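(* Let $\theta\in(0,1)$. There exist a constant $C(\Omega,\theta)>0$, independent of the time steps and of the mesh diameter $h$, and an absolute constant $C>0$, such that the following holds. Let $(u_n^{j,h},p_n^{j,h})_{0\le n\le N}$, $j=1,\dots,J$, be produced by the variable time-stepping DLN-Ensemble algorithm with parameter $\theta$ (described in the context) with source functions $f^j$ satisfying $f^j\in \ell^{2,\beta}(\{t_n\}_{n=0}^N;X^{-1})$ for all $j$. Suppose the CFL-like conditions $$1 - C(\Omega,\theta)\Big(\frac{1+\varepsilon_n\theta}{1-\varepsilon_n}\Big)^2\frac{\widehat k_n}{h\nu}\big\|\nabla\big(u_{n,\ast}^{j,h}-\langle u^h\rangle_{n,\ast}\big)\big\|^2\ \ge 0,\qquad j=1,\dots,J,\ n=1,\dots,N-1,$$ hold. Then for every $j=1,\dots,J$ and every $M=2,3,\dots,N$, $$\frac{1+\theta}{4}\|u_M^{j,h}\|^2+\frac{1-\theta}{4}\|u_{M-1}^{j,h}\|^2+\sum_{n=1}^{M-1}\frac{\theta(1-\theta^2)}{4(1+\varepsilon_n\theta)^2}\|U_n^{j,h}\|^2+\sum_{n=1}^{M-1}\frac{\nu\widehat k_n}{4}\|\nabla u_{n,\beta}^{j,h}\|^2$$ $$\le \frac{C}{\nu}\,\||f^j|\|_{2,-1,\beta}^2+\frac{1+\theta}{4}\|u_1^{j,h}\|^2+\frac{1-\theta}{4}\|u_0^{j,h}\|^2,$$ where $U_n^{j,h}=\frac{1-\varepsilon_n}{2}u_{n+1}^{j,h}-u_n^{j,h}+\frac{1+\vareps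ilon_n}{2}u_{n-1}^{j,h}$.
   Context: **Time grid and DLN coefficients.** $0=t_0<t_1<\dots<t_N=T$, $k_n=t_{n+1}-t_n$. For $1\le n\le N-1$: $\varepsilon_n=\frac{k_n-k_{n-1}}{k_n+k_{n-1}}\in(-1,1)$. For a parameter $\theta\in[0,1]$: $\alpha_2=\frac{\theta+1}{2}$, $\alpha_1=-\theta$, $\alpha_0=\frac{\theta-1}{2}$; $\widehat k_n=\alpha_2k_n-\alpha_0k_{n-1}$; $\beta_2^{(n)}=\frac14\big(1+\frac{1-\theta^2}{(1+\varepsilon_n\theta)^2}+\varepsilon_n^2\frac{\theta(1-\theta^2)}{(1+\varepsilon_n\theta)^2}+\theta\big)$, $\beta_1^{(n)}=\frac12\big(1-\frac{1-\theta^2}{(1+\varepsilon_n\theta)^2}\big)$, $\beta_0^{(n)}=\frac14\big(1+\frac{1-\theta^2}{(1+\varepsilon_n\theta)^2}-\varepsilon_n^2\frac{\theta(1-\theta^2)}{(1+\varepsilon_n\theta)^2}-\theta\big)$. For any sequence $\{z_n\}_{n=0}^N$ (including $z_n=t_n$): $z_{n,\alpha}=\sum_{\ell=0}^2\alpha_\ell z_{n-1+\ell}$, $z_{n,\beta}=\sum_{\ell=0}^2\beta_\ell^{(n)}z_{n-1+\ell}$, $z_{n,\ast}=\big(\beta_2^{(n)}(1+\frac{k_n}{k_{n-1}})+\beta_1^{(n)}\big)z_n+\big(\beta_0^{(n)}-\beta_2^{(n)}\frac{k_n}{k_{n-1}}\big)z_{n-1}$. **Spaces.** $\Omega\subset\mathbb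 R^d$ ($d=2,3$) is the flow domain, $\nu>0$ the viscosity; $\|\cdot\|$, $(\cdot,\cdot)$ are the $L^2(\Omega)$ norm and inner product; $\|\cdot\|_\ell$ and $|\cdot|_\ell$ are the $H^\ell(\Omega)$ norm and seminorm. $X=\{v\in (H^1(\Omega))^d: v|_{\partial\Omega}=0\}$, $Q=\{q\in L^2(\Omega):(q,1)=0\}$; $X^{-1}$ is the dual of $X$ with $\|g\|_{-1}=\sup_{0\ne v\in X}(g,v)/\|\nabla v\|$. $b(u,v,w)=\frac12((u\cdot\nabla)v,w)-\frac12((u\cdot\nabla)w,v)$. **Discrete norm.** $\||f|\|_{2,-1,\beta}=\big(\sum_{n=1}^{N-1}(k_n+k_{n-1})\|f(\cdot,t_{n,\beta})\|_{-1}^2\big)^{1/2}$, and $f\in\ell^{2,\beta}(\{t_n\};X^{-1})$ means $f(\cdot,t)\in X^{-1}$ for $0<t<T$ and this norm is finite. **Finite elements.** $X^h\subset X$, $Q^h\subset Q$ are finite element spaces on edge-to-edge triangulations of $\Omega$ of diameter $h\in(0,1]$, containing polynomials up to degree $r$ and $s$ respectively ($r,s\in\mathbb N$), and of class $C^m$. Standing assumptions (constants independent of $h$): for $u\in (H^{r+1})^d\cap X$, $p\in H^{s+1}\cap Q$, $\inf_{v^h\in X^h}\|u-v^h\|_{\ell_1}\le Ch^{r+1-\ell_1}|u|_{r+1}$ for $0\le\ell_1\le\min\{m+1,r+1\}$ and $\inf_{q^h\in Q^h}\|p-q^h\|_{\ell_2}\le Ch^{s+1-\ell_2}|p|_{s+1}$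 for $0\le\ell_2\le\min\{m+1,s+1\}$; inverse inequality $|v^h|_1\le C(\Omega)h^{-1}\|v^h\|$ for $v^h\in X^h$; discrete inf-sup condition $\inf_{q^h\in Q^h}\sup_{v^h\in X^h}\frac{(\nabla\cdot v^h,q^h)}{\|\nabla v^h\|\|q^h\|}\ge C_{\mathrm{is}}>0$. Constants written $C(\Omega,\dots)$ may also depend on the constants in these inequalities for the fixed finite element family. **Problem and algorithm.** For $j=1,\dots,J$ ($J>1$) consider $u^j_t+(u^j\cdot\nabla)u^j-\nu\Delta u^j+\nabla p^j=f^j$, $\nabla\cdot u^j=0$, $\int_\Omega p^j=0$ on $\Omega\times(0,T)$, $u^j|_{\partial\Omega}=0$, $u^j(\cdot,0)=u_0^j$. DLN-Ensemble algorithm: given starting values $u_0^{j,h},u_1^{j,h}\in X^h$, $p_0^{j,h},p_1^{j,h}\in Q^h$, for $n=1,\dots,N-1$ and $j=1,\dots,J$ find $u_{n+1}^{j,h}\in X^h$, $p_{n+1}^{j,h}\in Q^h$ such that for all $v^h\in X^h$, $q^h\in Q^h$, $$\Big(\frac{u_{n,\alpha}^{j,h}}{\widehat k_n},v^h\Big)+b(\langle u^h\rangle_{n,\ast},u_{n,\beta}^{j,h},v^h)-(p_{n,\beta}^{j,h},\nabla\cdot v^h)+\nu(\nabla u_{n,\beta}^{j,h},\nabla v^h)=(f^j(t_{n,\beta}),v^h)-b(u_{n,\ast}^{j,h}-\langle u^h\rangle_{n,\ast},u_{n,\ast}^{j,h},v^h),$$ $$(\nabla\cdot u_{n,\beta}^{j,h},q^h)=0,$$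 where $\langle u^h\rangle_{n,\ast}=\frac1J\sum_{j=1}^Ju_{n,\ast}^{j,h}$. *)

(* Defs.v *)
From HB Require Import structures.
From mathcomp Require Import all_boot all_order all_algebra.
From mathcomp Require Import all_classical all_reals all_analysis.

Set Implicit Arguments.
Unset Strict Implicit.
Unset Printing Implicit Defensive.

Import Order.TTheory GRing.Theory Num.Theory.
Import numFieldNormedType.Exports.

Local Open Scope classical_set_scope.
Local Open Scope ring_scope.

(* Lebesgue measure on R^d.  Row vectors carry the sigma-algebra generated by *)
(* the coordinates (the Borel sets); the measure is built by adding one       *)
(* coordinate at a time, through the product measure of the library.          *)

Definition rV_display : measure_display.
Proof. exact. Qed.

Section rV_measurable.
Context (R : realType) (d : nat).

Definition coord (i : 'I_d) (x : 'rV[R]_d) : R := x 0 i.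

Let rV_set0 : g_sigma_preimage coord set0.
Proof. exact: sigma_algebra0. Qed.

Let rV_setC A : g_sigma_preimage coord A -> g_sigma_preimage coord (~` A).
Proof. exact: sigma_algebraC. Qed.

Let rV_bigcup (F : _^nat) : (forall i, g_sigma_preimage coord (F i)) ->
  g_sigma_preimage coord (\bigcup_i (F i)).
Proof. exact: sigma_algebra_bigcup. Qed.

HB.instance Definition _ := @isMeasurable.Build rV_display
  'rV[R]_d (g_sigma_preimage coord) rV_set0 rV_setC rV_bigcup.

Lemma measurable_coord i : measurable_fun [set: 'rV[R]_d] (coord i).
Proof.
move=> _ Y mY; rewrite setTI; apply: sub_sigma_algebra => /=.
rewrite -bigcup_seq/=; exists i => /=; first by rewrite mem_index_enum.
by exists Y => //; rewrite setTI.
Qed.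

Lemma measurable_fun_coordP d1 (T1 : measurableType d1) (f : T1 -> 'rV[R]_d) :
  (forall i, measurable_fun [set: T1] (coord i \o f)) ->
  measurable_fun [set: T1] f.
Proof.
move=> mf.
suff : g_sigma_preimage (fun i => coord i \o f) `<=` measurable.
  rewrite g_sigma_preimage_comp => prefS _ A mA.
  by apply: prefS; exists A.
apply: smallest_sub; first exact: sigma_algebra_measurable.
rewrite -bigcup_seq; apply: bigcup_sub => i _ A [B mB <-]; exact: mf.
Qed.

End rV_measurable.

Section lebesgue_rV.
Context (R : realType).

Definition rV_cons d (p : 'rV[R]_d * measurableTypeR R) : 'rV[R]_d.+1 :=
  \row_i oapp (p.1 0) (p.2 : R) (unlift ord0 i).

Lemma measurable_rV_cons d : measurable_fun setT (@rV_cons d).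
Proof.
apply: measurable_fun_coordP => i.
case: (unliftP ord0 i) => [j|] ->.
- rewrite (_ : _ \o _ = coord j \o fst); last first.
    by apply/funext => p; rewrite /coord /rV_cons /= mxE liftK.
  by apply: measurableT_comp => //; exact: measurable_coord.
- rewrite (_ : _ \o _ = snd) //.
  by apply/funext => p; rewrite /coord /rV_cons /= mxE unlift_none.
Qed.

Fixpoint lebesgue_rV d : {measure set 'rV[R]_d -> \bar R} :=
  match d with
  | 0%N => [the {measure set 'rV[R]_0 -> \bar R} of \d_(0 : 'rV[R]_0)]
  | d'.+1 =>
      (* pushforward of the product measure along rV_cons *)
      measure_function_pushforward__canonical__measure_function_Measure
        [the {measure set ('rV[R]_d' * measurableTypeR R) -> \bar R} of
          (lebesgue_rV d' \x (@lebesgue_measure R))%E]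
        (@measurable_rV_cons d')
  end.

End lebesgue_rV.

Section function_spaces.
Context (R : realType) (d : nat).
Local Notation E := 'rV[R]_d.
Local Notation leb := (lebesgue_rV R d).
Implicit Types (Om : set E) (f g q : E -> R) (u v w : E -> E).

Definition is_domain Om :=
  [/\ open Om, connected Om, Om !=set0 & bounded_set Om].

Definition comp v (i : 'I_d) : E -> R := fun x => v x 0 i.

(* Iterated classical partial derivatives, along a list of directions. *)
Definition pderiv (i : 'I_d) f : E -> R := fun x => 'D_(delta_mx 0 i) f x.
Definition pderivs (s : seq 'I_d) f : E -> R := foldr pderiv f s.

Definition Cm (A : set E) (m : nat) f := forall s : seq 'I_d,
  ((size s <= m)%N -> forall x, A x -> {for x, continuous (pderivs s f)}) /\
  ((size s < m)%N -> forall x, A x -> forall i : 'I_d,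
     derivable (pderivs s f) x (delta_mx 0 i)).

Definition test_fun Om f := (forall m, Cm setT m f) /\
  exists K : set E, [/\ compact K, K `<=` Om & forall x, ~ K x -> f x = 0].

(* Elements of L^2 and of the Sobolev spaces are represented by functions on  *)
(* R^d, of which only the restriction to Om matters.                          *)
Definition L2 Om f :=
  measurable_fun Om f /\ (\int[leb]_(x in Om) (f x ^+ 2)%:E < +oo)%E.

Definition ip Om f g : R := \int[leb]_(x in Om) (f x * g x).
Definition l2norm Om f : R := Num.sqrt (ip Om f f).

Definition vip Om u v : R := \sum_i ip Om (comp u i) (comp v i).
Definition vl2norm Om v : R := Num.sqrt (vip Om v v).

Definition is_weak_deriv Om (s : seq 'I_d) f g := forall phi, test_fun Om phi ->
  ip Om f (pderivs s phi) = (-1) ^+ size s * ip Om g phi.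

(* The weak derivative in L^2(Om), unique up to a null set of Om; 0 if there  *)
(* is none.                                                                   *)
Definition weak_deriv Om (s : seq 'I_d) f : E -> R :=
  xget (cst 0) [set g : E -> R | L2 Om g /\ is_weak_deriv Om s f g].

Definition in_H Om (l : nat) f := L2 Om f /\ forall s : seq 'I_d,
  (size s <= l)%N -> exists g, L2 Om g /\ is_weak_deriv Om s f g.
Definition in_vH Om l v := forall i, in_H Om l (comp v i).

Definition multi_seq n (a : {ffun 'I_d -> 'I_n}) : seq 'I_d :=
  flatten [seq nseq (a i) i | i <- enum 'I_d].

(* |f|_l and ||f||_l, with one term for each multi-index. *)
Definition Hsemi Om l f : R := Num.sqrt
  (\sum_(a : {ffun 'I_d -> 'I_l.+1} | (\sum_i a i == l)%N)
     l2norm Om (weak_deriv Om (multi_seq a) f) ^+ 2).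
Definition Hnorm Om l f : R := Num.sqrt (\sum_(k < l.+1) Hsemi Om k f ^+ 2).
Definition vHsemi Om l v : R := Num.sqrt (\sum_i Hsemi Om l (comp v i) ^+ 2).
Definition vHnorm Om l v : R := Num.sqrt (\sum_i Hnorm Om l (comp v i) ^+ 2).

(* (grad u, grad v), ||grad v|| and div v, with weak derivatives. *)
Definition grad_ip Om u v : R := \sum_i \sum_j
  ip Om (weak_deriv Om [:: j] (comp u i)) (weak_deriv Om [:: j] (comp v i)).
Definition grad_norm Om v : R := Num.sqrt (grad_ip Om v v).
Definition div Om v : E -> R :=
  fun x => \sum_i weak_deriv Om [:: i] (comp v i) x.

(* (u . grad) v *)
Definition convec Om u v : E -> E :=
  fun x => \row_i \sum_j u x 0 j * weak_deriv Om [:: j] (comp v i) x.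

Definition b Om u v w : R :=
  2^-1 * vip Om (convec Om u v) w - 2^-1 * vip Om (convec Om u w) v.

(* Vanishing on the boundary is understood in the usual sense for H^1         *)
(* functions on an arbitrary domain: being an H^1 limit of test functions.    *)
Definition spaceX Om : set (E -> E) := [set v | in_vH Om 1 v /\
  forall i (e : R), 0 < e ->
    exists2 phi, test_fun Om phi & Hnorm Om 1 (comp v i - phi) < e].

Definition spaceQ Om : set (E -> R) :=
  [set q | L2 Om q /\ \int[leb]_(x in Om) q x = 0].

(* Elements of X^{-1} are the bounded linear functionals on X; g v is (g, v). *)
Definition in_dual Om (g : (E -> E) -> R) :=
  (forall (a : R) u v, spaceX Om u -> spaceX Om v ->
     g (a *: u + v) = a * g u + g v) /\
  exists C : R, forall v, spaceX Om v -> `|g v| <= C * grad_norm Om v.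

Definition dual_norm Om (g : (E -> E) -> R) : \bar R :=
  ereal_sup [set (g v / grad_norm Om v)%:E |
    v in [set v | spaceX Om v /\ vl2norm Om v != 0]].

End function_spaces.

Section finite_elements.
Context (R : realType) (d : nat).
Local Notation E := 'rV[R]_d.

Definition poly_fun (n : nat) (p : E -> R) :=
  exists c : {ffun 'I_d -> 'I_n.+1} -> R, p = fun x =>
    \sum_(a : {ffun 'I_d -> 'I_n.+1} | (\sum_i a i <= n)%N)
      c a * \prod_i x 0 i ^+ a i.

(* Simplices are given by their d+1 vertices. *)
Definition face (K : {ffun 'I_d.+1 -> E}) (S : {set 'I_d.+1}) : set E :=
  [set x | exists c : 'I_d.+1 -> R,
    [/\ forall i, 0 <= c i, forall i, i \notin S -> c i = 0,
        \sum_i c i = 1 & x = \sum_i c i *: K i]].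
Definition simplex (K : {ffun 'I_d.+1 -> E}) : set E := face K [set: 'I_d.+1].

Definition affine_indep (K : {ffun 'I_d.+1 -> E}) :=
  row_free (\matrix_(i < d) (K (lift ord0 i) - K ord0)).

Definition diam (A : set E) : R := sup [set z | exists x y,
  [/\ A x, A y & z = Num.sqrt (\sum_i (x 0 i - y 0 i) ^+ 2)]].

(* Edge-to-edge: two simplices meet along the face spanned by their common    *)
(* vertices (which is empty if there are none).                               *)
Definition triangulation (Om : set E) (h : R) (Th : seq {ffun 'I_d.+1 -> E}) :=
  [/\ forall K, K \in Th -> affine_indep K /\ interior (simplex K) `<=` Om,
      closure Om = \bigcup_(K in [set` Th]) simplex K,
      forall K L, K \in Th -> L \in Th ->
        simplex K `&` simplex L = face K [set i | K i \in codom L]%SET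
    & h = \big[Num.max/0]_(K <- Th) diam (simplex K)].

Definition piecewise_poly (Om : set E) (Th : seq {ffun 'I_d.+1 -> E})
    (f : E -> R) := forall K, K \in Th ->
  exists n p, poly_fun n p /\ forall x, simplex K x -> Om x -> f x = p x.

Definition span_of (V : lmodType R) n (e : 'I_n -> V) : set V :=
  [set v | exists c : 'I_n -> R, v = \sum_i c i *: e i].

(* The polynomials are contained in the finite element space before the       *)
(* boundary condition, resp. the zero mean condition, is imposed.             *)
Definition fe_velocity Om Th (m r : nat) (Xh : set (E -> E)) :=
  exists n (e : 'I_n -> (E -> E)),
  [/\ forall k i, Cm Om m (comp (e k) i) /\ piecewise_poly Om Th (comp (e k) i),
      forall p : E -> E, (forall i, poly_fun r (comp p i)) ->
        exists2 v, span_of e v & forall x, Om x -> v x = p x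
    & Xh = span_of e `&` spaceX Om].

Definition fe_pressure Om Th (m s : nat) (Qh : set (E -> R)) :=
  exists n (e : 'I_n -> (E -> R)),
  [/\ forall k, Cm Om m (e k) /\ piecewise_poly Om Th (e k),
      forall p : E -> R, poly_fun s p ->
        exists2 q, span_of e q & forall x, Om x -> q x = p x
    & Qh = span_of e `&` spaceQ Om].

(* What is common to all the members of a finite element family: degrees,     *)
(* smoothness, and the constants of the standing inequalities.                *)
Record fe_consts := FeConsts {
  fe_r : nat; fe_s : nat; fe_m : nat;
  fe_CX : R; fe_CQ : R; fe_Cinv : R; fe_Cis : R }.

Definition fe_pair (Om : set E) (F : fe_consts) (h : R)
    (Xh : set (E -> E)) (Qh : set (E -> R)) :=
  (exists Th, [/\ triangulation Om h Th,
     fe_velocity Om Th (fe_m F) (fe_r F) Xh &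
     fe_pressure Om Th (fe_m F) (fe_s F) Qh]) /\
  [/\ forall u, in_vH Om (fe_r F).+1 u -> spaceX Om u ->
        forall l, (l <= minn (fe_m F).+1 (fe_r F).+1)%N ->
        (ereal_inf [set (vHnorm Om l (u - v))%:E | v in Xh] <=
         (fe_CX F * h ^+ ((fe_r F).+1 - l) * vHsemi Om (fe_r F).+1 u)%:E)%E,
      forall p, in_H Om (fe_s F).+1 p -> spaceQ Om p ->
        forall l, (l <= minn (fe_m F).+1 (fe_s F).+1)%N ->
        (ereal_inf [set (Hnorm Om l (p - q))%:E | q in Qh] <=
         (fe_CQ F * h ^+ ((fe_s F).+1 - l) * Hsemi Om (fe_s F).+1 p)%:E)%E,
      forall v, Xh v -> vHsemi Om 1 v <= fe_Cinv F * h^-1 * vl2norm Om v,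
      0 < fe_Cis F
    & ((fe_Cis F)%:E <= ereal_inf [set
        ereal_sup [set (ip Om (div Om v) q /
                        (grad_norm Om v * l2norm Om q))%:E |
          v in [set v | Xh v /\ vl2norm Om v != 0%R]] |
        q in [set q | Qh q /\ l2norm Om q != 0%R]])%E].

End finite_elements.

Section DLN.
Context (R : realType).
Implicit Types (theta e : R) (t : nat -> R) (n N : nat).

Definition time_grid (T : R) N t :=
  [/\ t 0%N = 0, t N = T & forall n, (n < N)%N -> t n < t n.+1].

Definition step t n : R := t n.+1 - t n.
Definition eps t n : R :=
  (step t n - step t n.-1) / (step t n + step t n.-1).

Definition alpha theta (l : nat) : R :=
  match l with
  | 0 => (theta - 1) / 2
  | 1 => - theta
  | _ => (theta + 1) / 2
  end.

(* beta_l^{(n)} is beta theta (eps t n) l. *)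
Definition beta theta e (l : nat) : R :=
  let A := (1 - theta ^+ 2) / (1 + e * theta) ^+ 2 in
  let B := e ^+ 2 * (theta * (1 - theta ^+ 2) / (1 + e * theta) ^+ 2) in
  match l with
  | 0 => 4^-1 * (1 + A - B - theta)
  | 1 => 2^-1 * (1 - A)
  | _ => 4^-1 * (1 + A + B + theta)
  end.

Definition khat theta t n : R :=
  alpha theta 2 * step t n - alpha theta 0 * step t n.-1.

Definition avg_alpha (V : lmodType R) theta (z : nat -> V) n : V :=
  \sum_(l < 3) alpha theta l *: z (n.-1 + l)%N.
Definition avg_beta (V : lmodType R) theta t (z : nat -> V) n : V :=
  \sum_(l < 3) beta theta (eps t n) l *: z (n.-1 + l)%N.
Definition avg_star (V : lmodType R) theta t (z : nat -> V) n : V :=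
  let be := beta theta (eps t n) in
  let rho := step t n / step t n.-1 in
  (be 2 * (1 + rho) + be 1) *: z n + (be 0 - be 2 * rho) *: z n.-1.

Definition t_beta theta t n : R := @avg_beta R^o theta t t n.

Definition diff2 (V : lmodType R) t (z : nat -> V) n : V :=
  ((1 - eps t n) / 2) *: z n.+1 - z n + ((1 + eps t n) / 2) *: z n.-1.

End DLN.

Section ensemble.
Context (R : realType) (d : nat).
Local Notation E := 'rV[R]_d.

(* |||f|||_{2,-1,beta}, for f mapping a time to a functional on X. *)
Definition dln_norm (Om : set E) (theta : R) N t
    (f : R -> (E -> E) -> R) : \bar R :=
  sqrte (\sum_(1 <= n < N)
    (step t n + step t n.-1)%:E * dual_norm Om (f (t_beta theta t n)) ^+ 2)%E.

Definition in_l2beta (Om : set E) (theta T : R) N t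
    (f : R -> (E -> E) -> R) :=
  (forall s, 0 < s < T -> in_dual Om (f s)) /\
  (dln_norm Om theta N t f < +oo)%E.

(* <u>_{n,*} *)
Definition mean_star J (theta : R) t (u : 'I_J -> nat -> (E -> E)) n : E -> E :=
  J%:R^-1 *: \sum_j avg_star theta t (u j) n.

Definition dln_ensemble (Om : set E) (nu theta : R) N t J
    (Xh : set (E -> E)) (Qh : set (E -> R))
    (f : 'I_J -> R -> (E -> E) -> R)
    (u : 'I_J -> nat -> (E -> E)) (p : 'I_J -> nat -> (E -> R)) :=
  (forall j n, (n <= N)%N -> Xh (u j n) /\ Qh (p j n)) /\
  forall n j, (1 <= n < N)%N ->
    let ub := avg_beta theta t (u j) n in
    let us := avg_star theta t (u j) n in
    let um := mean_star theta t u n in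
    (forall v, Xh v ->
       vip Om ((khat theta t n)^-1 *: avg_alpha theta (u j) n) v
       + b Om um ub v
       - ip Om (avg_beta theta t (p j) n) (div Om v)
       + nu * grad_ip Om ub v
       = f j (t_beta theta t n) v - b Om (us - um) us v) /\
    (forall q, Qh q -> ip Om (div Om ub) q = 0).

End ensemble.

(* Main.v *)
Require Import Defs.
From HB Require Import structures.
From mathcomp Require Import all_boot all_order all_algebra.
From mathcomp Require Import all_classical all_reals all_analysis.
From mathcomp Require Import measurable_realfun ring lra.

Set Implicit Arguments.
Unset Strict Implicit.
Unset Printing Implicit Defensive.

Import Order.TTheory GRing.Theory Num.Theory.
Import numFieldNormedType.Exports.

Local Open Scope classical_set_scope.
Local Open Scope ring_scope.

(** The energy estimate is obtained by testing the momentum equation with the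
    average u_beta of the iterates. Three facts make this work.

    First, the inner product of u_alpha and u_beta is the increment of the
    energy (1 + theta)/4 |u_(n+1)|^2 + (1 - theta)/4 |u_n|^2 plus a positive
    multiple of |U_n|^2, where U_n is the second difference: an identity of
    quadratic forms ([g_stability], [vip_alpha_beta]).

    Second, the convection form vanishes when its last two arguments agree.
    This removes the implicit convection term, and lets the explicit one be
    rewritten with u_star replaced by u_star - u_beta, which is a multiple of
    U_n ([avg_beta_star]). What is left is b(w, U_n, u_beta), where w is the
    deviation of u_star from its ensemble mean.

    Third, on the finite element space,
      |b(w, U, v)| <= C h^(-1/2) |U| |grad w| |grad v|    ([b_le_fe]).
    By Young's inequality the term is then absorbed, half by the viscosity and
    half by the numerical dissipation; the latter is where the condition on
    the time step enters ([energy_absorb]). The source is bounded by the dual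
    norm and by a quarter of the viscous term ([source_le]), and the
    inequalities of the single steps are added up ([telescope_ereal]).

    The power -1/2 of h in the third fact is the analytical core. The
    derivative falling on U is moved to w and v ([ibp_triple]), so that by
    Cauchy-Schwarz it is enough to bound the integral of w^2 U^2. By the
    inequalities of Cauchy-Schwarz and Young it is at most a multiple of
    |grad w|^2 |grad U| |U| ([ip_mul_le]), given the embedding of H^1_0 into
    L^6, and the inverse inequality applied to U gives the power of h. In both
    dimensions the embedding comes from Gagliardo's argument, which bounds the
    fourth power of a test function by integrals of its derivative along the
    coordinate lines ([sobolev6]); it passes to bounded elements of H^1_0,
    such as finite element functions, by density ([sobolev_H10]).

    Weak derivatives are only chosen up to null sets. They are handled through
    the fundamental lemma of the calculus of variations
    ([test_fun_orthogonal]), which rests on smooth cut-offs of boxes built from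
    exp(-1/x), and through the fact that partial derivatives of test functions
    are also weak derivatives ([integral_pderiv0]). *)

(** * Borel sets of R^d *)

Section borel_rV.
Context (R : realType) (d : nat).
Local Notation E := 'rV[R]_d.

Definition obox (a b : E) : set E := [set x | forall i, a 0 i < x 0 i < b 0 i].
Definition cbox (a b : E) : set E := [set x | forall i, a 0 i <= x 0 i <= b 0 i].

Lemma obox_sub_cbox a b : obox a b `<=` cbox a b.
Proof. by move=> x abx i; have /andP[ax xb] := abx i; rewrite !ltW. Qed.

Lemma measurable_obox a b : measurable (obox a b).
Proof.
rewrite (_ : obox a b = \big[setI/setT]_(i < d) (@Defs.coord R d i @^-1` `]a 0 i, b 0 i[)).
  apply: bigsetI_measurable => i _; rewrite -[X in measurable X]setTI.
  by apply: measurable_coord => //; exact: measurable_itv.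
rewrite -bigcap_seq; apply/seteqP; split => [x abx i _ /=|x abx i].
  by rewrite /Defs.coord in_itv /= abx.
by have := abx i (mem_index_enum i); rewrite /Defs.coord /= in_itv.
Qed.

Definition qvec (q : 'rV[rat]_d) : E := map_mx (@ratr R) q.

(** The closed boxes, not only the open ones, are kept inside [U]: cut-off
    functions of the open boxes are then compactly supported in [U]. *)
Lemma open_rat_boxes (U : set E) : open U ->
  U = \bigcup_(q : 'rV[rat]_d * 'rV[rat]_d)
        (if `[< cbox (qvec q.1) (qvec q.2) `<=` U >]
         then obox (qvec q.1) (qvec q.2) else set0).
Proof.
move=> oU; apply/seteqP; split => [x Ux|x [q _]]; last first.
  by case: asboolP => // qU /obox_sub_cbox; exact: qU.
have /nbhs_ballP[e /= e0 eU] : nbhs x U by apply: open_nbhs_nbhs.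
have near (i : 'I_d) : exists q : rat * rat,
    x 0 i - e < ratr q.1 < x 0 i /\ x 0 i < ratr q.2 < x 0 i + e.
  have [q1 h1] := @rat_in_itvoo R (x 0 i - e) (x 0 i) ltac:(by rewrite ltrBlDr ltrDl).
  have [q2 h2] := @rat_in_itvoo R (x 0 i) (x 0 i + e) ltac:(by rewrite ltrDl).
  by exists (q1, q2); move: h1 h2; rewrite !in_itv.
have [q qP] := choice near.
exists (\row_i (q i).1, \row_i (q i).2) => //=.
case: asboolP => [_ i|[]].
  by rewrite !mxE; have [/andP[_ ->] /andP[->]] := qP i.
move=> y yq; apply: eU; split=> // i j; rewrite ord1 => {i}.
rewrite /ball /= /ball_ /=.
have := yq j; rewrite !mxE; have [] := qP j.
by rewrite ltr_distl => /andP[? ?] /andP[? ?] /andP[? ?]; lra.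
Qed.

Lemma open_measurable_rV (U : set E) : open U -> measurable U.
Proof.
move=> oU; rewrite (open_rat_boxes oU).
apply: countable_bigcupT_measurable => // q.
by case: ifP => // _; exact: measurable_obox.
Qed.

Lemma continuous_measurable_rV (f : E -> R) (D : set E) :
  measurable D -> continuous f -> measurable_fun D f.
Proof.
move=> mD cf; apply: (measurable_funS measurableT) => //.
apply: (measurability _ (RGenOpens.measurableE R)).
move=> _ [_ [a [b ->] <-]]; rewrite setTI.
apply: open_measurable_rV; move/continuousP : cf; apply; exact: interval_open.
Qed.

(** The sets cut out by finitely many strict lower bounds on coordinates form
    a pi-system that generates the Borel sets and, unlike boxes, contains the
    whole space. *)
Definition orthants : set (set E) :=
  [set A | exists s : seq ('I_d * R), A = [set x : E | forall p, p \in s -> p.2 < x 0 p.1]].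

Lemma orthants_setI : setI_closed orthants.
Proof.
move=> _ _ [s ->] [s' ->]; exists (s ++ s'); apply/seteqP; split.
  by move=> x [xs xs'] p; rewrite mem_cat => /orP[/xs|/xs'].
by move=> x xss; split => p ps; apply: xss; rewrite mem_cat ps ?orbT.
Qed.

Lemma measurable_orthants : @measurable _ E = <<s orthants >>.
Proof.
apply/seteqP; split.
  apply: smallest_sub; first exact: smallest_sigma_algebra.
  rewrite -bigcup_seq => A [i _ [B mB <-]]; rewrite setTI.
  have sa : sigma_algebra setT [set C : set R | <<s orthants >> (@Defs.coord R d i @^-1` C)].
    split.
    - by rewrite /= preimage_set0; apply: sigma_algebra0.
    - move=> C /= mC; rewrite setTD preimage_setC -setTD.
      by apply: (sigma_algebraCD).
    - move=> F mF /=; rewrite preimage_bigcup.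
      exact: sigma_algebra_bigcup.
  have sub : <<s @RGenOInfty.G R >> `<=`
      [set C : set R | <<s orthants >> (@Defs.coord R d i @^-1` C)]; last first.
    apply: sub; suff: (@RGenOInfty.G R).-sigma.-measurable B by [].
    by rewrite -RGenOInfty.measurableE.
  apply: smallest_sub sa _ => _ [x ->] /=.
  apply: sub_sigma_algebra; exists [:: (i, x)]; apply/seteqP; split.
    by move=> y /=; rewrite in_itv/= andbT => xy p; rewrite inE => /eqP ->.
  by move=> y /(_ (i, x)) /=; rewrite in_itv /= andbT inE eqxx => /(_ erefl).
apply: smallest_sub; first exact: sigma_algebra_measurable.
move=> _ [s ->].
elim: s => [|p s IH]; first by rewrite (_ : [set _ | _] = setT) //; apply/seteqP.
rewrite (_ : [set _ | _] = (@Defs.coord R d p.1 @^-1` `]p.2, +oo[) `&`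
    [set x : E | forall p, p \in s -> p.2 < x 0 p.1]).
  apply: measurableI IH; rewrite -[X in measurable X]setTI.
  by apply: measurable_coord => //; exact: measurable_itv.
apply/seteqP; split => [x xs|x [xp xs] q].
  split => [|q qs]; last by apply: xs; rewrite inE qs orbT.
  by rewrite /Defs.coord /= in_itv /= andbT; apply: xs; rewrite inE eqxx.
rewrite inE => /orP[/eqP ->|]; last exact: xs.
by move: xp; rewrite /Defs.coord /= in_itv /= andbT.
Qed.

End borel_rV.

(** * Functions flat at the origin *)

Section flat_functions.
Context (R : realType).
Implicit Types (P : {poly R}) (x : R).

(** The functions P(1/x) exp(-1/x) on x > 0, extended by zero: a class stable
    under differentiation, whose members are all flat at the origin. *)
Definition flat P x : R := if 0 < x then P.[x^-1] * expR (- x^-1) else 0.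

Lemma horner_le_pow P : exists2 C : R, 0 <= C &
  forall y : R, 1 <= y -> `|P.[y]| <= C * y ^+ (size P).
Proof.
exists (\sum_(i < size P) `|P`_i|) => [|y y1]; first by apply: sumr_ge0.
rewrite horner_coef mulr_suml (le_trans (ler_norm_sum _ _ _))//.
apply: ler_sum => i _; rewrite normrM ler_wpM2l// ger0_norm ?exprn_ge0 ?(le_trans _ y1)//.
by rewrite ler_weXn2l// ltnW.
Qed.

(** The exponential beats every power of 1/x; a quadratic bound is what
    differentiability at the origin asks for. *)
Lemma flat_le_sqr P : exists2 C : R, 0 <= C &
  forall x, `|x| < 1 -> `|flat P x| <= C * `|x| ^+ 2.
Proof.
have [C C0 PC] := horner_le_pow P.
set n := size P; exists (C * (n.+2)`!%:R) => [|x x1]; first by rewrite mulr_ge0.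
rewrite /flat; case: ifPn => [x0|_]; last first.
  by rewrite normr0 !mulr_ge0.
rewrite (gtr0_norm x0) in x1 *.
set y := x^-1.
have y1 : 1 <= y by rewrite /y invf_ge1// ltW.
have y0 : 0 < y by rewrite (lt_le_trans _ y1).
rewrite normrM (gtr0_norm (expR_gt0 _)).
have -> : x ^+ 2 = y ^- 2 by rewrite /y exprVn invrK.
have e1 : y ^+ n.+2 / n.+2`!%:R <= expR y.
  by apply: le_trans (expR_ge1Dxn n.+1 (ltW y0)); rewrite lerDr.
have f0 : 0 < n.+2`!%:R :> R by rewrite ltr0n fact_gt0.
have -> : expR (- y) = (expR y)^-1 by rewrite expRN.
apply: le_trans (_ : C * y ^+ n * (y ^+ n.+2 / n.+2`!%:R)^-1 <= _).
  apply: ler_pM => //; first exact: PC.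
  by rewrite lef_pV2// posrE ?expR_gt0// divr_gt0// exprn_gt0.
rewrite invf_div -!mulrA ler_wpM2l//.
rewrite mulrCA ler_wpM2l ?(ltW f0)//.
rewrite -addn2 exprD invfM mulrA divff ?mul1r// expf_neq0// gt_eqF//.
Qed.

Lemma is_derive_flat P x :
  is_derive x 1 (flat P) (flat ('X^2 * (P - P^`())) x).
Proof.
have [x0|x0|->] := ltgtP x 0.
- rewrite /flat (lt_gtF x0).
  apply: (near_eq_is_derive (f := cst 0)).
    near=> y; rewrite /= /flat ifN// -leNgt ltW//.
    by near: y; exact: lt_nbhsl.
- rewrite [flat _ x]/flat x0.
  apply: (@near_eq_is_derive R R R (fun y : R => P.[y^-1] * expR (- y^-1))).
    near=> y; rewrite /= /flat ifT//.
    by near: y; exact: lt_nbhsr.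
  have dV : is_derive x 1 (fun y : R => y^-1) (- x ^- 2).
    have := @is_deriveV R id x 1 1 (lt0r_neq0 x0) (is_derive_id _ _).
    by rewrite /= [_ *: _]mulr1.
  have dP : is_derive x 1 (fun y => P.[y^-1]) (P^`().[x^-1] * - x ^- 2).
    have dH : is_derive x^-1 1 (horner P) P^`().[x^-1].
      by apply: DeriveDef; [exact: derivable_horner|rewrite derivE derive1E].
    exact: (@is_derive1_comp R (horner P) (fun y : R => y^-1) x _ _ dH dV).
  have dN : is_derive x 1 (fun y : R => - y^-1) (x ^- 2).
    by have := @is_deriveN R R R _ x 1 _ dV; rewrite opprK.
  have dE : is_derive x 1 (fun y => expR (- y^-1)) (expR (- x^-1) * x ^- 2).
    exact: (@is_derive1_comp R expR (fun y : R => - y^-1) x _ _ (is_derive_expR _) dN).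
  apply: (is_derive_eq (@is_deriveM _ _ _ _ x 1 _ _ dP dE)).
  by rewrite !hornerE /GRing.scale /= -exprVn; ring.
- rewrite {2}/flat ltxx.
  have [C C0 PC] := flat_le_sqr P.
  have cv : (fun h => h^-1 *: ((flat P \o shift (0 : R)) (h *: 1) - flat P 0)) @ (0 : R)^' --> (0 : R).
    apply/cvgrPdist_le => e e0; near=> h.
    rewrite sub0r normrN /= addr0 {2}/flat ltxx subr0 [h *: 1]mulr1 normrZ normfV.
    have h1 : `|h| < 1 by near: h; apply: dnbhs0_lt.
    have he : C * `|h| <= e.
      apply: (@le_trans _ _ ((C + 1) * `|h|)); first by rewrite ler_wpM2r// lerDl.
      rewrite mulrC -ler_pdivlMr ?ltr_wpDl//.
      by near: h; apply: dnbhs0_le; rewrite divr_gt0// ltr_wpDl.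
    have hn0 : 0 < `|h| by rewrite normr_gt0; near: h; exact: nbhs_dnbhs_neq.
    rewrite ler_pdivrMl//; apply: le_trans (PC _ h1) _.
    by rewrite expr2 mulrA mulrC ler_wpM2l.
  by apply: DeriveDef; [apply/cvg_ex; exists 0|exact: cvg_lim].
Unshelve. all: by end_near. Qed.

Definition flat1 x : R := flat 1 x.

Lemma flat1_gt0 x : 0 < x -> flat1 x = expR (- x^-1).
Proof. by move=> x0; rewrite /flat1 /flat x0 hornerC mul1r. Qed.

Lemma flat1_le0 x : x <= 0 -> flat1 x = 0.
Proof. by move=> x0; rewrite /flat1 /flat ltNge x0. Qed.

Lemma flat1_ge0 x : 0 <= flat1 x.
Proof. by case: (leP x 0) => [/flat1_le0->|/flat1_gt0->] //; exact: expR_ge0. Qed.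

Lemma flat1_le1 x : flat1 x <= 1.
Proof.
case: (leP x 0) => [/flat1_le0->|x0] //; rewrite flat1_gt0//.
by rewrite -expR0 ler_expR oppr_le0 invr_ge0 ltW.
Qed.

(** Dilations turn the smooth function [flat1] into cut-offs that converge to
    the indicator of the positive reals. *)
Lemma cvg_flat1 x : (fun n : nat => flat1 (n%:R * x)) @ \oo --> ((0 < x)%R%:R : R).
Proof.
case: (ltP 0 x) => x0; last first.
  apply: cvg_near_cst; near=> n; rewrite flat1_le0//.
  by rewrite mulr_ge0_le0.
have -> : true%:R = expR (- 0) :> R by rewrite oppr0 expR0.
apply: (cvg_trans (G := (fun n : nat => expR (- (n%:R^-1 * x^-1))) @ \oo)).
  apply: near_eq_cvg; near=> n.
  rewrite flat1_gt0 ?invfM// mulr_gt0// ltr0n.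
  by near: n; exact: nbhs_infty_gt.
apply: continuous_cvg; first exact: continuous_expR.
apply: cvgN; rewrite -[X in _ --> X](mul0r x^-1); apply: cvgMr_tmp.
rewrite -(@cvg_shiftS R); exact: cvg_harmonic.
Unshelve. all: by end_near. Qed.

End flat_functions.

(** * Smooth functions and test functions *)

Section smooth_functions.
Context (R : realType) (d : nat).
Local Notation E := 'rV[R]_d.
Implicit Types (f g phi psi : E -> R) (Om : set E).

(** Directional derivatives are derivatives of functions of one variable. *)
Lemma is_derive_along f (x v : E) (df : R) :
  is_derive (0 : R) 1 (fun h : R => f (h *: v + x)) df -> is_derive x v f df.
Proof.
move=> [dv dval]; apply: DeriveDef; first exact/derivable1P.
rewrite -dval /derive.
suff -> : (fun h : R => h^-1 *: (((fun s : R => f (s *: v + x)) \o shift 0) (h *: (1 : R)) -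
     f (0 *: v + x))) = (fun h : R => h^-1 *: ((f \o shift x) (h *: v) - f x)) by [].
by apply/funext => h /=; rewrite addr0 scale0r add0r [h%:A]mulr1.
Qed.

Lemma is_derive_line f (x v : E) (t : R) : derivable f (t *: v + x) v ->
  is_derive t 1 (fun h : R => f (h *: v + x)) ('D_v f (t *: v + x)).
Proof.
have E1 : (fun h : R => h^-1 *: (((fun s : R => f (s *: v + x)) \o shift t) (h *: (1 : R)) -
     f (t *: v + x))) =
   (fun h : R => h^-1 *: ((f \o shift (t *: v + x)) (h *: v) - f (t *: v + x))).
  by apply/funext => h /=; rewrite [h%:A]mulr1 scalerDl addrA.
by move=> df; apply: DeriveDef; rewrite /derivable /derive E1.
Qed.

Definition smooth f := forall m, Cm setT m f.

Lemma smooth_pderivs f (s : seq 'I_d) : smooth f -> smooth (pderivs s f).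
Proof.
move=> sf m s'.
have := sf (size (s' ++ s)).+1 (s' ++ s).
rewrite /pderivs foldr_cat => -[cf df]; split=> [_|_]; last exact: df.
by apply: cf.
Qed.

Lemma smooth_pderiv f i : smooth f -> smooth (pderiv i f).
Proof. by move=> sf; exact: (smooth_pderivs [:: i] sf). Qed.

Lemma smooth_continuous f : smooth f -> continuous f.
Proof. by move=> sf x; have [cf _] := sf 0%N [::]; exact: (cf isT x I). Qed.

Lemma smooth_derivable f x i : smooth f -> derivable f x (delta_mx 0 i).
Proof. by move=> sf; have [_ df] := sf 1%N [::]; exact: (df isT x I i). Qed.

(** The derivative taken first is the last one of the list of directions, so
    that induction on the list fits badly with closure properties; a set of
    functions stable under one derivative avoids the lists altogether. *)
Lemma smooth_coind (S : set (E -> R)) :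
  (forall g, S g -> continuous g /\
     forall i, (forall x, derivable g x (delta_mx 0 i)) /\ S (pderiv i g)) ->
  forall f, S f -> smooth f.
Proof.
move=> HS f Sf.
have {Sf}SS s : S (pderivs s f).
  by elim: s => [|i s IH] //=; have [_ /(_ i)[]] := HS _ IH.
move=> m s; have [cs ds] := HS _ (SS s).
split=> [_ x _|_ x _ i]; first exact: cs.
by have [] := ds i.
Qed.

(** Leibniz' rule leaves the set of products of smooth functions, but not
    the algebra that they generate. *)
Inductive smooth_alg : (E -> R) -> Prop :=
| SA_smooth f : smooth f -> smooth_alg f
| SA_add f g : smooth_alg f -> smooth_alg g -> smooth_alg (f + g)
| SA_mul f g : smooth_alg f -> smooth_alg g -> smooth_alg (f * g).

Lemma pderivM f g i : (forall x, derivable f x (delta_mx 0 i)) ->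
  (forall x, derivable g x (delta_mx 0 i)) ->
  pderiv i (f * g) = pderiv i f * g + f * pderiv i g.
Proof.
move=> df dg; apply/funext => x.
rewrite -[RHS]/(pderiv i f x * g x + f x * pderiv i g x) /pderiv.
by rewrite (deriveM (df x) (dg x)) addrC [pderiv i f x * _]mulrC [X in _ + X = _]/GRing.scale.
Qed.

Lemma pderivD f g i : (forall x, derivable f x (delta_mx 0 i)) ->
  (forall x, derivable g x (delta_mx 0 i)) ->
  pderiv i (f + g) = pderiv i f + pderiv i g.
Proof. by move=> df dg; apply/funext => x; rewrite /pderiv /= deriveD. Qed.

Lemma smooth_alg_smooth f : smooth_alg f -> smooth f.
Proof.
apply: (smooth_coind (S := smooth_alg)) => {f} f; elim => {f}.
- move=> f sf; split; first exact: smooth_continuous.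
  move=> i; split=> [x|]; first exact: smooth_derivable.
  exact/SA_smooth/smooth_pderiv.
- move=> f g af [cf df] ag [cg dg]; split.
    by move=> x; apply: continuousD; [exact: cf|exact: cg].
  move=> i; have [dfi sfi] := df i; have [dgi sgi] := dg i.
  split=> [x|]; first exact: derivableD.
  by rewrite pderivD//; exact: SA_add.
- move=> f g af [cf df] ag [cg dg]; split.
    by move=> x; apply: continuousM; [exact: cf|exact: cg].
  move=> i; have [dfi sfi] := df i; have [dgi sgi] := dg i.
  split=> [x|]; first exact: derivableM.
  by rewrite pderivM//; apply: SA_add; exact: SA_mul.
Qed.

Lemma smoothD f g : smooth f -> smooth g -> smooth (f + g).
Proof. by move=> sf sg; apply/smooth_alg_smooth/SA_add; exact: SA_smooth. Qed.

Lemma smoothM f g : smooth f -> smooth g -> smooth (f * g).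
Proof. by move=> sf sg; apply/smooth_alg_smooth/SA_mul; exact: SA_smooth. Qed.

Lemma pderiv_cst (c : R) i : pderiv i (cst c : E -> R) = cst 0.
Proof. by apply/funext => x; rewrite /pderiv derive_cst. Qed.

Lemma smooth_cst (c : R) : smooth (cst c).
Proof.
apply: (smooth_coind (S := [set f | exists c : R, f = cst c])); last by exists c.
move=> _ [a ->]; split; first exact: cst_continuous.
move=> i; split; first by move=> x; exact: derivable_cst.
by exists 0; rewrite pderiv_cst.
Qed.

Lemma smoothZ (a : R) f : smooth f -> smooth (a *: f).
Proof. by move=> sf; have := smoothM (smooth_cst a) sf. Qed.

Lemma is_derive_flat_coord (P : {poly R}) (c e : R) (i : 'I_d) (x v : E) :
  is_derive x v (fun y : E => flat P (c * y 0 i + e))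
    (flat ('X^2 * (P - P^`())) (c * x 0 i + e) * (c * v 0 i)).
Proof.
apply: is_derive_along.
pose l (h : R) := h * (c * v 0 i) + (c * x 0 i + e).
have -> : (fun h => flat P (c * (h *: v + x) 0 i + e)) = flat P \o l.
  by apply/funext => h; rewrite /= /l !mxE; congr flat; ring.
have l0 : l 0 = c * x 0 i + e by rewrite /l mul0r add0r.
have dl : is_derive (0 : R) 1 l (c * v 0 i).
  by apply: is_derive_eq; rewrite /GRing.scale /=; ring.
rewrite -l0; exact: (is_derive1_comp (is_derive_flat P (l 0)) dl).
Qed.

(** Up to scalars, the functions of this form are stable under partial
    derivatives; their products are cut-offs of boxes. *)
Lemma smooth_flat_coord (P : {poly R}) (c e : R) (i : 'I_d) :
  smooth (fun y : E => flat P (c * y 0 i + e)).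
Proof.
apply: (smooth_coind (S := [set f | exists (a : R) (Q : {poly R}),
    f = fun y : E => a * flat Q (c * y 0 i + e)])); last first.
  by exists 1, P; apply/funext => y; rewrite mul1r.
move=> _ [a [Q ->]].
have dQ (x v : E) : is_derive x v (fun y : E => a * flat Q (c * y 0 i + e))
    (a * (flat ('X^2 * (Q - Q^`())) (c * x 0 i + e) * (c * v 0 i))).
  exact: (is_deriveZ a (is_derive_flat_coord Q c e i x v)).
split.
  have cl : continuous (fun y : E => c * y 0 i + e).
    move=> x; have h := @coord_continuous R 1 d 0 i x.
    exact: (cvgD (cvgMl_tmp (a := c) h) (cvg_cst e)).
  have cf : continuous (flat Q).
    move=> t; apply/differentiable_continuous/derivable1_diffP.
    by have [] := is_derive_flat Q t.
  have cc : continuous (flat Q \o (fun y : E => c * y 0 i + e)).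
    by move=> x; apply: continuous_comp; [exact: cl|exact: cf].
  by move=> x; apply: (@cvgMl_tmp R _ _ _ _ a _ (cc x)).
move=> j; split; first by move=> x; have [] := dQ x (delta_mx 0 j).
exists (a * (c * (i == j)%:R)), ('X^2 * (Q - Q^`())).
apply/funext => x; rewrite /pderiv (derive_val (is_derive := dQ x _)).
by rewrite mxE eqxx /= eq_sym; ring.
Qed.

Lemma pderiv_support (K : set E) f i : closed K -> (forall x, ~ K x -> f x = 0) ->
  forall x, ~ K x -> pderiv i f x = 0.
Proof.
move=> cK fK x Kx; rewrite /pderiv -(derive_cst 0 x (delta_mx 0 i)).
apply: near_eq_derive.
have : nbhs x (~` K) by apply: open_nbhs_nbhs; split=> //; exact: closed_openC.
by apply: filterS => y /= /fK.
Qed.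

Lemma rV_compact_closed (K : set E) : compact K -> closed K.
Proof. by move=> cK; apply: compact_closed => //; exact: norm_hausdorff. Qed.

Lemma test_fun_smooth Om phi : test_fun Om phi -> smooth phi.
Proof. by case. Qed.

Lemma test_fun_mul Om phi g : test_fun Om phi -> smooth g -> test_fun Om (phi * g).
Proof.
move=> [sphi [K [cK KO phiK]]] sg; split; first exact: smoothM.
by exists K; split=> // x /phiK phi0; rewrite -[LHS]/(phi x * g x) phi0 mul0r.
Qed.

Lemma test_funZ Om (a : R) phi : test_fun Om phi -> test_fun Om (a *: phi).
Proof.
move=> [sphi [K [cK KO phiK]]]; split; first exact: smoothZ.
by exists K; split=> // x /phiK phi0; rewrite -[LHS]/(a * phi x) phi0 mulr0.
Qed.

Lemma test_funD Om phi psi : test_fun Om phi -> test_fun Om psi ->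
  test_fun Om (phi + psi).
Proof.
move=> [sphi [K [cK KO phiK]]] [spsi [L [cL LO psiL]]]; split; first exact: smoothD.
exists (K `|` L); split; first exact: compactU.
  by move=> x [/KO|/LO].
by move=> x /not_orP[/phiK h /psiL k]; rewrite -[LHS]/(phi x + psi x) h k addr0.
Qed.

Lemma test_fun_pderiv Om phi i : test_fun Om phi -> test_fun Om (pderiv i phi).
Proof.
move=> [sphi [K [cK KO phiK]]]; split; first exact: smooth_pderiv.
by exists K; split=> //; apply: pderiv_support => //; exact: rV_compact_closed.
Qed.

Lemma test_fun_bounded Om phi : test_fun Om phi -> exists M : R, forall x, `|phi x| <= M.
Proof.
move=> [sphi [K [cK _ phiK]]].
have /compact_bounded[M [_ HM]] : compact (phi @` K).
  apply: continuous_compact => //.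
  by apply: continuous_subspaceT; exact: smooth_continuous.
exists (Num.max 0 (M + 1)) => x; have [Kx|/phiK ->] := pselect (K x).
  rewrite le_max; apply/orP; right; apply: (HM (M + 1)); last by exists x.
  by rewrite ltrDl.
by rewrite normr0 le_max lexx.
Qed.

End smooth_functions.

(** * Lebesgue measure of bounded sets and square integrable functions *)

Section lebesgue_rV_finite.
Context (R : realType).

Lemma lebesgue_rVS d (A : set 'rV[R]_d.+1) :
  lebesgue_rV R d.+1 A =
  (lebesgue_rV R d \x (@lebesgue_measure R))%E (@rV_cons R d @^-1` A).
Proof. by []. Qed.

Lemma measurable_cbox d (a b : 'rV[R]_d) : measurable (cbox a b).
Proof.
rewrite (_ : cbox a b = \big[setI/setT]_(i < d) (@Defs.coord R d i @^-1` `[a 0 i, b 0 i])).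
  apply: bigsetI_measurable => i _; rewrite -[X in measurable X]setTI.
  by apply: measurable_coord => //; exact: measurable_itv.
rewrite -bigcap_seq; apply/seteqP; split => [x abx i _ /=|x abx i].
  by rewrite /Defs.coord in_itv /= abx.
by have := abx i (mem_index_enum i); rewrite /Defs.coord /= in_itv.
Qed.

Lemma lebesgue_rV_cbox d (a b : 'rV[R]_d) : (lebesgue_rV R d (cbox a b) < +oo)%E.
Proof.
elim: d a b => [|d IH] a b; first by rewrite /= diracE ltry.
rewrite lebesgue_rVS (_ : _ @^-1` _ =
  cbox (\row_i a 0 (lift ord0 i)) (\row_i b 0 (lift ord0 i)) `*`
  [set` `[a 0 ord0, b 0 ord0]]).
  rewrite product_measure1E//; last exact: measurable_cbox.
  have fin : (@lebesgue_measure R [set` `[a 0%R ord0, b 0%R ord0]] < +oo)%E.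
    by rewrite lebesgue_measure_itv /=; case: ifP => _; rewrite ltry.
  by rewrite lte_mul_pinfty// ge0_fin_numE.
apply/seteqP; split => [[x y] /= abx|[x y] /= [abx aby] i].
  split; last by have := abx ord0; rewrite mxE unlift_none /= in_itv.
  by move=> i; have := abx (lift ord0 i); rewrite !mxE liftK.
case: (unliftP ord0 i) => [j|] ->; rewrite mxE.
  by have := abx j; rewrite liftK !mxE.
by rewrite unlift_none /=; move: aby; rewrite in_itv.
Qed.

Lemma lebesgue_rV_sigma_finite d : sigma_finite setT (lebesgue_rV R d).
Proof.
exists (fun n : nat => cbox (const_mx (- n%:R)) (const_mx n%:R)); last first.
  by move=> n; split; [exact: measurable_cbox|exact: lebesgue_rV_cbox].
apply/esym/seteqP; split=> // x _.
pose n := (Num.truncn `|x|).+1.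
exists n => // i; rewrite !mxE -ler_norml ltW//.
apply: le_lt_trans (truncnS_gt _).
rewrite [leRHS]mx_normrE.
by rewrite (le_bigmax _ (fun j : 'I_1 * 'I_d => `|x j.1 j.2|) (0, i)).
Qed.

(** A name for the measure to which the sigma-finite structure, on which
    Tonelli's theorem relies, is attached. *)
Definition lebf d : set 'rV[R]_d -> \bar R := lebesgue_rV R d.

HB.instance Definition _ d := isMeasure.Build _ _ _ (@lebf d)
  (measure0 (lebesgue_rV R d)) (measure_ge0 (lebesgue_rV R d))
  (@measure_semi_sigma_additive _ _ _ (lebesgue_rV R d)).

HB.instance Definition _ d := Measure_isSigmaFinite.Build _ _ _
  (@lebf d) (@lebesgue_rV_sigma_finite d).

Lemma bounded_set_cbox d (A : set 'rV[R]_d) : bounded_set A ->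
  exists2 M : R, 0 < M & A `<=` cbox (const_mx (- M)) (const_mx M).
Proof.
move=> [M [_ AM]]; pose N := Num.max 1 (M + 1); exists N.
  by rewrite lt_max ltr01.
move=> x Ax i; rewrite !mxE -ler_norml.
have MN : M < N by rewrite lt_max ltrDl ltr01 orbT.
apply: le_trans (AM N MN _ Ax).
rewrite [leRHS]mx_normrE.
by rewrite (le_bigmax _ (fun j : 'I_1 * 'I_d => `|x j.1 j.2|) (0, i)).
Qed.

Lemma lebesgue_rV_bounded d (A : set 'rV[R]_d) : measurable A -> bounded_set A ->
  (lebesgue_rV R d A < +oo)%E.
Proof.
move=> mA /bounded_set_cbox[M _ AM].
apply: le_lt_trans (lebesgue_rV_cbox (const_mx (- M)) (const_mx M)).
by apply: le_measure => //; rewrite inE//; exact: measurable_cbox.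
Qed.

End lebesgue_rV_finite.

Section square_integrable.
Context (R : realType) (d : nat) (Om : set 'rV[R]_d).
Hypothesis mOm : measurable Om.
Local Notation E := 'rV[R]_d.
Local Notation leb := (lebesgue_rV R d).
Implicit Types (f g k : E -> R).

(** By 2 |f g| <= f^2 + g^2. *)
Lemma L2_integrableM f g : L2 Om f -> L2 Om g ->
  leb.-integrable Om (EFin \o (f * g)).
Proof.
move=> [mf if2] [mg ig2].
have i2 (h : E -> R) : measurable_fun Om h -> (\int[leb]_(x in Om) (h x ^+ 2)%:E < +oo)%E ->
    leb.-integrable Om (fun x => (h x ^+ 2)%:E).
  move=> mh ih; apply/integrableP; split.
    by apply/measurable_EFinP; exact: measurable_funX.
  by under eq_integral do rewrite gee0_abs ?lee_fin ?sqr_ge0//.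
apply: (le_integrable mOm _ _ (integrableD mOm (i2 _ mf if2) (i2 _ mg ig2))).
  by apply/measurable_EFinP; exact: measurable_funM.
move=> x _; rewrite -EFinD !abse_EFin lee_fin.
rewrite [X in _ <= X]ger0_norm ?addr_ge0 ?sqr_ge0//.
rewrite -[(f * g) x]/(f x * g x) normrM -(real_normK (num_real (f x))) -(real_normK (num_real (g x))).
have := sqr_ge0 (`|f x| - `|g x|); have := normr_ge0 (f x); have := normr_ge0 (g x).
nra.
Qed.

Lemma L2_sqr_integrable f : L2 Om f -> leb.-integrable Om (EFin \o (f * f)).
Proof. by move=> Lf; exact: L2_integrableM. Qed.

Lemma L2P f : measurable_fun Om f -> leb.-integrable Om (EFin \o (f * f)) -> L2 Om f.
Proof.
move=> mf /integrableP[_ If]; split=> //; apply: le_lt_trans If.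
apply: ge0_le_integral => //.
- by move=> x _; rewrite lee_fin sqr_ge0.
- by apply/measurable_EFinP; exact: measurable_funX.
- by apply: measurableT_comp => //; apply/measurable_EFinP; exact: measurable_funM.
- by move=> x _; rewrite abse_EFin lee_fin expr2 ler_norm.
Qed.

Lemma L2D f g : L2 Om f -> L2 Om g -> L2 Om (f + g).
Proof.
move=> Lf Lg; apply: L2P; first by apply: measurable_funD; [case: Lf|case: Lg].
have fg := L2_integrableM Lf Lg.
have -> : EFin \o ((f + g) * (f + g)) =
    ((EFin \o (f * f)) \+ (EFin \o (f * g))) \+ ((EFin \o (f * g)) \+ (EFin \o (g * g))).
  apply/funext => x /=.
  rewrite -!EFinD; congr EFin.
  rewrite -[LHS]/((f x + g x) * (f x + g x)) -[RHS]/(f x * f x + f x * g x + (f x * g x + g x * g x)).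
  ring.
by do !apply: integrableD => //; exact: L2_sqr_integrable.
Qed.

Lemma L2_bounded_mul f k (M : R) : L2 Om f -> measurable_fun Om k ->
  (forall x, Om x -> `|k x| <= M) -> L2 Om (f * k).
Proof.
move=> Lf mk kM; have [mf _] := Lf.
apply: L2P; first exact: measurable_funM.
apply: (le_integrable mOm _ _ (integrableZl mOm (M ^+ 2) (L2_sqr_integrable Lf))).
  by apply/measurable_EFinP; do 2?apply: measurable_funM => //.
move=> x Ox; rewrite -EFinM !abse_EFin lee_fin.
rewrite -[(f * k * (f * k)) x]/(f x * k x * (f x * k x)) -[(f * f) x]/(f x * f x).
rewrite mulrACA (normrM (f x * f x)) (normrM (M ^+ 2)) mulrC ler_wpM2r//.
by rewrite -expr2 !normrX ler_sqr ?nnegrE// (le_trans (kM _ Ox))// ler_norm.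
Qed.

Lemma L2Z (a : R) f : L2 Om f -> L2 Om (a *: f).
Proof.
move=> Lf; have := L2_bounded_mul Lf (measurable_cst a) (fun x _ => lexx `|a|).
by rewrite mulrC.
Qed.

Lemma L2B f g : L2 Om f -> L2 Om g -> L2 Om (f - g).
Proof. by move=> Lf Lg; rewrite -scaleN1r; apply: L2D => //; exact: L2Z. Qed.

Lemma L2_0 : L2 Om 0.
Proof.
split; first exact: measurable_cst.
rewrite integral0_eq ?ltry// => x _.
by rewrite -[(0 : E -> R) x]/(0 : R) expr0n.
Qed.

Lemma L2_sum (I : Type) (r : seq I) (P : pred I) (F : I -> E -> R) :
  (forall i, L2 Om (F i)) -> L2 Om (\sum_(i <- r | P i) F i).
Proof. by move=> LF; elim/big_ind: _ => //; [exact: L2_0|exact: L2D]. Qed.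

Lemma L2_bounded k (M : R) : (leb Om < +oo)%E -> measurable_fun Om k ->
  (forall x, Om x -> `|k x| <= M) -> L2 Om k.
Proof.
move=> fOm mk kM; rewrite -[k]mul1r; apply: L2_bounded_mul kM => //.
split; first exact: measurable_cst.
under eq_integral do rewrite -[(1 : E -> R) _]/(1 : R) expr1n.
by rewrite integral_cst// mul1e.
Qed.

Lemma ipC f g : ip Om f g = ip Om g f.
Proof. by apply: eq_Rintegral => x _; rewrite mulrC. Qed.

Lemma ipDl f g k : L2 Om f -> L2 Om g -> L2 Om k ->
  ip Om (f + g) k = ip Om f k + ip Om g k.
Proof.
move=> Lf Lg Lk; rewrite /ip -RintegralD//; try exact: L2_integrableM.
by apply: eq_Rintegral => x _; rewrite -mulrDl.
Qed.

Lemma ipZl (a : R) f k : L2 Om f -> L2 Om k -> ip Om (a *: f) k = a * ip Om f k.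
Proof.
move=> Lf Lk; rewrite /ip -RintegralZl//; last exact: L2_integrableM.
by apply: eq_Rintegral => x _; rewrite mulrA.
Qed.

Lemma ipDr f g k : L2 Om f -> L2 Om g -> L2 Om k ->
  ip Om k (f + g) = ip Om k f + ip Om k g.
Proof. by move=> *; rewrite ipC ipDl// !(ipC k). Qed.

Lemma ipZr (a : R) f k : L2 Om f -> L2 Om k -> ip Om k (a *: f) = a * ip Om k f.
Proof. by move=> *; rewrite ipC ipZl// ipC. Qed.

Lemma ipBl f g k : L2 Om f -> L2 Om g -> L2 Om k ->
  ip Om (f - g) k = ip Om f k - ip Om g k.
Proof.
by move=> *; rewrite -scaleN1r ipDl ?ipZl ?mulN1r//; exact: L2Z.
Qed.

Lemma ipBr f g k : L2 Om f -> L2 Om g -> L2 Om k ->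
  ip Om k (f - g) = ip Om k f - ip Om k g.
Proof. by move=> *; rewrite ipC ipBl// !(ipC k). Qed.

Lemma ip0l k : ip Om 0 k = 0.
Proof.
rewrite /ip; under eq_Rintegral do rewrite -[(0 : E -> R) _]/(0 : R) mul0r.
by rewrite /Rintegral integral0.
Qed.

Lemma ip_suml (I : Type) (r : seq I) (P : pred I) (F : I -> E -> R) k :
  (forall i, L2 Om (F i)) -> L2 Om k ->
  ip Om (\sum_(i <- r | P i) F i) k = \sum_(i <- r | P i) ip Om (F i) k.
Proof.
move=> LF Lk; elim: r => [|i r IH]; first by rewrite !big_nil ip0l.
rewrite !big_cons; case: ifP => // _; rewrite ipDl ?IH//; exact: L2_sum.
Qed.

Lemma ip_mulA f g k : ip Om (f * g) k = ip Om f (g * k).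
Proof. by apply: eq_Rintegral => x _; rewrite -mulrA. Qed.

Lemma ip_ge0 f : 0 <= ip Om f f.
Proof. by apply: Rintegral_ge0 => x _; rewrite -expr2 sqr_ge0. Qed.

Lemma l2norm_ge0 f : 0 <= l2norm Om f.
Proof. exact: sqrtr_ge0. Qed.

Lemma sqr_l2norm f : l2norm Om f ^+ 2 = ip Om f f.
Proof. by rewrite sqr_sqrtr// ip_ge0. Qed.

(** The quadratic function t |-> |f + t g|^2 has no negative value. *)
Lemma cauchy_schwarz_sqr f g : L2 Om f -> L2 Om g ->
  ip Om f g ^+ 2 <= ip Om f f * ip Om g g.
Proof.
move=> Lf Lg.
have H (t : R) : 0 <= ip Om f f + t * ip Om f g *+ 2 + t ^+ 2 * ip Om g g.
  have := ip_ge0 (f + t *: g); have Ltg := L2Z t Lg.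
  rewrite ipDl ?ipDr//; last exact: L2D.
  by rewrite !ipZl ?ipZr// (ipC g f) => ?; nra.
set a := ip Om f f; set b := ip Om f g; set c := ip Om g g.
rewrite -/a -/b -/c in H.
have a0 : 0 <= a by exact: ip_ge0.
have c0 : 0 <= c by exact: ip_ge0.
have [c1|c1] := ltP 0 c.
  have := H (- b / c).
  have -> : a + - b / c * b *+ 2 + (- b / c) ^+ 2 * c = (a * c - b ^+ 2) / c.
    by field; rewrite gt_eqF.
  by rewrite pmulr_lge0 ?invr_gt0// subr_ge0.
have c00 : c = 0 by apply/eqP; rewrite eq_le c1.
rewrite c00 mulr0.
have [->|b0] := eqVneq b 0; first by rewrite expr0n.
have := H (- (a + 1) / (b *+ 2)).
have -> : a + - (a + 1) / (b *+ 2) * b *+ 2 + (- (a + 1) / (b *+ 2)) ^+ 2 * c = - 1.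
  by rewrite c00; field.
by rewrite lerNr oppr0 ler10.
Qed.

Lemma cauchy_schwarz f g : L2 Om f -> L2 Om g ->
  `|ip Om f g| <= l2norm Om f * l2norm Om g.
Proof.
move=> Lf Lg; rewrite -ler_sqr ?nnegrE ?mulr_ge0 ?l2norm_ge0//.
by rewrite real_normK ?num_real// exprMn !sqr_l2norm cauchy_schwarz_sqr.
Qed.

Lemma l2norm0_ip f g : L2 Om f -> L2 Om g -> ip Om f f = 0 -> ip Om f g = 0.
Proof.
move=> Lf Lg f0; apply/eqP; rewrite -normr_le0.
by apply: le_trans (cauchy_schwarz Lf Lg) _; rewrite {1}/l2norm f0 sqrtr0 mul0r.
Qed.

Lemma l2normD f g : L2 Om f -> L2 Om g ->
  l2norm Om (f + g) <= l2norm Om f + l2norm Om g.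
Proof.
move=> Lf Lg; rewrite -ler_sqr ?nnegrE ?addr_ge0 ?l2norm_ge0//.
rewrite sqr_l2norm ipDl ?ipDr//; last exact: L2D.
rewrite (ipC g f) sqrrD !sqr_l2norm.
by have := le_trans (ler_norm _) (cauchy_schwarz Lf Lg); lra.
Qed.

Lemma l2normZ (a : R) f : L2 Om f -> l2norm Om (a *: f) = `|a| * l2norm Om f.
Proof.
move=> Lf; rewrite /l2norm ipZl ?ipZr//; last exact: L2Z.
by rewrite mulrA -expr2 sqrtrM ?sqr_ge0// sqrtr_sqr.
Qed.

End square_integrable.

(** * The fundamental lemma of the calculus of variations *)

Section box_bumps.
Context (R : realType) (d : nat).
Local Notation E := 'rV[R]_d.
Local Notation leb := (lebesgue_rV R d).
Implicit Types (a b x : E) (Om : set E).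

Lemma closed_cbox a b : closed (cbox a b).
Proof.
rewrite (_ : cbox a b = \bigcap_(i in [set: 'I_d]) ((fun x : E => x 0 i) @^-1` `[a 0 i, b 0 i])).
  apply: closed_bigI => i _; apply: closed_comp; last exact: itv_closed.
  by move=> x _; exact: coord_continuous.
apply/seteqP; split => [x abx i _ /=|x abx i]; first by rewrite in_itv /= abx.
by have := abx i I; rewrite /= in_itv.
Qed.

Lemma compact_cbox a b : compact (cbox a b).
Proof.
apply: bounded_closed_compact; last exact: closed_cbox.
exists (\sum_i (`|a 0 i| + `|b 0 i|)); split; first exact: num_real.
move=> M sM x abx; apply: le_trans (ltW sM).
rewrite [leLHS]mx_normrE; apply: bigmax_le; first by apply: sumr_ge0.
move=> [j i] _ /=; rewrite ord1 (bigD1 i)//= -[leLHS]addr0 lerD ?sumr_ge0//.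
have /andP[ax xb] := abx i; rewrite ler_norml; apply/andP; split.
  by have := ler_norm (- a 0 i); rewrite normrN; have := normr_ge0 (b 0 i); lra.
by have := ler_norm (b 0 i); have := normr_ge0 (a 0 i); lra.
Qed.

(** Smooth, with values in [0, 1], supported in the closed box, and converging
    to the indicator of the open box as [n] grows. *)
Definition box_bump a b (n : nat) : E -> R :=
  \prod_(i < d) ((fun x : E => flat1 ((n%:R : R) * x 0 i + - (n%:R * a 0 i))) *
                 (fun x : E => flat1 (- (n%:R : R) * x 0 i + n%:R * b 0 i))).

Lemma box_bumpE a b n x : box_bump a b n x =
  \prod_(i < d) (flat1 (n%:R * (x 0 i - a 0 i)) * flat1 (n%:R * (b 0 i - x 0 i))).
Proof.
rewrite /box_bump; elim/big_ind2 : _ => // [f r g s <- <-//|i _].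
rewrite -[LHS]/(flat1 _ * flat1 _).
by congr (flat1 _ * flat1 _); ring.
Qed.

Lemma box_bump_ge0 a b n x : 0 <= box_bump a b n x.
Proof. by rewrite box_bumpE; apply: prodr_ge0 => i _; rewrite mulr_ge0// flat1_ge0. Qed.

Lemma box_bump_le1 a b n x : box_bump a b n x <= 1.
Proof.
rewrite box_bumpE; apply: prodr_ile1 => i _.
by rewrite mulr_ge0 ?flat1_ge0//= mulr_ile1 ?flat1_ge0 ?flat1_le1.
Qed.

Lemma test_fun_box_bump Om a b n : cbox a b `<=` Om -> test_fun Om (box_bump a b n).
Proof.
move=> abO; split.
  apply: (big_ind (@smooth R d)); [exact: smooth_cst|exact: smoothM|].
  by move=> i _; apply: smoothM; exact: smooth_flat_coord.
exists (cbox a b); split=> //; first exact: compact_cbox.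
move=> x /existsNP[i /negP]; rewrite negb_and -!ltNge box_bumpE (bigD1 i)//=.
case/orP => h.
  by rewrite [X in X * _ * _]flat1_le0 ?mul0r// mulr_ge0_le0// subr_le0 ltW.
by rewrite [X in _ * X * _]flat1_le0 ?mulr0 ?mul0r// mulr_ge0_le0// subr_le0 ltW.
Qed.

Lemma cvg_box_bump a b x : (fun n : nat => box_bump a b n x) @ \oo -->
  ((x \in obox a b)%:R : R).
Proof.
have -> : (x \in obox a b)%:R =
    \prod_(i < d) (((0 < x 0 i - a 0 i)%R%:R : R) * (0 < b 0 i - x 0 i)%R%:R).
  case: (boolP (x \in obox a b)) => [/set_mem abx|].
    rewrite big1// => i _; have /andP[ax xb] := abx i.
    by rewrite !subr_gt0 ax xb mulr1.
  move=> /negP abx.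
  have [i /negP] : exists i, ~ (a 0 i < x 0 i < b 0 i).
    by apply/existsNP => h; apply: abx; apply/mem_set.
  rewrite negb_and (bigD1 i)//= !subr_gt0 => /orP[]/negPf->.
    by rewrite !mul0r.
  by rewrite mulr0 mul0r.
under eq_cvg do rewrite box_bumpE.
apply: (@cvg_big R _ *%R 1 predT _ nat \oo (index_enum 'I_d)
   (fun i n => flat1 (n%:R * (x 0 i - a 0 i)) * flat1 (n%:R * (b 0 i - x 0 i)))
   (fun i => ((0 < x 0 i - a 0 i)%R%:R : R) * (0 < b 0 i - x 0 i)%R%:R)).
  exact: mul_continuous.
by move=> i _; apply: cvgM; exact: cvg_flat1.
Qed.

End box_bumps.

Section fundamental_lemma.
Context (R : realType) (d : nat) (Om : set 'rV[R]_d).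
Hypotheses (oOm : open Om) (bOm : bounded_set Om).
Local Notation E := 'rV[R]_d.
Local Notation leb := (lebesgue_rV R d).
Variable g : E -> R.
Hypotheses (Lg : L2 Om g) (gT : forall phi, test_fun Om phi -> ip Om g phi = 0).

Let mOm : measurable Om. Proof. exact: open_measurable_rV. Qed.
Let fOm : (leb Om < +oo)%E. Proof. exact: lebesgue_rV_bounded. Qed.
Let mg : measurable_fun Om g. Proof. by case: Lg. Qed.

Let ig : leb.-integrable Om (EFin \o g).
Proof.
have L1 : L2 Om (cst 1).
  by apply: (@L2_bounded _ _ _ mOm _ 1) => // x _; rewrite normr1.
have := L2_integrableM mOm Lg L1; apply: eq_integrable => // x _ /=.
by rewrite -[(g * cst 1) x]/(g x * 1) mulr1.
Qed.

(** Dominated convergence along the bumps of the box. *)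
Let integral_obox a b : cbox a b `<=` Om -> (\int[leb]_(x in obox a b) (g x)%:E = 0)%E.
Proof.
move=> abO; have oO : obox a b `<=` Om by apply: subset_trans abO; exact: obox_sub_cbox.
pose f_ (n : nat) x := (g x * box_bump a b n x)%:E.
pose f x := (g x * (x \in obox a b)%:R)%:E.
have mbox n : measurable_fun Om (box_bump a b n).
  apply: continuous_measurable_rV => //; apply: smooth_continuous.
  exact: (test_fun_smooth (test_fun_box_bump n abO)).
have [] := @dominated_convergence _ E R leb Om mOm f_ f (fun x => `|(g x)%:E|%E).
- by move=> n; apply/measurable_EFinP; exact: measurable_funM.
- apply/measurable_EFinP; apply: measurable_funM => //.
  rewrite (_ : (fun x => _) = \1_(obox a b)); last by apply/funext => x; rewrite indicE.
  by apply: measurable_indic; exact: measurable_obox.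
- apply/aeW => x _; apply: cvg_EFin; first by exact: nearW.
  by apply: cvgMl_tmp; exact: cvg_box_bump.
- exact: integrable_abse.
- apply/aeW => x n _; rewrite !abse_EFin lee_fin normrM ler_piMr//.
  by rewrite ger0_norm ?box_bump_ge0 ?box_bump_le1.
move=> If _ cf.
have f0 n : (\int[leb]_(x in Om) f_ n x = 0)%E.
  have := gT (test_fun_box_bump n abO); rewrite /ip /Rintegral => e0.
  rewrite -[LHS]fineK ?e0//.
  have Lb : L2 Om (box_bump a b n).
    apply: (@L2_bounded _ _ _ mOm _ 1) => // x _.
    by rewrite ger0_norm ?box_bump_ge0 ?box_bump_le1.
  exact: (integrable_fin_num mOm (L2_integrableM mOm Lg Lb)).
have : (\int[leb]_(x in Om) f x = 0)%E.
  have e : (fun n => \int[leb]_(x in Om) f_ n x)%E = cst 0%E by apply/funext => n; exact: f0.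
  rewrite e in cf; apply: (cvg_unique _ cf); [exact: ereal_hausdorff|exact: cvg_cst].
move=> <-.
rewrite [LHS]integral_mkcond [RHS]integral_mkcond; apply: eq_integral => x _.
rewrite /patch /f; case: ifPn => xb; last by case: ifP => // _; rewrite mulr0.
by rewrite mem_set ?mulr1//; apply: oO; exact: set_mem.
Qed.

(** A box meets an orthant in a box with larger lower corner. *)
Let integral_obox_orthant (s : seq ('I_d * R)) a b : cbox a b `<=` Om ->
  (\int[leb]_(x in [set x : E | forall p, p \in s -> (p.2 < x 0 p.1)%R] `&` obox a b) (g x)%:E = 0)%E.
Proof.
elim: s a b => [|p s IH] a b abO.
  rewrite (_ : [set _ | _] = setT) ?setTI ?integral_obox//.
  by apply/seteqP; split.
pose a' : E := \row_i if i == p.1 then Num.max (a 0 i) p.2 else a 0 i.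
rewrite -(IH a' b); last first.
  apply: subset_trans abO => x h i; have := h i; rewrite mxE.
  by case: ifP => // _; rewrite ge_max => /andP[/andP[-> _] ->].
congr (integral _ _ _); apply/seteqP; split => x.
  move=> [xs abx]; split; first by move=> q qs; apply: xs; rewrite inE qs orbT.
  move=> i; rewrite mxE; have /andP[ax xb] := abx i; rewrite xb andbT.
  case: eqP => // ip; rewrite gt_max ax /= ip.
  by apply: xs; rewrite inE eqxx.
move=> [xs abx]; split.
  move=> q; rewrite inE => /orP[/eqP ->|]; last exact: xs.
  by have := abx p.1; rewrite mxE eqxx gt_max => /andP[/andP[]].
move=> i; have := abx i; rewrite mxE; case: ifP => // _.
by rewrite gt_max => /andP[/andP[-> _] ->].
Qed.

(** The sets on which the integral vanishes form a Dynkin system. *)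
Let integral_obox_measurable (A : set E) a b : measurable A -> cbox a b `<=` Om ->
  (\int[leb]_(x in A `&` obox a b) (g x)%:E = 0)%E.
Proof.
move=> mA abO; have oO : obox a b `<=` Om by apply: subset_trans abO; exact: obox_sub_cbox.
have mo := measurable_obox a b.
move: A mA; rewrite measurable_orthants.
apply: (dynkin_induction (@measurable_orthants R d) (@orthants_setI R d)).
- by rewrite setTI integral_obox.
- by move=> _ [s ->]; exact: integral_obox_orthant.
- move=> S mS S0; have := integral_obox abO.
  rewrite -{1}(setTI (obox a b)) -(setUv S) setIUl integral_setU ?S0 ?add0e//.
  + exact: measurableI.
  + by apply: measurableI => //; exact: measurableC.
  + apply: (measurable_funS mOm); last exact/measurable_EFinP.
    by rewrite -setIUl setUv setTI.
  + by rewrite disj_set2E setIACA setICr set0I.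
- move=> F mF tF F0; rewrite setI_bigcupl integral_bigcup.
  + by rewrite eseries0.
  + by apply: trivIset_setIr.
  + by move=> k; exact: measurableI.
  + apply: (integrableS mOm) ig.
      by apply: bigcupT_measurable => k; exact: measurableI.
    by move=> x [k _ [_ /oO]].
Qed.

(** An open set is covered by countably many of its boxes. *)
Let ae_zero : ae_eq leb Om (EFin \o g) (cst 0%E).
Proof.
pose B (q : 'rV[rat]_d * 'rV[rat]_d) : set E :=
  if `[< cbox (qvec R q.1) (qvec R q.2) `<=` Om >]
  then obox (qvec R q.1) (qvec R q.2) else set0.
have HB q : leb.-negligible [set x | B q x /\ g x != 0].
  rewrite /B; case: asboolP => [abO|_]; last first.
    by apply: (@negligibleS _ _ _ leb set0); [move=> x []|exact: negligible_set0].
  set Q := obox _ _.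
  have QO : Q `<=` Om by apply: subset_trans abO; exact: obox_sub_cbox.
  have mQ : measurable Q by exact: measurable_obox.
  have : ae_eq leb Q (EFin \o g) (cst 0%E).
    apply: integral_ae_eq => //; first exact: integrableS ig.
    move=> A AQ mA; rewrite integral0.
    have -> : A = A `&` Q by apply/esym/setIidPl.
    exact: integral_obox_measurable.
  apply: negligibleS => x [Qx gx] /= h; move: gx; apply/negP; rewrite negbK.
  by have [->] := h Qx.
apply: (@negligibleS _ _ _ leb
  (\bigcup_n (if unpickle n is Some q then [set x | B q x /\ g x != 0] else set0))).
  move=> x /= /not_implyP[Ox gx].
  have := Ox; rewrite {1}(open_rat_boxes oOm) => -[q _ Bq].
  exists (pickle q) => //; rewrite pickleK; split=> //.
  by apply/eqP => g0; apply: gx; rewrite g0.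
by apply: negligible_bigcup => n; case: unpickle => [q|] //; exact: negligible_set0.
Qed.

(** Fundamental lemma of the calculus of variations: it identifies functions
    known only through their integrals against test functions. *)
Lemma test_fun_orthogonal : ip Om g g = 0.
Proof.
rewrite /ip /Rintegral (ae_eq_integral (cst 0%E)) ?integral0//.
  exact/measurable_EFinP/measurable_funM.
apply: filterS ae_zero => x /= h /h [->].
by rewrite mul0r.
Qed.

End fundamental_lemma.

(** * Integration over R^d one coordinate at a time *)

Section tonelli_rV.
Context (R : realType).
Local Notation mu := (@lebesgue_measure R).

Lemma measurable_rV_cons_comp d (f : 'rV[R]_d.+1 -> \bar R) :
  measurable_fun setT f ->
  measurable_fun setT (fun p : 'rV[R]_d * measurableTypeR R => f (rV_cons p)).
Proof. by move=> mf; apply: measurableT_comp => //; exact: measurable_rV_cons. Qed.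

Lemma measurable_rV_cons_tail d (f : 'rV[R]_d.+1 -> \bar R) (z : R) :
  measurable_fun setT f -> measurable_fun setT (fun x : 'rV[R]_d => f (rV_cons (x, z))).
Proof.
by move=> /measurable_rV_cons_comp mf; exact: (measurable_fun_pair1 z mf).
Qed.

Lemma integral_rV_prod d (f : 'rV[R]_d.+1 -> \bar R) :
  measurable_fun setT f -> (forall x, 0 <= f x)%E ->
  (\int[lebesgue_rV R d.+1]_x f x =
   \int[(@lebf R d \x mu)]_p f (rV_cons p))%E.
Proof.
move=> mf f0.
exact: (@ge0_integral_pushforward _ _ _ _ R _ (@measurable_rV_cons R d)
  ((@lebf R d \x mu)%E) setT f measurableT mf (fun x _ => f0 x)).
Qed.

Lemma integral_rVS d (f : 'rV[R]_d.+1 -> \bar R) :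
  measurable_fun setT f -> (forall x, 0 <= f x)%E ->
  (\int[lebesgue_rV R d.+1]_x f x =
   \int[mu]_z \int[lebesgue_rV R d]_x f (rV_cons (x, z)))%E.
Proof.
move=> mf f0; rewrite integral_rV_prod//.
by rewrite (fubini_tonelli2 (fun p => f (rV_cons p)))//; exact: measurable_rV_cons_comp.
Qed.

Lemma integral_rVS' d (f : 'rV[R]_d.+1 -> \bar R) :
  measurable_fun setT f -> (forall x, 0 <= f x)%E ->
  (\int[lebesgue_rV R d.+1]_x f x =
   \int[lebesgue_rV R d]_x \int[mu]_z f (rV_cons (x, z)))%E.
Proof.
move=> mf f0; rewrite integral_rV_prod//.
by rewrite (fubini_tonelli1 (fun p => f (rV_cons p)))//; exact: measurable_rV_cons_comp.
Qed.

Lemma measurable_integral_tail d (f : 'rV[R]_d.+1 -> \bar R) :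
  measurable_fun setT f -> (forall x, 0 <= f x)%E ->
  measurable_fun setT (fun z : R => \int[lebesgue_rV R d]_x f (rV_cons (x, z)))%E.
Proof.
move=> mf f0.
by apply: (@measurable_fun_fubini_tonelli_G _ _ _ _ R (@lebf R d) (fun p => f (rV_cons p)));
  [exact: measurable_rV_cons_comp|].
Qed.

Lemma measurable_integral_head d (f : 'rV[R]_d.+1 -> \bar R) :
  measurable_fun setT f -> (forall x, 0 <= f x)%E ->
  measurable_fun setT (fun x : 'rV[R]_d => \int[mu]_z f (rV_cons (x, z)))%E.
Proof.
move=> mf f0.
by apply: (@measurable_fun_fubini_tonelli_F _ _ _ _ R mu (fun p => f (rV_cons p)));
  [exact: measurable_rV_cons_comp|].
Qed.

Lemma rV_cons_head d (x : 'rV[R]_d) (t : R) :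
  rV_cons (x, t) = t *: delta_mx 0 ord0 + rV_cons (x, 0).
Proof.
apply/rowP => i; rewrite !mxE eqxx /=.
by case: unliftP => [j ->|->] /=; rewrite ?addr0 ?mulr0 ?add0r// mulr1.
Qed.

Lemma rV_cons_tail d (x : 'rV[R]_d) (z t : R) (i : 'I_d) :
  rV_cons (t *: delta_mx 0 i + x, z) = t *: delta_mx 0 (lift ord0 i) + rV_cons (x, z).
Proof.
apply/rowP => j; rewrite !mxE eqxx /=.
case: unliftP => [k ->|->] /=; last by rewrite mulr0 add0r.
by rewrite !mxE eqxx /= (inj_eq lift_inj).
Qed.

(** Gagliardo's argument in the plane: each line integral is a function of one
    variable only, so [u] squared is at most a product of functions of
    different variables, whose double integral factors. *)
Lemma gagliardo_plane (u A B : 'rV[R]_2 -> \bar R) :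
  measurable_fun setT u -> measurable_fun setT A -> measurable_fun setT B ->
  (forall x, 0 <= u x)%E -> (forall x, 0 <= A x)%E -> (forall x, 0 <= B x)%E ->
  (forall p s, u (s *: delta_mx 0 0 + p)%R <= \int[mu]_t A (t *: delta_mx 0 0 + p)%R)%E ->
  (forall p s, u (s *: delta_mx 0 1 + p)%R <= \int[mu]_t B (t *: delta_mx 0 1 + p)%R)%E ->
  (\int[lebesgue_rV R 2]_x (u x * u x) <=
   \int[lebesgue_rV R 2]_x A x * \int[lebesgue_rV R 2]_x B x)%E.
Proof.
move=> mu_ mA mB u0 A0 B0 uA uB.
pose a (x : 'rV[R]_1) := (\int[mu]_z A (rV_cons (x, z)))%E.
pose b (z : R) := (\int[lebesgue_rV R 1]_x B (rV_cons (x, z)))%E.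
have a0 x : (0 <= a x)%E by exact: integral_ge0.
have b0 z : (0 <= b z)%E by exact: integral_ge0.
have ma : measurable_fun setT a by exact: measurable_integral_head.
have mb : measurable_fun setT b by exact: measurable_integral_tail.
have ua x z : (u (rV_cons (x, z)) <= a x)%E.
  rewrite rV_cons_head; apply: le_trans (uA _ _) _.
  by rewrite /a le_eqVlt; apply/orP; left; apply/eqP; apply: eq_integral => t _; rewrite (rV_cons_head x t).
have line (x : 'rV[R]_1) : x = x 0 0 *: delta_mx 0 0 + 0.
  by apply/rowP => i; rewrite ord1 !mxE eqxx mulr1 addr0.
have lift01 : lift ord0 (0 : 'I_1) = 1 :> 'I_2 by apply/val_inj.
have rV0 (x : 'rV[R]_0) : x = 0 by apply/rowP => -[].
have ub x z : (u (rV_cons (x, z)) <= b z)%E.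
  rewrite (line x) rV_cons_tail lift01; apply: le_trans (uB _ _) _.
  rewrite /b integral_rVS//; last exact: measurable_rV_cons_tail.
  rewrite le_eqVlt; apply/orP; left; apply/eqP; apply: eq_integral => t _.
  rewrite /= integral_dirac ?diracT ?mul1e//; last first.
    exact: (measurable_rV_cons_tail t (measurable_rV_cons_tail z mB)).
  by rewrite -lift01 -rV_cons_tail (rV_cons_head 0 t); congr (B (rV_cons (_ + _, _)));
    apply/rowP => i; rewrite ord1 !mxE unlift_none.
rewrite integral_rVS//; [|exact: emeasurable_funM|by move=> x; exact: mule_ge0].
rewrite (integral_rVS' mA)// (integral_rVS mB)//.
rewrite -[X in (X * _)%E]/(\int[lebesgue_rV R 1]_x a x)%E -[X in (_ * X)%E]/(\int[mu]_z b z)%E.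
rewrite -ge0_integralZl//; last exact: integral_ge0.
apply: ge0_le_integral => //.
- by move=> z _; apply: integral_ge0 => x _; exact: mule_ge0.
- by apply: (measurable_integral_tail (f := fun x => u x * u x)%E) => [|x];
    [exact: emeasurable_funM|exact: mule_ge0].
- by apply: emeasurable_funM => //; exact: measurable_cst.
- move=> z _; rewrite -ge0_integralZr//.
  apply: ge0_le_integral => //.
  + by move=> x _; exact: mule_ge0.
  + by apply: emeasurable_funM; exact: measurable_rV_cons_tail.
  + by apply: emeasurable_funM => //; exact: measurable_cst.
  + by move=> x _; apply: lee_pmul.
Qed.

End tonelli_rV.

(** * Bounds along lines *)

Section line_bound.
Context (R : realType).
Local Notation mu := (@lebesgue_measure R).

(** The fundamental theorem of calculus, started to the left of the support. *)
Lemma abs_le_integral_derive (f f' : R -> R) (c : R) :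
  (forall t, is_derive t (1 : R) f (f' t)) -> continuous f' ->
  (forall t, t <= c -> f t = 0) ->
  forall x, (`|f x|%:E <= \int[mu]_t `|f' t|%:E)%E.
Proof.
move=> df cf' f0 x.
pose a := Num.min c (x - 1).
have ax : a < x by rewrite gt_min ltrBlDr ltrDl ltr01 orbT.
have fa : f a = 0 by apply: f0; rewrite ge_min lexx.
have cf : continuous f.
  by move=> t; apply/differentiable_continuous/derivable1_diffP; case: (df t).
have mf' : measurable_fun setT f' by exact: continuous_measurable_fun.
have -> : (`|f x|%:E = `|\int[mu]_(t in `[a, x]) (f' t)%:E|)%E.
  rewrite (@continuous_FTC2 _ f' f a x ax).
  - by rewrite fa sube0.
  - exact: continuous_subspaceT.
  - split; [by move=> t _; case: (df t)| |].
      by apply: cvg_at_right_filter; exact: cf.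
    by apply: cvg_at_left_filter; exact: cf.
  - by move=> t _; rewrite derive1E; case: (df t).
apply: le_trans (le_abse_integral _ _ _) _ => //.
  by apply/measurable_EFinP; exact: measurable_funS mf'.
apply: ge0_subset_integral => //.
by apply: measurableT_comp => //; exact/measurable_EFinP.
Qed.

Lemma test_fun_line_bound d (Om : set 'rV[R]_d) (w : 'rV[R]_d -> R) (i : 'I_d) p s :
  bounded_set Om -> test_fun Om w ->
  (`|w (s *: delta_mx 0 i + p)|%:E <=
   \int[mu]_t `|pderiv i w (t *: delta_mx 0 i + p)|%:E)%E.
Proof.
move=> /bounded_set_cbox[M M0 OM] tw; have sw := test_fun_smooth tw.
have [_ [K [_ KO wK]]] := tw.
apply: (@abs_le_integral_derive (fun t => w (t *: delta_mx 0 i + p))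
  (fun t => pderiv i w (t *: delta_mx 0 i + p)) (- M - 1 - p 0 i)).
- by move=> t; apply: is_derive_line; exact: smooth_derivable.
- move=> t; apply: (@continuous_comp _ _ _ (fun t : R => t *: delta_mx 0 i + p) (pderiv i w)).
    apply: (@cvgD _ _ _ _ _ (fun t : R => t *: delta_mx 0 i) (fun=> p)); last exact: cvg_cst.
    by apply: cvgZr_tmp; exact: cvg_id.
  exact: (smooth_continuous (smooth_pderiv i sw)).
- move=> t tM; apply: wK => /KO/OM/(_ i); rewrite !mxE !eqxx mulr1.
  by move=> /andP[]; lra.
Qed.

End line_bound.

Section ip_extra.
Context (R : realType) (d : nat) (Om : set 'rV[R]_d).
Hypothesis mOm : measurable Om.
Local Notation E := 'rV[R]_d.
Local Notation leb := (lebesgue_rV R d).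
Implicit Types (f g k : E -> R).

Lemma le_ip2 f g f1 g1 f2 g2 : L2 Om f -> L2 Om g -> L2 Om f1 -> L2 Om g1 ->
  L2 Om f2 -> L2 Om g2 ->
  (forall x, Om x -> f x * g x <= f1 x * g1 x + f2 x * g2 x) ->
  ip Om f g <= ip Om f1 g1 + ip Om f2 g2.
Proof.
move=> Lf Lg Lf1 Lg1 Lf2 Lg2 H.
rewrite /ip -RintegralD//; try exact: L2_integrableM.
apply: le_Rintegral => //; first exact: L2_integrableM.
exact: (integrableD mOm (L2_integrableM mOm Lf1 Lg1) (L2_integrableM mOm Lf2 Lg2)).
Qed.

Lemma L2_norm f : L2 Om f -> L2 Om (fun x => `|f x|).
Proof.
move=> [mf If]; split; first exact: measurableT_comp.
by under eq_integral do rewrite real_normK ?num_real//.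
Qed.

Lemma l2norm_norm f : l2norm Om (fun x => `|f x|) = l2norm Om f.
Proof.
congr Num.sqrt; apply: eq_Rintegral => x _.
by rewrite -!expr2 real_normK ?num_real.
Qed.

Lemma integral_ip f g : L2 Om f -> L2 Om g -> (forall x, ~ Om x -> f x * g x = 0) ->
  (\int[leb]_x (f x * g x)%:E = (ip Om f g)%:E)%E.
Proof.
move=> Lf Lg fg0; rewrite /ip /Rintegral fineK.
  rewrite [RHS]integral_mkcond; apply: eq_integral => x _.
  rewrite /patch; case: ifPn => // /negP xO; rewrite fg0// => Ox.
  by apply: xO; exact/mem_set.
exact: (integrable_fin_num mOm (L2_integrableM mOm Lf Lg)).
Qed.

Lemma test_fun_L2 f : (leb Om < +oo)%E -> test_fun Om f -> L2 Om f.
Proof.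
move=> fOm tf; have [M fM] := test_fun_bounded tf.
apply: (@L2_bounded _ _ _ mOm _ M) => //.
by apply: continuous_measurable_rV => //; apply: smooth_continuous; exact: test_fun_smooth tf.
Qed.

Lemma test_fun_out f x : test_fun Om f -> ~ Om x -> f x = 0.
Proof. by move=> [_ [K [_ KO fK]]] Ox; apply: fK => /KO. Qed.

End ip_extra.

(** * Sobolev inequalities for test functions *)

Section sobolev.
Context (R : realType) (d : nat) (Om : set 'rV[R]_d).
Hypotheses (oOm : open Om) (bOm : bounded_set Om).
Local Notation E := 'rV[R]_d.
Local Notation leb := (lebesgue_rV R d).
Local Notation mu := (@lebesgue_measure R).
Variable phi : E -> R.
Hypothesis tphi : test_fun Om phi.

Let mOm : measurable Om. Proof. exact: open_measurable_rV. Qed.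
Let fOm : (leb Om < +oo)%E. Proof. exact: lebesgue_rV_bounded. Qed.

(** The sixth power of [phi] is integrated as [cube * cube], and the fourth
    power is the function to which the bounds along lines are applied. *)
Definition cube : E -> R := phi * phi * phi.
Definition quad : E -> R := phi * phi * (phi * phi).

Let sphi := test_fun_smooth tphi.

Lemma test_cube : test_fun Om cube.
Proof. by apply: test_fun_mul => //; exact: test_fun_mul. Qed.

Lemma test_quad : test_fun Om quad.
Proof. by apply: test_fun_mul; [exact: test_fun_mul|exact: smoothM]. Qed.

Lemma quadE x : quad x = phi x ^+ 4.
Proof. by rewrite -[LHS]/(phi x * phi x * (phi x * phi x)); ring. Qed.

Lemma cubeE x : cube x = phi x ^+ 3.
Proof. by rewrite -[LHS]/(phi x * phi x * phi x); ring. Qed.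

Lemma pderiv_quad i x : pderiv i quad x = 4 * (cube x * pderiv i phi x).
Proof.
have dphi y : derivable phi y (delta_mx 0 i) by exact: smooth_derivable.
have d2 y : derivable (phi * phi) y (delta_mx 0 i) by exact: derivableM.
rewrite /quad pderivM// pderivM// cubeE.
rewrite -[LHS]/((pderiv i phi x * phi x + phi x * pderiv i phi x) * (phi x * phi x) +
  phi x * phi x * (pderiv i phi x * phi x + phi x * pderiv i phi x)).
ring.
Qed.

Lemma L2_test f : test_fun Om f -> L2 Om f.
Proof. exact: test_fun_L2. Qed.

Lemma integral_pderiv_quad (G : R) i : l2norm Om (pderiv i phi) <= G ->
  (\int[leb]_x `|pderiv i quad x|%:E <= (4 * l2norm Om cube * G)%:E)%E.
Proof.
move=> phiG; pose P : E -> R := fun x => `|cube x|; pose Q : E -> R := fun x => `|pderiv i phi x|.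
have LP : L2 Om P by apply: L2_norm; exact/L2_test/test_cube.
have LQ : L2 Om Q by apply: L2_norm; exact/L2_test/test_fun_pderiv.
have -> : (\int[leb]_x `|pderiv i quad x|%:E = \int[leb]_x ((4 *: P) x * Q x)%:E)%E.
  apply: eq_integral => x _; congr EFin.
  rewrite pderiv_quad normrM (normrM (cube x)) (ger0_norm (ler0n R 4)) mulrA.
  by rewrite -[(4 *: P) x]/(4 * P x).
rewrite (integral_ip mOm (L2Z mOm 4 LP) LQ); last first.
  by move=> x /(test_fun_out (test_fun_pderiv i tphi)); rewrite /Q => ->; rewrite normr0 mulr0.
rewrite lee_fin ipZl// -mulrA ler_wpM2l//.
apply: le_trans (ler_norm _) _; apply: le_trans (cauchy_schwarz mOm LP LQ) _.
by rewrite !l2norm_norm ler_wpM2l// l2norm_ge0.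
Qed.

End sobolev.

Section sobolev23.
Context (R : realType).
Local Notation mu := (@lebesgue_measure R).

Lemma measurable_test d (Om : set 'rV[R]_d) f : test_fun Om f -> measurable_fun setT f.
Proof.
by move=> tf; apply: continuous_measurable_rV => //; apply: smooth_continuous; exact: test_fun_smooth tf.
Qed.

(** In the plane, the bound for the L^8 norm of [phi] by its L^6 norm gives a
    bound for the latter because the domain has finite measure. *)
Lemma sobolev_plane (Om : set 'rV[R]_2) : open Om -> bounded_set Om ->
  exists2 C : R, 0 < C & forall phi, test_fun Om phi -> forall G : R, 0 < G ->
    (forall i, l2norm Om (pderiv i phi) <= G) ->
    ip Om (cube phi) (cube phi) <= C * G ^+ 6.
Proof.
move=> oOm bOm; have mOm : measurable Om by exact: open_measurable_rV.
have fOm : (lebesgue_rV R 2 Om < +oo)%E by exact: lebesgue_rV_bounded.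
pose m := ip Om (cst 1 : _ -> R) (cst 1).
have m0 : 0 <= m by exact: ip_ge0.
have L1 : L2 Om (cst 1 : 'rV[R]_2 -> R).
  by apply: (@L2_bounded _ _ _ mOm _ 1) => // x _; rewrite normr1.
pose c : R := 24 ^+ 3 / 4.
have c0 : 0 < c by rewrite divr_gt0// exprn_gt0.
exists (2 * (c * m) + 1); first by rewrite ltr_wpDl// !mulr_ge0// ltW.
move=> phi tphi G G0 phiG.
have tq := test_quad tphi; have tc := test_cube tphi.
have Lq := test_fun_L2 mOm fOm tq; have Lc := test_fun_L2 mOm fOm tc.
pose K := 4 * l2norm Om (cube phi) * G.
pose A (i : 'I_2) x := (`|pderiv i (quad phi) x|%:E).
have mA i : measurable_fun setT (A i).
  apply/measurable_EFinP; apply: measurableT_comp => //.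
  exact: measurable_test (test_fun_pderiv i tq).
have mq : measurable_fun setT (fun x => `|quad phi x|%:E).
  by apply/measurable_EFinP; apply: measurableT_comp => //; exact: measurable_test tq.
have := @gagliardo_plane R (fun x => `|quad phi x|%:E) (A 0) (A 1) mq (mA 0) (mA 1)
  (fun x => normr_ge0 _) (fun x => normr_ge0 _) (fun x => normr_ge0 _)
  (fun p s => test_fun_line_bound 0 p s bOm tq) (fun p s => test_fun_line_bound 1 p s bOm tq).
have -> : (\int[lebesgue_rV R 2]_x (`|quad phi x|%:E * `|quad phi x|%:E) =
    (ip Om (quad phi) (quad phi))%:E)%E.
  rewrite -(integral_ip mOm Lq Lq); last by move=> x /(test_fun_out tq) ->; rewrite mul0r.
  by apply: eq_integral => x _; rewrite -EFinM -!expr2 real_normK ?num_real.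
have KA i : (\int[lebesgue_rV R 2]_x A i x <= K%:E)%E by exact: integral_pderiv_quad.
move=> H.
have {}H : ip Om (quad phi) (quad phi) <= K * K.
  rewrite -lee_fin EFinM; apply: le_trans H _.
  by apply: lee_pmul; rewrite ?KA//; apply: integral_ge0 => x _; rewrite lee_fin.
set Y := ip Om (cube phi) (cube phi).
have Y0 : 0 <= Y by exact: ip_ge0.
have KK : K * K = 16 * Y * G ^+ 2.
  by rewrite /Y -sqr_l2norm /K; ring.
(* the weight in Young's inequality for which half of Y is absorbed *)
pose la := (24 * G ^+ 2)^-1.
have la0 : 0 < la by rewrite invr_gt0 mulr_gt0// exprn_gt0.
have young : Y <= ip Om ((3 / 4 * la) *: quad phi) (quad phi) +
    ip Om ((4 * la ^+ 3)^-1 *: (cst 1 : _ -> R)) (cst 1).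
  apply: le_ip2 => //; try exact: L2Z.
  move=> x _; rewrite -[(_ *: quad phi) x]/(3 / 4 * la * quad phi x).
  rewrite -[(_ *: cst 1) x * cst 1 x]/((4 * la ^+ 3)^-1 * 1 * 1) !mulr1 quadE cubeE.
  set a := phi x ^+ 2.
  have -> : phi x ^+ 3 * phi x ^+ 3 = a ^+ 3 by rewrite /a; ring.
  have -> : phi x ^+ 4 = a ^+ 2 by rewrite /a; ring.
  have a0 : 0 <= a by exact: sqr_ge0.
  have la3 : 0 < la ^+ 3 by rewrite exprn_gt0.
  have k0 : 0 < 4 * la ^+ 3 by rewrite mulr_gt0.
  rewrite -(ler_pM2r k0) [leRHS]mulrDl [X in _ + X]mulVf ?gt_eqF//.
  have -> : a ^+ 3 * (4 * la ^+ 3) = 4 * (la * a) ^+ 3 by ring.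
  have -> : 3 / 4 * la * a ^+ 2 * a ^+ 2 * (4 * la ^+ 3) = 3 * (la * a) ^+ 4 by field.
  set y := la * a.
  have -> : 3 * y ^+ 4 + 1 = 4 * y ^+ 3 + (y - 1) ^+ 2 * (2 * y ^+ 2 + (y + 1) ^+ 2) by ring.
  rewrite lerDl; apply: mulr_ge0; first exact: sqr_ge0.
  by apply: addr_ge0; [apply: mulr_ge0 => //; exact: sqr_ge0|exact: sqr_ge0].
rewrite !ipZl// -/m in young.
have e1 : 3 / 4 * la * (K * K) = Y / 2.
  have Gn0 : G != 0 by rewrite gt_eqF.
  by rewrite KK /la; field.
have e2 : (4 * la ^+ 3)^-1 = c * G ^+ 6.
  rewrite /c /la exprVn invfM invrK; ring.
have le1 : 3 / 4 * la * ip Om (quad phi) (quad phi) <= Y / 2.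
  by rewrite -e1 ler_wpM2l// mulr_ge0 // ltW.
rewrite e2 in young.
have G6 : 0 < G ^+ 6 by rewrite exprn_gt0.
have -> : (2 * (c * m) + 1) * G ^+ 6 = 2 * (c * G ^+ 6 * m) + G ^+ 6 by ring.
lra.
Qed.

(** In space, the planar bound on the slices orthogonal to one axis is
    combined with the bound along that axis and integrated over the slices. *)
Lemma sobolev_space (Om : set 'rV[R]_3) : open Om -> bounded_set Om ->
  forall phi, test_fun Om phi -> forall G : R, 0 < G ->
    (forall i, l2norm Om (pderiv i phi) <= G) ->
    ip Om (cube phi) (cube phi) <= (4 * G) ^+ 6.
Proof.
move=> oOm bOm; have mOm : measurable Om by exact: open_measurable_rV.
have fOm : (lebesgue_rV R 3 Om < +oo)%E by exact: lebesgue_rV_bounded.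
move=> phi tphi G G0 phiG.
have tq := test_quad tphi; have tc := test_cube tphi.
have Lq := test_fun_L2 mOm fOm tq; have Lc := test_fun_L2 mOm fOm tc.
set r := l2norm Om (cube phi).
have r0 : 0 <= r by exact: l2norm_ge0.
have -> : ip Om (cube phi) (cube phi) = r ^+ 2 by rewrite sqr_l2norm.
have [r00|rn0] := eqVneq r 0; first by rewrite r00 expr0n /= exprn_ge0// mulr_ge0// ltW.
have {rn0}r1 : 0 < r by rewrite lt_def rn0.
pose K := 4 * r * G.
have K0 : 0 < K by rewrite !mulr_gt0.
pose A (i : 'I_3) x := (`|pderiv i (quad phi) x|%:E).
have A0 i x : (0 <= A i x)%E by rewrite lee_fin.
have mA i : measurable_fun setT (A i).
  apply/measurable_EFinP; apply: measurableT_comp => //.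
  exact: measurable_test (test_fun_pderiv i tq).
have KA i : (\int[lebesgue_rV R 3]_x A i x <= K%:E)%E by exact: integral_pderiv_quad.
pose u (x : 'rV[R]_3) := (`|quad phi x|%:E).
have u0 x : (0 <= u x)%E by rewrite lee_fin.
have mq : measurable_fun setT u.
  by apply/measurable_EFinP; apply: measurableT_comp => //; exact: measurable_test tq.
pose s (x : 'rV[R]_3) := ((cube phi x * cube phi x)%:E).
have s0 x : (0 <= s x)%E by rewrite lee_fin -expr2 sqr_ge0.
have ms : measurable_fun setT s.
  by apply/measurable_EFinP; apply: measurable_funM; exact: measurable_test tc.
pose i1 : 'I_3 := lift ord0 0; pose i2 : 'I_3 := lift ord0 1.
pose a (z : R) := (\int[lebesgue_rV R 2]_x A i1 (rV_cons (x, z)))%E.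
pose b (z : R) := (\int[lebesgue_rV R 2]_x A i2 (rV_cons (x, z)))%E.
pose S (z : R) := (\int[lebesgue_rV R 2]_x s (rV_cons (x, z)))%E.
have a0 z : (0 <= a z)%E by exact: integral_ge0.
have b0 z : (0 <= b z)%E by exact: integral_ge0.
have S0 z : (0 <= S z)%E by exact: integral_ge0.
have slice2 z : (\int[lebesgue_rV R 2]_x (u (rV_cons (x, z)) * u (rV_cons (x, z))) <= a z * b z)%E.
  apply: (@gagliardo_plane R (fun x => u (rV_cons (x, z)))
    (fun x => A i1 (rV_cons (x, z))) (fun x => A i2 (rV_cons (x, z)))) => //.
  - exact: (measurable_rV_cons_tail z mq).
  - exact: (measurable_rV_cons_tail z (mA i1)).
  - exact: (measurable_rV_cons_tail z (mA i2)).
  - move=> p t; rewrite rV_cons_tail; under eq_integral do rewrite rV_cons_tail.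
    exact: (test_fun_line_bound i1 _ _ bOm tq).
  - move=> p t; rewrite rV_cons_tail; under eq_integral do rewrite rV_cons_tail.
    exact: (test_fun_line_bound i2 _ _ bOm tq).
have slice1 z : (\int[lebesgue_rV R 2]_x u (rV_cons (x, z)) <= K%:E)%E.
  apply: le_trans (KA ord0); rewrite (integral_rVS' (mA ord0))//.
  apply: ge0_le_integral => //.
  - exact: measurable_rV_cons_tail.
  - exact: measurable_integral_head.
  - move=> x _; rewrite rV_cons_head; under eq_integral do rewrite rV_cons_head.
    exact: (test_fun_line_bound ord0 _ _ bOm tq).
have sliceS z (la : R) : 0 < la ->
    (S z <= (la / 2 * K)%:E + (la * 2)^-1%:E * (a z * b z))%E.
  move=> la0.
  have m1 := measurable_rV_cons_tail z mq.
  have c0 : 0 <= la / 2 by rewrite divr_ge0// ltW.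
  have c1 : 0 <= (la * 2)^-1 by rewrite invr_ge0 mulr_ge0// ltW.
  have m2 : measurable_fun setT (fun x => u (rV_cons (x, z)) * u (rV_cons (x, z)))%E.
    exact: emeasurable_funM.
  have m3 : measurable_fun setT (fun x => (la / 2)%:E * u (rV_cons (x, z)))%E.
    by apply: emeasurable_funM => //; exact: measurable_cst.
  have m4 : measurable_fun setT
      (fun x => (la * 2)^-1%:E * (u (rV_cons (x, z)) * u (rV_cons (x, z))))%E.
    by apply: emeasurable_funM => //; exact: measurable_cst.
  have uu0 x : (0 <= u (rV_cons (x, z)) * u (rV_cons (x, z)))%E by exact: mule_ge0.
  apply: (@le_trans _ _ (\int[lebesgue_rV R 2]_x ((la / 2)%:E * u (rV_cons (x, z)) +
     (la * 2)^-1%:E * (u (rV_cons (x, z)) * u (rV_cons (x, z)))))%E).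
    apply: ge0_le_integral => //.
    - exact: (measurable_rV_cons_tail z ms).
    - exact: emeasurable_funD.
    - move=> x _; rewrite /s /u -!EFinM -EFinD lee_fin.
      rewrite quadE cubeE ger0_norm ?exprn_even_ge0//.
      set f := phi _.
      rewrite -subr_ge0.
      have -> : la / 2 * f ^+ 4 + (la * 2)^-1 * (f ^+ 4 * f ^+ 4) - f ^+ 3 * f ^+ 3 =
        (la * 2)^-1 * (f ^+ 2 * (f ^+ 2 - la)) ^+ 2 by field; rewrite gt_eqF.
      by rewrite mulr_ge0// sqr_ge0.
  rewrite ge0_integralD//; last 2 first.
  - by move=> x _; rewrite mule_ge0// lee_fin.
  - by move=> x _; rewrite mule_ge0// lee_fin.
  rewrite ge0_integralZl// ge0_integralZl//.
  apply: leeD; last by rewrite lee_wpmul2l// lee_fin.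
  by rewrite (EFinM (la / 2) K) lee_wpmul2l// lee_fin.
have sliceE z : (S z <= (Num.sqrt K / 2)%:E * (a z + b z))%E.
  have k0 : 0 < Num.sqrt K by rewrite sqrtr_gt0.
  have kk : Num.sqrt K ^+ 2 = K by rewrite sqr_sqrtr// ltW.
  move: (a0 z) (b0 z) (sliceS z) (S0 z); case: (a z) (b z) (S z) => [ar| |] [br| |] [Sr| |] //.
  - rewrite !lee_fin => ar0 br0 H Sr0.
    have {}H (la : R) : 0 < la -> Sr <= la / 2 * K + (la * 2)^-1 * (ar * br).
      by move=> /H h; rewrite -lee_fin EFinD (EFinM (la * 2)^-1) (EFinM ar); exact: h.
    (* a slice on which both bounds vanish is reached by letting la tend to 0 *)
    have [ab0|ab0] := eqVneq (ar + br) 0.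
      have [a00 b00] : ar = 0 /\ br = 0 by split; lra.
      rewrite ab0 mulr0; apply/ler_addgt0Pl => e e0.
      have := H (2 * e / K) ltac:(by rewrite !mulr_gt0// invr_gt0).
      have -> : 2 * e / K / 2 * K = e by field; rewrite gt_eqF.
      by rewrite a00 mul0r mulr0 !addr0.
    have ab1 : 0 < ar + br by rewrite lt_def ab0 addr_ge0.
    (* the value of la that balances the two terms of sliceS when ar = br *)
    have := H ((ar + br) / (2 * Num.sqrt K)) ltac:(by rewrite divr_gt0// mulr_gt0).
    rewrite -{2}kk.
    have -> : (ar + br) / (2 * Num.sqrt K) / 2 * Num.sqrt K ^+ 2 = Num.sqrt K * (ar + br) / 4.
      by field; rewrite gt_eqF.
    have -> : ((ar + br) / (2 * Num.sqrt K) * 2)^-1 * (ar * br) =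
       Num.sqrt K * ((ar * br) / (ar + br)) by field; rewrite ?ab0 ?gt_eqF.
    move=> h; apply: le_trans h _.
    have : ar * br / (ar + br) <= (ar + br) / 4.
      rewrite ler_pdivrMr//; have := sqr_ge0 (ar - br); nra.
    by move=> h; have := ler_wpM2l (ltW k0) h; lra.
  - by move=> _ _ /(_ 1 ltr01).
  - by move=> *; rewrite gt0_muley ?leey// lte_fin divr_gt0.
  - by move=> *; rewrite gt0_muley ?leey// lte_fin divr_gt0.
  - by move=> *; rewrite gt0_muley ?leey// lte_fin divr_gt0.
  - by move=> *; rewrite gt0_muley ?leey// lte_fin divr_gt0.
  - by move=> *; rewrite gt0_muley ?leey// lte_fin divr_gt0.
  - by move=> *; rewrite gt0_muley ?leey// lte_fin divr_gt0.
have main : r ^+ 2 <= Num.sqrt K * K.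
  rewrite sqr_l2norm -lee_fin -(integral_ip mOm Lc Lc); last first.
    by move=> x /(test_fun_out tc) ->; rewrite mul0r.
  rewrite integral_rVS//.
  have mmS : measurable_fun setT S := measurable_integral_tail ms s0.
  have mma : measurable_fun setT a := measurable_integral_tail (mA i1) (A0 i1).
  have mmb : measurable_fun setT b := measurable_integral_tail (mA i2) (A0 i2).
  apply: (@le_trans _ _ (\int[mu]_z ((Num.sqrt K / 2)%:E * (a z + b z)))%E).
    apply: ge0_le_integral => //.
    - by move=> z _; exact: S0.
    - exact: (emeasurable_funM (measurable_cst (Num.sqrt K / 2)%:E) (emeasurable_funD mma mmb)).
    - by move=> z _; exact: sliceE.
  have k0 : 0 <= Num.sqrt K / 2 by rewrite divr_ge0// sqrtr_ge0.
  have msum : measurable_fun setT (fun z => a z + b z)%E := emeasurable_funD mma mmb.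
  rewrite (ge0_integralZl_EFin mu measurableT (fun z _ => adde_ge0 (a0 z) (b0 z)) msum k0).
  rewrite (ge0_integralD mu measurableT (fun z _ => a0 z) mma (fun z _ => b0 z) mmb).
  have -> : ((Num.sqrt K * K)%:E = (Num.sqrt K / 2)%:E * (K%:E + K%:E))%E.
    by rewrite -EFinD -EFinM; congr EFin; field.
  rewrite lee_wpmul2l ?lee_fin//; apply: leeD.
    by apply: le_trans (KA i1); rewrite [leRHS]integral_rVS.
  by apply: le_trans (KA i2); rewrite [leRHS]integral_rVS.
have : r ^+ 2 * r ^+ 2 <= r ^+ 3 * (4 * G) ^+ 3.
  have -> : r ^+ 3 * (4 * G) ^+ 3 = (Num.sqrt K * K) * (Num.sqrt K * K).
    have -> : Num.sqrt K * K * (Num.sqrt K * K) = Num.sqrt K ^+ 2 * (K * K) by ring.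
    rewrite sqr_sqrtr ?(ltW K0)// /K; ring.
  by apply: ler_pM => //; exact: sqr_ge0.
have -> : r ^+ 2 * r ^+ 2 = r ^+ 3 * r by ring.
rewrite ler_pM2l ?exprn_gt0// => h.
have -> : (4 * G) ^+ 6 = ((4 * G) ^+ 3) ^+ 2 by rewrite -exprM.
by rewrite ler_sqr ?nnegrE// exprn_ge0// mulr_ge0// ltW.
Qed.

Lemma sobolev6 d (Om : set 'rV[R]_d) : d = 2%N \/ d = 3%N -> open Om -> bounded_set Om ->
  exists2 C : R, 0 < C & forall phi, test_fun Om phi -> forall G : R, 0 < G ->
    (forall i, l2norm Om (pderiv i phi) <= G) ->
    ip Om (cube phi) (cube phi) <= C * G ^+ 6.
Proof.
case=> dE; subst d => oOm bOm; first exact: sobolev_plane.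
exists (4 ^+ 6) => [|phi tphi G G0 phiG]; first by rewrite exprn_gt0.
by rewrite -exprMn; exact: sobolev_space.
Qed.

End sobolev23.

(** * Integrals of partial derivatives *)

Section integral_of_derivative.
Context (R : realType).
Local Notation mu := (@lebesgue_measure R).

Lemma integral_derive0 (f f' : R -> R) (c : R) :
  (forall t, is_derive t (1 : R) f (f' t)) -> continuous f' ->
  (forall t, c < `|t| -> f t = 0) -> (\int[mu]_t (f' t)%:E = 0)%E.
Proof.
move=> df cf' f0.
pose a : R := `|c| + 1.
have ca : c < a by rewrite /a; have := ler_norm c; lra.
have a0 : 0 < a by rewrite /a ltr_wpDl.
have cf : continuous f.
  by move=> t; apply/differentiable_continuous/derivable1_diffP; case: (df t).
have f'0 t : c < `|t| -> f' t = 0.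
  move=> ct; have [_ <-] := df t; rewrite -(derive_cst (0 : R) t (1 : R)).
  apply: near_eq_derive.
  have nb : \forall s \near t, c < `|s|.
    by have h := @norm_continuous _ R t; exact: (h _ (lt_nbhsr ct)).
  by apply: filterS nb => s /f0.
transitivity (\int[mu]_(t in `[(- a)%R, a]) (f' t)%:E)%E.
  rewrite [RHS]integral_mkcond; apply: eq_integral => t _.
  rewrite /patch; case: ifPn => //; rewrite notin_setE /= in_itv /= -ler_norml => /negP.
  by rewrite -ltNge => ta; rewrite f'0// (lt_trans ca).
rewrite (@continuous_FTC2 _ f' f (- a) a); first 1 last.
- by lra.
- exact: continuous_subspaceT.
- split; [by move=> t _; case: (df t)| |].
    by apply: cvg_at_right_filter; exact: cf.
  by apply: cvg_at_left_filter; exact: cf.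
- by move=> t _; rewrite derive1E; case: (df t).
by rewrite !f0 ?normrN ?gtr0_norm// subee.
Qed.

Lemma continuous_rV_cons_tail d (z : R) : continuous (fun x : 'rV[R]_d => rV_cons (x, z)).
Proof.
move=> x A /nbhs_ballP[e /= e0 eA]; apply/nbhs_ballP; exists e => //= y [_ xy].
apply: eA; split=> // i j; rewrite ord1 !mxE; case: unliftP => [k|] _ /=; last exact: ballxx.
exact: xy.
Qed.

(** Slicing off the first coordinate commutes with the other derivatives. *)
Lemma pderiv_rV_cons_tail d (w : 'rV[R]_d.+1 -> R) (z : R) (i : 'I_d) (x : 'rV[R]_d) :
  pderiv i (fun x => w (rV_cons (x, z))) x = pderiv (lift ord0 i) w (rV_cons (x, z)).
Proof.
rewrite /pderiv /derive.
suff -> : (fun h : R => h^-1 *: (((fun x => w (rV_cons (x, z))) \o shift x) (h *: delta_mx 0 i) -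
    w (rV_cons (x, z)))) =
  (fun h : R => h^-1 *: ((w \o shift (rV_cons (x, z))) (h *: delta_mx 0 (lift ord0 i)) -
    w (rV_cons (x, z)))) by [].
by apply/funext => h /=; rewrite rV_cons_tail.
Qed.

Lemma derivable_rV_cons_tail d (w : 'rV[R]_d.+1 -> R) (z : R) (i : 'I_d) (x : 'rV[R]_d) :
  derivable w (rV_cons (x, z)) (delta_mx 0 (lift ord0 i)) ->
  derivable (fun x => w (rV_cons (x, z))) x (delta_mx 0 i).
Proof.
rewrite /derivable.
suff -> : (fun h : R => h^-1 *: (((fun x => w (rV_cons (x, z))) \o shift x) (h *: delta_mx 0 i) -
    w (rV_cons (x, z)))) =
  (fun h : R => h^-1 *: ((w \o shift (rV_cons (x, z))) (h *: delta_mx 0 (lift ord0 i)) -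
    w (rV_cons (x, z)))) by [].
by apply/funext => h /=; rewrite rV_cons_tail.
Qed.

(** The integral of a partial derivative vanishes: by the fundamental theorem
    of calculus along the axis, and by Fubini in the other variables. *)
Lemma integral_pderiv0 d (w : 'rV[R]_d -> R) (i : 'I_d) (M : R) :
  (forall x, derivable w x (delta_mx 0 i)) -> continuous (pderiv i w) ->
  (forall x, ~ cbox (const_mx (- M)) (const_mx M) x -> w x = 0) ->
  (\int[lebesgue_rV R d]_x (pderiv i w x)%:E = 0)%E.
Proof.
elim: d w i => [w [//]|d IH w i dw cw w0].
pose B := @cbox R d.+1 (const_mx (- M)) (const_mx M).
have mB : measurable B by exact: measurable_cbox.
have dw0 : forall x, ~ B x -> pderiv i w x = 0.
  by apply: pderiv_support => //; exact: closed_cbox.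
have mw : measurable_fun setT (pderiv i w) by exact: continuous_measurable_rV.
have iw : (lebesgue_rV R d.+1).-integrable setT (EFin \o pderiv i w).
  have : (lebesgue_rV R d.+1).-integrable B (EFin \o pderiv i w).
    apply: measurable_bounded_integrable => //; first exact: lebesgue_rV_cbox.
      exact: measurable_funS mw.
    have : compact (pderiv i w @` B).
      apply: continuous_compact; last exact: compact_cbox.
      exact: continuous_subspaceT.
    move=> /compact_bounded[N [Nr HN]]; exists N; split=> // m Nm x Bx.
    by apply: (HN m Nm); exists x.
  move/(integrable_mkcond _ mB); apply: eq_integrable => // x _.
  rewrite /patch /=; case: ifPn => // /negP xB; rewrite dw0// => Bx.
  by apply: xB; exact/mem_set.
have ic : (@lebf R d \x mu)%E.-integrable setT (fun p => (pderiv i w (rV_cons p))%:E).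
  apply/integrableP; split.
    exact: (measurable_rV_cons_comp (f := EFin \o pderiv i w)) (measurableT_comp _ mw).
  have [_] := integrableP _ _ _ iw.
  by rewrite integral_rV_prod//; do 2?apply: measurableT_comp.
have -> : (\int[lebesgue_rV R d.+1]_x (pderiv i w x)%:E =
    \int[(@lebf R d \x mu)]_p (pderiv i w (rV_cons p))%:E)%E.
  exact: (@integral_pushforward _ _ _ _ R _ (@measurable_rV_cons R d)
    ((@lebf R d \x mu)%E) setT (EFin \o pderiv i w) (measurableT_comp _ mw) ic measurableT).
case: (unliftP ord0 i) => [k|] ik.
  rewrite -integral21_prod_meas1//.
  rewrite (eq_integral (cst 0%E)) ?integral0// => z _.
  rewrite -[RHS](IH (fun x => w (rV_cons (x, z))) k).
  - by apply: eq_integral => x _; rewrite pderiv_rV_cons_tail -ik.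
  - by move=> x; apply: derivable_rV_cons_tail; rewrite -ik.
  - rewrite (_ : pderiv k _ = pderiv i w \o (fun x => rV_cons (x, z))); last first.
      by apply/funext => x; rewrite pderiv_rV_cons_tail -ik.
    move=> x; apply: continuous_comp; last exact: cw.
    exact: continuous_rV_cons_tail.
  - move=> x xB; apply: w0 => wB; apply: xB => j.
    by have := wB (lift ord0 j); rewrite !mxE liftK.
rewrite -integral12_prod_meas1//.
rewrite (eq_integral (cst 0%E)) ?integral0// => x _.
rewrite -[RHS](@integral_derive0 (fun t => w (t *: delta_mx 0 i + rV_cons (x, 0)))
  (fun t => pderiv i w (t *: delta_mx 0 i + rV_cons (x, 0))) M).
- by apply: eq_integral => z _; rewrite rV_cons_head ik.
- by move=> t; exact: is_derive_line.
- move=> t; apply: (@continuous_comp _ _ _ (fun t : R => t *: delta_mx 0 i + rV_cons (x, 0)) (pderiv i w)).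
    apply: (@cvgD _ _ _ _ _ (fun t : R => t *: delta_mx 0 i) (fun=> rV_cons (x, 0))); last exact: cvg_cst.
    by apply: cvgZr_tmp; exact: cvg_id.
  exact: cw.
- move=> t Mt; apply: w0 => /(_ i); rewrite !mxE !eqxx mulr1 ik unlift_none /= addr0 -ler_norml.
  by rewrite leNgt Mt.
Qed.

End integral_of_derivative.

Section multi_indices.
Context (R : realType) (d : nat).

Definition mi0 n : {ffun 'I_d -> 'I_n.+1} := [ffun=> ord0].
Definition mi1 (j : 'I_d) : {ffun 'I_d -> 'I_2} := [ffun i => inord (i == j)].

Lemma multi_seq0 n : multi_seq (mi0 n) = [::].
Proof. by rewrite /multi_seq; elim: (enum _) => //= i s ->; rewrite ffunE. Qed.

Lemma sum_mi0 n : (\sum_i mi0 n i)%N = 0%N.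
Proof. by rewrite big1// => i _; rewrite ffunE. Qed.

Lemma mi1E j i : mi1 j i = (i == j) :> nat.
Proof. by rewrite ffunE inordK//; case: (i == j). Qed.

Lemma multi_seq1 j : multi_seq (mi1 j) = [:: j].
Proof.
rewrite -(filter_pred1_uniq (enum_uniq 'I_d) (mem_enum _ j)) /multi_seq.
elim: (enum _) => //= i s ->; rewrite mi1E.
by case: eqVneq => [->|].
Qed.

Lemma sum_mi1 j : (\sum_i mi1 j i)%N = 1%N.
Proof.
rewrite (bigD1 j)//= mi1E eqxx big1 ?addn0// => i ij.
by rewrite mi1E (negPf ij).
Qed.

Lemma size_multi_seq n (a : {ffun 'I_d -> 'I_n}) : size (multi_seq a) = (\sum_i a i)%N.
Proof.
rewrite /multi_seq size_flatten /shape -map_comp sumnE big_map big_enum /=.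
by apply: eq_bigr => i _; rewrite size_nseq.
Qed.

End multi_indices.

(** * Weak derivatives and H^1_0 *)

Lemma ler_sum_lin (R : numDomainType) (I : finType) (P : pred I) (F G H : I -> R) (c k x y z : R) :
  x = \sum_(i | P i) H i -> y = \sum_(i | P i) F i -> z = \sum_(i | P i) G i ->
  (forall i, P i -> H i <= k * (c * F i + G i)) -> x <= k * (c * y + z).
Proof. by move=> -> -> -> HFG; rewrite mulr_sumr -big_split mulr_sumr /=; exact: ler_sum. Qed.

Lemma ler_add2_lin (R : realDomainType) (c k x x0 x1 y y0 y1 z z0 z1 : R) :
  x = x0 + x1 -> y = y0 + y1 -> z = z0 + z1 ->
  x0 <= k * (c * y0 + z0) -> x1 <= k * (c * y1 + z1) -> x <= k * (c * y + z).
Proof.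
move=> -> -> -> h0 h1; apply: le_trans (lerD h0 h1) _.
by rewrite -mulrDr (mulrDr c) addrACA.
Qed.

Lemma addr_shift (V : zmodType) (x1 x2 y1 y2 z2 : V) :
  x2 = z2 + y2 -> y1 + y2 = 0 -> x1 + x2 = (x1 - y1) + z2.
Proof. by move=> -> /eqP; rewrite addr_eq0 => /eqP ->; rewrite opprK addrA addrAC. Qed.

Section weak_derivatives.
Context (R : realType) (d : nat) (Om : set 'rV[R]_d).
Hypotheses (oOm : open Om) (bOm : bounded_set Om).
Local Notation E := 'rV[R]_d.
Local Notation leb := (lebesgue_rV R d).
Implicit Types (f g k phi psi : E -> R) (s : seq 'I_d).

Let mOm : measurable Om. Proof. exact: open_measurable_rV. Qed.
Let fOm : (leb Om < +oo)%E. Proof. exact: lebesgue_rV_bounded. Qed.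
Let testL2 f : test_fun Om f -> L2 Om f. Proof. exact: test_fun_L2. Qed.
Local Hint Resolve mOm : core.

(** The derivative of the product of two test functions has integral zero. *)
Lemma ip_pderiv_test phi psi j : test_fun Om phi -> test_fun Om psi ->
  ip Om phi (pderiv j psi) = - ip Om (pderiv j phi) psi.
Proof.
move=> tp tq; apply/eqP; rewrite -subr_eq0 opprK; apply/eqP.
have sp := test_fun_smooth tp; have sq := test_fun_smooth tq.
have tpq : test_fun Om (phi * psi) by exact: test_fun_mul.
have [M M0 OM] := bounded_set_cbox bOm.
have := @integral_pderiv0 R d (phi * psi) j M
  (fun x => @smooth_derivable _ _ _ x j (test_fun_smooth tpq))
  (smooth_continuous (smooth_pderiv j (test_fun_smooth tpq))).
move=> /(_ (fun x xM => test_fun_out tpq (fun Ox => xM (OM _ Ox)))).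
have tdq := test_fun_pderiv j tq; have tdp := test_fun_pderiv j tp.
rewrite pderivM; [|by move=> x; exact: smooth_derivable..].
have L1 : L2 Om (cst 1) by apply: (@L2_bounded _ _ _ mOm _ 1) => // x _; rewrite normr1.
have La : L2 Om (pderiv j phi * psi) by apply: testL2; exact: test_fun_mul.
have Lb : L2 Om (phi * pderiv j psi).
  by apply: testL2; apply: test_fun_mul => //; exact: smooth_pderiv.
have Lsum := L2D mOm La Lb.
under eq_integral do rewrite -[X in X%:E]mulr1.
rewrite (integral_ip mOm Lsum L1); last first.
  move=> x Ox; rewrite -[(_ + _) x]/(pderiv j phi x * psi x + phi x * pderiv j psi x).
  by rewrite (test_fun_out tq Ox) (test_fun_out tp Ox) mulr0 mul0r addr0 mul0r.
move=> [] e.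
rewrite /ip -RintegralD//; try by apply: L2_integrableM => //; exact: testL2.
by rewrite -[RHS]e; apply: eq_Rintegral => x _; rewrite /= addrC mulr1.
Qed.

Lemma is_weak_deriv_test phi j : test_fun Om phi -> is_weak_deriv Om [:: j] phi (pderiv j phi).
Proof. by move=> tp psi tq; rewrite /= ip_pderiv_test// expr1 mulN1r. Qed.

Lemma is_weak_deriv0 f : is_weak_deriv Om [::] f f.
Proof. by move=> psi tq; rewrite /= expr0 mul1r. Qed.

Lemma is_weak_deriv_lin (a : R) s f g Df Dg : L2 Om f -> L2 Om g -> L2 Om Df -> L2 Om Dg ->
  is_weak_deriv Om s f Df -> is_weak_deriv Om s g Dg ->
  is_weak_deriv Om s (a *: f + g) (a *: Df + Dg).
Proof.
move=> Lf Lg LDf LDg Hf Hg psi tq.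
have Lp := testL2 tq.
have Ls : L2 Om (pderivs s psi).
  by apply: testL2; elim: s {Hf Hg} => //= i s; exact: test_fun_pderiv.
rewrite !ipDl//; try exact: L2Z.
by rewrite !ipZl// Hf// Hg//; ring.
Qed.

(** By the fundamental lemma. Uniqueness up to null sets is expressed by inner
    products, which makes [weak_deriv], a choice among the weak derivatives,
    linear for every purpose of the estimates. *)
Lemma weak_deriv_unique s f D1 D2 k : L2 Om D1 -> L2 Om D2 -> L2 Om k ->
  is_weak_deriv Om s f D1 -> is_weak_deriv Om s f D2 -> ip Om D1 k = ip Om D2 k.
Proof.
move=> L1 L2' Lk H1 H2; apply/eqP; rewrite -subr_eq0 -ipBl//; apply/eqP.
apply: l2norm0_ip => //; first exact: L2B.
apply: test_fun_orthogonal => //; first exact: L2B.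
move=> phi tp; rewrite ipBl//; last exact: testL2.
apply/eqP; rewrite subr_eq0; apply/eqP.
apply: (@mulfI _ ((-1) ^+ size s : R)); first by rewrite signr_eq0.
by rewrite -H1// -H2.
Qed.

Lemma weak_deriv_unique_norm s f D1 D2 : L2 Om D1 -> L2 Om D2 ->
  is_weak_deriv Om s f D1 -> is_weak_deriv Om s f D2 -> l2norm Om D1 = l2norm Om D2.
Proof.
move=> L1 L2' H1 H2; rewrite /l2norm.
by rewrite (weak_deriv_unique L1 L2' L1 H1 H2) ipC (weak_deriv_unique L1 L2' L2' H1 H2).
Qed.

Lemma weak_derivP s f : (exists g, L2 Om g /\ is_weak_deriv Om s f g) ->
  L2 Om (weak_deriv Om s f) /\ is_weak_deriv Om s f (weak_deriv Om s f).
Proof. exact: (@xgetPex _ _ [set g : E -> R | L2 Om g /\ is_weak_deriv Om s f g]). Qed.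

Lemma weak_deriv0_norm f : L2 Om f -> l2norm Om (weak_deriv Om [::] f) = l2norm Om f.
Proof.
move=> Lf; have [L1 H1] := weak_derivP (ex_intro _ f (conj Lf (is_weak_deriv0 f))).
exact: (weak_deriv_unique_norm L1 Lf H1 (is_weak_deriv0 f)).
Qed.

Local Opaque weak_deriv ip l2norm.

Local Notation D j f := (weak_deriv Om [:: j] f).

Lemma in_H1_L2 f : in_H Om 1 f -> L2 Om f. Proof. by case. Qed.

Lemma in_H1P f s : in_H Om 1 f -> (size s <= 1)%N ->
  L2 Om (weak_deriv Om s f) /\ is_weak_deriv Om s f (weak_deriv Om s f).
Proof. by move=> [_ Hf] s1; apply: weak_derivP; exact: Hf. Qed.

Lemma in_H1_D f j : in_H Om 1 f -> L2 Om (D j f).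
Proof. by move=> Hf; have [] := in_H1P Hf (s := [:: j]) isT. Qed.

Lemma in_H1_lin (a : R) f g : in_H Om 1 f -> in_H Om 1 g -> in_H Om 1 (a *: f + g).
Proof.
move=> Hf Hg; have Lf := in_H1_L2 Hf; have Lg := in_H1_L2 Hg.
split; first by apply: L2D => //; exact: L2Z.
move=> s s1; have [L1 W1] := in_H1P Hf s1; have [L2' W2] := in_H1P Hg s1.
exists (a *: weak_deriv Om s f + weak_deriv Om s g); split.
  by apply: L2D => //; exact: L2Z.
exact: is_weak_deriv_lin.
Qed.

Lemma ip_weak_deriv_lin (a : R) f g k s : in_H Om 1 f -> in_H Om 1 g ->
  (size s <= 1)%N -> L2 Om k ->
  ip Om (weak_deriv Om s (a *: f + g)) k =
  a * ip Om (weak_deriv Om s f) k + ip Om (weak_deriv Om s g) k.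
Proof.
move=> Hf Hg s1 Lk.
have Lf := in_H1_L2 Hf; have Lg := in_H1_L2 Hg.
have [L1 W1] := in_H1P Hf s1; have [L2' W2] := in_H1P Hg s1.
have [L3 W3] := in_H1P (in_H1_lin a Hf Hg) s1.
have LZ := L2Z mOm a L1.
rewrite (weak_deriv_unique L3 (L2D mOm LZ L2') Lk W3 (is_weak_deriv_lin a Lf Lg L1 L2' W1 W2)).
by rewrite ipDl// ipZl.
Qed.

Lemma ip_D_lin (a : R) f g k j : in_H Om 1 f -> in_H Om 1 g -> L2 Om k ->
  ip Om (D j (a *: f + g)) k = a * ip Om (D j f) k + ip Om (D j g) k.
Proof. by move=> *; exact: ip_weak_deriv_lin. Qed.

Lemma sqr_weak_deriv_lin (a : R) f g s : in_H Om 1 f -> in_H Om 1 g ->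
  (size s <= 1)%N ->
  l2norm Om (weak_deriv Om s (a *: f + g)) ^+ 2 <=
  2 * (a ^+ 2 * l2norm Om (weak_deriv Om s f) ^+ 2 + l2norm Om (weak_deriv Om s g) ^+ 2).
Proof.
move=> Hf Hg s1.
have Lf := in_H1_L2 Hf; have Lg := in_H1_L2 Hg.
have [L1 W1] := in_H1P Hf s1; have [L2' W2] := in_H1P Hg s1.
have [L3 W3] := in_H1P (in_H1_lin a Hf Hg) s1.
have LZ := L2Z mOm a L1.
rewrite (weak_deriv_unique_norm L3 (L2D mOm LZ L2') W3 (is_weak_deriv_lin a Lf Lg L1 L2' W1 W2)).
move: (weak_deriv Om s f) (weak_deriv Om s g) L1 LZ L2' {W1 W2 L3 W3} => p q L1 LZ L2'.
have sqE (c : R) : ip Om (c *: p + q) (c *: p + q) =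
    c ^+ 2 * ip Om p p + 2 * c * ip Om p q + ip Om q q.
  have Lc := L2Z mOm c L1.
  rewrite (ipDl mOm Lc L2' (L2D mOm Lc L2')) (ipDr mOm Lc L2' Lc) (ipDr mOm Lc L2' L2').
  rewrite (ipZl mOm c L1 Lc) (ipZr mOm c L1 L1) (ipZl mOm c L1 L2') (ipZr mOm c L1 L2').
  rewrite (ipC Om q p); move: (ip Om p p) (ip Om p q) (ip Om q q) => x y z.
  ring.
have := ip_ge0 Om (- a *: p + q).
rewrite (sqr_l2norm Om (a *: p + q)) (sqr_l2norm Om p) (sqr_l2norm Om q) (sqE a) (sqE (- a)) sqrrN.
move: (ip Om p p) (ip Om p q) (ip Om q q) => x y z; lra.
Qed.

Lemma test_fun_H1 phi : test_fun Om phi -> in_H Om 1 phi.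
Proof.
move=> tp; split; first exact: testL2.
case=> [_|j [_|//]]; first by exists phi; split; [exact: testL2|exact: is_weak_deriv0].
by exists (pderiv j phi); split; [exact/testL2/test_fun_pderiv|exact: is_weak_deriv_test].
Qed.

Lemma ip_D_test phi j k : test_fun Om phi -> L2 Om k ->
  ip Om (D j phi) k = ip Om (pderiv j phi) k.
Proof.
move=> tp Lk; have [L1 W1] := in_H1P (test_fun_H1 tp) (s := [:: j]) isT.
by apply: (weak_deriv_unique L1 _ Lk W1 (is_weak_deriv_test j tp)); exact/testL2/test_fun_pderiv.
Qed.

Lemma Hnorm1E f : Hnorm Om 1 f ^+ 2 = Hsemi Om 0 f ^+ 2 + Hsemi Om 1 f ^+ 2.
Proof.
rewrite /Hnorm sqr_sqrtr; last by apply: sumr_ge0 => k _; exact: sqr_ge0.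
by rewrite big_ord_recl big_ord1.
Qed.

Lemma sqr_Hsemi l f : Hsemi Om l f ^+ 2 = \sum_(a : {ffun 'I_d -> 'I_l.+1} | (\sum_i a i == l)%N)
     l2norm Om (weak_deriv Om (multi_seq a) f) ^+ 2.
Proof. by rewrite /Hsemi sqr_sqrtr//; apply: sumr_ge0 => i _; exact: sqr_ge0. Qed.

Lemma Hsemi_ge0 l f : 0 <= Hsemi Om l f. Proof. exact: sqrtr_ge0. Qed.

Local Opaque Hsemi Hnorm.

Lemma le_Hsemi0 f : l2norm Om (weak_deriv Om [::] f) <= Hsemi Om 0 f.
Proof.
rewrite -ler_sqr ?nnegrE ?l2norm_ge0 ?Hsemi_ge0// sqr_Hsemi.
rewrite (bigD1 (mi0 d 0)) ?sum_mi0//= multi_seq0 lerDl.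
by apply: sumr_ge0 => i _; rewrite sqr_ge0.
Qed.

Lemma le_Hsemi1 f j : l2norm Om (D j f) <= Hsemi Om 1 f.
Proof.
rewrite -ler_sqr ?nnegrE ?l2norm_ge0 ?Hsemi_ge0// sqr_Hsemi.
rewrite (bigD1 (mi1 j)) ?sum_mi1//= multi_seq1 lerDl.
by apply: sumr_ge0 => i _; rewrite sqr_ge0.
Qed.

Lemma Hsemi_Hnorm1 f : Hsemi Om 0 f <= Hnorm Om 1 f /\ Hsemi Om 1 f <= Hnorm Om 1 f.
Proof.
by split; rewrite -ler_sqr ?nnegrE ?Hsemi_ge0 ?sqrtr_ge0// Hnorm1E ?lerDl ?lerDr sqr_ge0.
Qed.

Lemma sqr_Hsemi_lin (a : R) l f g : (l <= 1)%N -> in_H Om 1 f -> in_H Om 1 g ->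
  Hsemi Om l (a *: f + g) ^+ 2 <= 2 * (a ^+ 2 * Hsemi Om l f ^+ 2 + Hsemi Om l g ^+ 2).
Proof.
move=> l1 Hf Hg.
apply: (ler_sum_lin (sqr_Hsemi l (a *: f + g)) (sqr_Hsemi l f) (sqr_Hsemi l g)) => b /eqP bl; apply: sqr_weak_deriv_lin => //.
by rewrite size_multi_seq bl.
Qed.

Lemma sqr_Hnorm1_lin (a : R) f g : in_H Om 1 f -> in_H Om 1 g ->
  Hnorm Om 1 (a *: f + g) ^+ 2 <= 2 * (a ^+ 2 * Hnorm Om 1 f ^+ 2 + Hnorm Om 1 g ^+ 2).
Proof.
move=> Hf Hg.
exact: (ler_add2_lin (Hnorm1E (a *: f + g)) (Hnorm1E f) (Hnorm1E g)
  (sqr_Hsemi_lin a (isT : (0 <= 1)%N) Hf Hg) (sqr_Hsemi_lin a (isT : (1 <= 1)%N) Hf Hg)).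
Qed.

(** The condition that [spaceX] puts on each component. *)
Definition H10 f := in_H Om 1 f /\
  forall e : R, 0 < e -> exists2 phi, test_fun Om phi & Hnorm Om 1 (f - phi) < e.

Lemma H10_lin (a : R) f g : H10 f -> H10 g -> H10 (a *: f + g).
Proof.
move=> [Hf af] [Hg ag]; split; first exact: in_H1_lin.
move=> e e0.
(* one is added because the scalar may vanish *)
have a0 : 0 < `|a| + 1 by rewrite ltr_wpDl.
have [phi tp fp] := af (e / (2 * (`|a| + 1))) ltac:(by rewrite divr_gt0// mulr_gt0).
have [psi tq gq] := ag (e / 2) ltac:(by rewrite divr_gt0).
exists (a *: phi + psi); first by apply: test_funD => //; exact: test_funZ.
have -> : a *: f + g - (a *: phi + psi) = a *: (f - phi) + (g - psi).
  by rewrite scalerBr opprD addrACA.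
have N1 : in_H Om 1 (f - phi).
  by rewrite addrC -scaleN1r; apply: in_H1_lin => //; exact: test_fun_H1.
have N2 : in_H Om 1 (g - psi).
  by rewrite addrC -scaleN1r; apply: in_H1_lin => //; exact: test_fun_H1.
rewrite -ltr_sqr ?nnegrE ?sqrtr_ge0 ?(ltW e0)//.
apply: le_lt_trans (sqr_Hnorm1_lin a N1 N2) _.
have q : Hnorm Om 1 (g - psi) ^+ 2 < (e / 2) ^+ 2.
  by rewrite ltr_sqr ?nnegrE ?sqrtr_ge0// divr_ge0// ltW.
have p : a ^+ 2 * Hnorm Om 1 (f - phi) ^+ 2 <= (e / 2) ^+ 2.
  rewrite -real_normK ?num_real// -exprMn ler_sqr ?nnegrE ?mulr_ge0 ?sqrtr_ge0 ?divr_ge0 ?(ltW e0)//.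
  apply: le_trans (_ : (`|a| + 1) * (e / (2 * (`|a| + 1))) <= _).
    by apply: ler_pM; rewrite ?sqrtr_ge0 ?(ltW fp)// lerDl.
  by rewrite le_eqVlt; apply/orP; left; apply/eqP; field; rewrite gt_eqF.
have -> : e ^+ 2 = 2 * ((e / 2) ^+ 2 + (e / 2) ^+ 2) by field.
by rewrite ltr_pM2l//; exact: ler_ltD.
Qed.

(** The norms of H^1 are sums over multi-indices; this singles out the terms
    of order zero and one, in which the estimates are written. *)
Lemma H10_approx f (e : R) : H10 f -> 0 < e -> exists phi, [/\ test_fun Om phi,
  l2norm Om (f - phi) <= e, (forall j, l2norm Om (D j (f - phi)) <= e) &
  in_H Om 1 (f - phi)].
Proof.
move=> [Hf af] e0; have [phi tp fp] := af e e0; exists phi.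
have Hd : in_H Om 1 (f - phi).
  by rewrite addrC -scaleN1r; apply: in_H1_lin => //; exact: test_fun_H1.
have [h0 h1] := Hsemi_Hnorm1 (f - phi).
split=> //.
  rewrite -weak_deriv0_norm; last exact: in_H1_L2.
  exact: le_trans (le_Hsemi0 _) (le_trans h0 (ltW fp)).
by move=> j; exact: le_trans (le_Hsemi1 _ j) (le_trans h1 (ltW fp)).
Qed.

Lemma eq0_eps (x c : R) : 0 <= c -> (forall e, 0 < e -> `|x| <= c * e) -> x = 0.
Proof.
move=> c0 H; apply/eqP; rewrite -normr_le0; apply/ler_addgt0Pl => e e0.
have c1 : 0 < c + 1 by rewrite ltr_wpDl.
apply: le_trans (H (e / (c + 1)) ltac:(by rewrite divr_gt0)) _.
rewrite addr0 mulrCA ler_piMr ?(ltW e0)// ler_pdivrMr// mul1r.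
by rewrite lerDl.
Qed.

(** The functional is continuous in the norm of H^1, in which test functions
    are dense in H^1_0 by definition. Identities between products are passed
    to H^1_0 by using this for one factor at a time. *)
Lemma H10_density A B j f : L2 Om A -> L2 Om B ->
  (forall phi, test_fun Om phi -> ip Om A phi + ip Om B (pderiv j phi) = 0) ->
  H10 f -> ip Om A f + ip Om B (D j f) = 0.
Proof.
move=> LA LB H0 Hf; have H1f := Hf.1.
apply: (@eq0_eps _ (l2norm Om A + l2norm Om B)).
  by rewrite addr_ge0// l2norm_ge0.
move=> e e0; have [phi [tp fp Dfp Hd]] := H10_approx Hf e0.
have Lf := in_H1_L2 H1f; have Lp := testL2 tp.
have Ldp := testL2 (test_fun_pderiv j tp).
have LDf := in_H1_D j H1f; have LDd := in_H1_D j Hd.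
have eD : ip Om B (D j f) = ip Om B (D j (f - phi)) + ip Om B (pderiv j phi).
  rewrite ![ip Om B _]ipC -ip_D_test//.
  have := ip_D_lin 1 j (k := B) Hd (test_fun_H1 tp) LB.
  by rewrite scale1r mul1r subrK.
have -> : ip Om A f + ip Om B (D j f) = ip Om A (f - phi) + ip Om B (D j (f - phi)).
  by rewrite (ipBr mOm Lf Lp LA); exact: (addr_shift _ eD (H0 _ tp)).
apply: le_trans (ler_normD _ _) _; rewrite mulrDl; apply: lerD.
  apply: le_trans (cauchy_schwarz mOm LA (L2B mOm Lf Lp)) _.
  by rewrite ler_wpM2l ?l2norm_ge0.
apply: le_trans (cauchy_schwarz mOm LB LDd) _.
by rewrite ler_wpM2l ?l2norm_ge0.
Qed.

End weak_derivatives.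

(** * Trilinear estimates for bounded functions in H^1_0 *)

Lemma young_absorb (R : realFieldType) (x y z v w W : R) :
  W = x + y -> x <= z -> y <= 5 / 6 * W + 6^-1 * v -> v <= w -> W <= 6 * z + w.
Proof. lra. Qed.

Section bounded_H10.
Context (R : realType) (d : nat) (Om : set 'rV[R]_d).
Hypotheses (oOm : open Om) (bOm : bounded_set Om).
Local Notation E := 'rV[R]_d.
Local Notation leb := (lebesgue_rV R d).
Implicit Types (f g k phi psi : E -> R).
Local Notation D j f := (weak_deriv Om [:: j] f).

Let mOm : measurable Om. Proof. exact: open_measurable_rV. Qed.
Let fOm : (leb Om < +oo)%E. Proof. exact: lebesgue_rV_bounded. Qed.
Let testL2 f : test_fun Om f -> L2 Om f. Proof. exact: test_fun_L2. Qed.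

Definition bdd f := exists M : R, forall x, Om x -> `|f x| <= M.

Lemma bddM f g : bdd f -> bdd g -> bdd (f * g).
Proof.
move=> [M fM] [N gN]; exists (M * N) => x Ox.
by rewrite normrM; apply: ler_pM; [| |exact: fM|exact: gN].
Qed.

Lemma bdd_lin (a : R) f g : bdd f -> bdd g -> bdd (a *: f + g).
Proof.
move=> [M fM] [N gN]; exists (`|a| * M + N) => x Ox.
apply: le_trans (ler_normD _ _) _; apply: lerD; last exact: gN.
by rewrite normrM ler_wpM2l//; exact: fM.
Qed.

Lemma bdd_test f : test_fun Om f -> bdd f.
Proof. by move=> /test_fun_bounded[M fM]; exists M => x _. Qed.

Lemma L2M_bdd f g : L2 Om f -> L2 Om g -> bdd g -> L2 Om (f * g).
Proof. by move=> Lf [mg _] [M gM]; exact: (L2_bounded_mul mOm Lf mg gM). Qed.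

Lemma L2M_bddl f g : L2 Om f -> L2 Om g -> bdd f -> L2 Om (f * g).
Proof. by move=> Lf Lg bf; rewrite mulrC; exact: L2M_bdd. Qed.

Local Opaque weak_deriv ip l2norm Hsemi Hnorm L2.

(** Leibniz' rule for two test functions, which density then replaces one
    after the other by [f] and [g]; boundedness keeps the products in L^2. *)
Lemma ibp_triple j f g k : in_H Om 1 k -> bdd k -> H10 Om f -> bdd f -> H10 Om g ->
  ip Om (D j k * f + k * D j f) g + ip Om (k * f) (D j g) = 0.
Proof.
move=> Hk bk Hf bf Hg; have Lk := in_H1_L2 Hk; have LDk := in_H1_D j Hk.
have Lf := in_H1_L2 Hf.1; have LDf := in_H1_D j Hf.1.
have [_ Wk] := in_H1P Hk (s := [:: j]) isT.
have LDkf := L2M_bdd LDk Lf bf; have LkDf := L2M_bddl Lk LDf bk.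
have Lkf := L2M_bdd Lk Lf bf.
apply: H10_density => //; first exact: L2D.
move=> psi tq; have Lq := testL2 tq; have bq := bdd_test tq.
have tdq := test_fun_pderiv j tq; have Ldq := testL2 tdq; have bdq := bdd_test tdq.
have LDkq := L2M_bdd LDk Lq bq; have Lkdq := L2M_bdd Lk Ldq bdq; have Lkq := L2M_bdd Lk Lq bq.
have step : ip Om (D j k * psi + k * pderiv j psi) f + ip Om (k * psi) (D j f) = 0.
  apply: H10_density => //; first exact: L2D.
  move=> phi tp; have Lp := testL2 tp.
  have sp := test_fun_smooth tp; have sq := test_fun_smooth tq.
  have tdp := test_fun_pderiv j tp; have Ldp := testL2 tdp.
  have := Wk _ (test_fun_mul tp sq).
  rewrite [pderivs _ _]/= pderivM; [|by move=> x; exact: smooth_derivable..].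
  have t1 : test_fun Om (pderiv j phi * psi) by exact: test_fun_mul.
  have t2 : test_fun Om (phi * pderiv j psi) by apply: test_fun_mul => //; exact: smooth_pderiv.
  rewrite (ipDr mOm (testL2 t1) (testL2 t2) Lk) [size _]/= expr1 mulN1r.
  rewrite (ipDl mOm LDkq Lkdq Lp) !ip_mulA (mulrC psi phi) (mulrC psi (pderiv j phi)) (mulrC (pderiv j psi) phi).
  move: (ip Om k _) (ip Om k _) (ip Om (D j k) _) => x y z; lra.
rewrite -[RHS]step.
rewrite (ipDl mOm LDkf LkDf Lq) (ipDl mOm LDkq Lkdq Lf) !ip_mulA.
rewrite (mulrC psi f) (mulrC psi (D j f)) (mulrC (pderiv j psi) f).
move: (ip Om k _) (ip Om k _) (ip Om (D j k) _) => x y z; lra.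
Qed.

(** The L^6 bound passes from test functions to bounded elements of H^1_0
    without extracting convergent subsequences: Young's inequality absorbs
    the part of the integral of f^6 = f^5 (f - phi) + f^5 phi that is not
    controlled by phi. *)
Lemma sobolev_H10 : d = 2%N \/ d = 3%N -> exists2 C : R, 0 < C &
  forall f, H10 Om f -> bdd f -> forall G : R, 0 < G ->
    (forall j, l2norm Om (D j f) <= G) -> ip Om (cube f) (cube f) <= C * G ^+ 6.
Proof.
move=> d23; have [C C0 HC] := sobolev6 d23 oOm bOm.
exists (C * 2 ^+ 6); first by rewrite mulr_gt0// exprn_gt0.
move=> f Hf bf G G0 fG.
have Lf := in_H1_L2 Hf.1.
have bf2 := bddM bf bf; have Lf2 := L2M_bdd Lf Lf bf.
have bf3 := bddM bf2 bf; have Lf3 : L2 Om (cube f) := L2M_bdd Lf2 Lf bf.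
have bf4 := bddM bf3 bf; have Lf4 := L2M_bdd Lf3 Lf bf.
have Lf5 := L2M_bdd Lf4 Lf bf.
set f5 : E -> R := f * f * f * f * f in Lf5.
set W := ip Om (cube f) (cube f).
have WE : W = ip Om f5 f by rewrite /W /cube /f5 !ip_mulA !mulrA.
have H (e : R) : 0 < e -> e <= G -> W <= 6 * l2norm Om f5 * e + C * (2 * G) ^+ 6.
  move=> e0 eG; have [phi [tp fp Dfp Hd]] := H10_approx oOm bOm Hf e0.
  have Lp := testL2 tp; have tc := test_cube tp; have Lc := testL2 tc.
  have phiG j : l2norm Om (pderiv j phi) <= 2 * G.
    have L1 := in_H1_D j Hd; have L2' := in_H1_D j Hf.1.
    have [_ W1] := in_H1P Hd (s := [:: j]) isT.
    have [_ W2] := in_H1P Hf.1 (s := [:: j]) isT.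
    have LZ := L2Z mOm (- 1) L1.
    have := is_weak_deriv_lin oOm bOm (- 1) (in_H1_L2 Hd) Lf L1 L2' W1 W2.
    rewrite (_ : - 1 *: (f - phi) + f = phi); last by rewrite scaleN1r opprB subrK.
    move=> W3; have tdp := test_fun_pderiv j tp.
    rewrite (weak_deriv_unique_norm oOm bOm (testL2 tdp) (L2D mOm LZ L2')
      (is_weak_deriv_test oOm bOm j tp) W3).
    apply: le_trans (l2normD mOm LZ L2') _.
    rewrite (l2normZ mOm _ L1) normrN1 mul1r mulr2n mulrDl mul1r.
    by apply: lerD; [exact: le_trans (Dfp j) eG|exact: fG].
  have Y : ip Om (cube phi) (cube phi) <= C * (2 * G) ^+ 6.
    by apply: (HC _ tp) => //; rewrite mulr_gt0.
  have e1 : W = ip Om f5 (f - phi) + ip Om f5 phi.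
    by rewrite WE -(ipDr mOm (L2B mOm Lf Lp) Lp Lf5) subrK.
  have e2 : ip Om f5 (f - phi) <= l2norm Om f5 * e.
    apply: le_trans (ler_norm _) _; apply: le_trans (cauchy_schwarz mOm Lf5 (L2B mOm Lf Lp)) _.
    by rewrite ler_wpM2l ?l2norm_ge0.
  have e3 : ip Om f5 phi <= 5 / 6 * W + 6^-1 * ip Om (cube phi) (cube phi).
    rewrite -(ipZl mOm (5 / 6) Lf3 Lf3) -(ipZl mOm (6^-1) Lc Lc).
    apply: (le_ip2 mOm Lf5 Lp (L2Z mOm _ Lf3) Lf3 (L2Z mOm _ Lc) Lc) => x _.
    rewrite -[f5 x]/(f x * f x * f x * f x * f x).
    rewrite -[(_ *: cube f) x]/(5 / 6 * cube f x) -[(_ *: cube phi) x]/(6^-1 * cube phi x) !cubeE.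
    move: (f x) (phi x) => a b; rewrite -subr_ge0.
    (* 6 a^5 b <= 5 a^6 + b^6 *)
    have -> : 5 / 6 * a ^+ 3 * a ^+ 3 + 6^-1 * b ^+ 3 * b ^+ 3 - a * a * a * a * a * b =
      6^-1 * ((a - b) ^+ 2 * ((b ^+ 2 + a * b) ^+ 2 + 2 * (a * (a + b)) ^+ 2 + 3 * (a ^+ 2) ^+ 2)).
      by field.
    apply: mulr_ge0; first by rewrite invr_ge0.
    apply: mulr_ge0; first exact: sqr_ge0.
    apply: addr_ge0; last by apply: mulr_ge0 => //; exact: sqr_ge0.
    by apply: addr_ge0; [exact: sqr_ge0|apply: mulr_ge0 => //; exact: sqr_ge0].
  by rewrite -mulrA; exact: (young_absorb e1 e2 e3 Y).
rewrite -mulrA -exprMn; apply/ler_addgt0Pl => e e0.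
have n0 : 0 < 6 * l2norm Om f5 + 1 by rewrite ltr_wpDl// mulr_ge0// l2norm_ge0.
have m0 : 0 < Num.min G (e / (6 * l2norm Om f5 + 1)) by rewrite lt_min G0 divr_gt0.
apply: le_trans (H _ m0 _) _; first by rewrite ge_min lexx.
apply: lerD => //.
apply: (@le_trans _ _ ((6 * l2norm Om f5 + 1) * (e / (6 * l2norm Om f5 + 1)))).
  apply: ler_pM; rewrite ?mulr_ge0 ?l2norm_ge0 ?(ltW m0) ?lerDl//.
  by rewrite ge_min lexx orbT.
by rewrite mulrC divfK// gt_eqF.
Qed.

(** The estimate that makes the condition on the time step linear in 1/h:
    the weight [g] only enters through the geometric mean of its norms in L^2
    and in H^1_0. *)
Lemma ip_mul_le : d = 2%N \/ d = 3%N -> exists2 C : R, 0 < C &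
  forall f g, H10 Om f -> bdd f -> H10 Om g -> bdd g -> forall s q : R, 0 < s -> 0 < q ->
    (forall j, l2norm Om (D j f) <= s) -> (forall j, l2norm Om (D j g) <= q) ->
    ip Om (f * g) (f * g) <= C * s ^+ 2 * q * l2norm Om g.
Proof.
move=> d23; have [C C0 HC] := sobolev_H10 d23.
exists (Num.sqrt C) => [|f g Hf bf Hg bg s q s0 q0 fs gq]; first by rewrite sqrtr_gt0.
have Lf := in_H1_L2 Hf.1; have Lg := in_H1_L2 Hg.1.
have bf2 := bddM bf bf; have Lf2 := L2M_bdd Lf Lf bf; have Lf3 : L2 Om (cube f) := L2M_bdd Lf2 Lf bf.
have Lg2 := L2M_bdd Lg Lg bg; have Lg3 : L2 Om (cube g) := L2M_bdd Lg2 Lg bg.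
have Lffg : L2 Om (f * f * g) := L2M_bdd Lf2 Lg bg.
have -> : ip Om (f * g) (f * g) = ip Om (f * f * g) g by rewrite !ip_mulA (mulrCA g f g).
apply: le_trans (ler_norm _) _; apply: le_trans (cauchy_schwarz mOm Lffg Lg) _.
rewrite ler_wpM2r ?l2norm_ge0//.
rewrite -ler_sqr ?nnegrE ?l2norm_ge0 ?mulr_ge0 ?sqrtr_ge0 ?exprn_ge0 ?(ltW s0) ?(ltW q0)//.
rewrite sqr_l2norm.
have -> : (Num.sqrt C * s ^+ 2 * q) ^+ 2 =
   (2 / 3 * (q ^+ 2 / s ^+ 2)) * (C * s ^+ 6) + 3^-1 * (s ^+ 4 / q ^+ 4) * (C * q ^+ 6).
  rewrite 2!exprMn sqr_sqrtr ?(ltW C0)//; field; rewrite ?gt_eqF//.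
have c1 : 0 <= 2 / 3 * (q ^+ 2 / s ^+ 2) by apply: mulr_ge0 => //; apply: divr_ge0; apply: exprn_ge0; exact: ltW.
have c2 : 0 <= 3^-1 * (s ^+ 4 / q ^+ 4) by apply: mulr_ge0 => //; apply: divr_ge0; apply: exprn_ge0; exact: ltW.
apply: (@le_trans _ _ (ip Om ((2 / 3 * (q ^+ 2 / s ^+ 2)) *: cube f) (cube f) +
   ip Om ((3^-1 * (s ^+ 4 / q ^+ 4)) *: cube g) (cube g))); last first.
  rewrite (ipZl mOm _ Lf3 Lf3) (ipZl mOm _ Lg3 Lg3); apply: lerD.
    by rewrite ler_wpM2l//; exact: HC.
  by rewrite ler_wpM2l//; exact: HC.
apply: (le_ip2 mOm Lffg Lffg (L2Z mOm _ Lf3) Lf3 (L2Z mOm _ Lg3) Lg3) => x _.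
rewrite -[(f * f * g) x]/(f x * f x * g x).
rewrite -[(_ *: cube f) x]/(2 / 3 * (q ^+ 2 / s ^+ 2) * cube f x).
rewrite -[(_ *: cube g) x]/(3^-1 * (s ^+ 4 / q ^+ 4) * cube g x) !cubeE.
move: (f x) (g x) => a b; rewrite -subr_ge0.
(* 3 x^2 y <= 2 x^3 + y^3 for x = (a / s)^2 and y = (b / q)^2 *)
have -> : 2 / 3 * (q ^+ 2 / s ^+ 2) * a ^+ 3 * a ^+ 3 + 3^-1 * (s ^+ 4 / q ^+ 4) * b ^+ 3 * b ^+ 3 -
    a * a * b * (a * a * b) =
  3^-1 * (s ^+ 4 * q ^+ 2) * (((a / s) ^+ 2 - (b / q) ^+ 2) ^+ 2 * (2 * (a / s) ^+ 2 + (b / q) ^+ 2)).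
  by field; rewrite ?gt_eqF.
apply: mulr_ge0.
  by apply: mulr_ge0; [rewrite invr_ge0|apply: mulr_ge0; apply: exprn_ge0; exact: ltW].
apply: mulr_ge0; first exact: sqr_ge0.
by apply: addr_ge0; [apply: mulr_ge0 => //; exact: sqr_ge0|exact: sqr_ge0].
Qed.

(** Both halves of the skew-symmetric form are bounded without differentiating
    [k]: in the first, the derivative is moved to the other two factors. *)
Lemma trilinear_le : d = 2%N \/ d = 3%N -> exists2 C : R, 0 < C &
  forall w k v j, H10 Om w -> bdd w -> H10 Om k -> bdd k -> H10 Om v -> bdd v ->
  forall a q c : R, 0 < a -> 0 < q -> 0 < c ->
    (forall j, l2norm Om (D j w) <= a) -> (forall j, l2norm Om (D j k) <= q) ->
    (forall j, l2norm Om (D j v) <= c) ->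
    `|ip Om (w * D j k) v| <= 2 * (Num.sqrt (C * q * l2norm Om k) * a * c) /\
    `|ip Om (w * D j v) k| <= Num.sqrt (C * q * l2norm Om k) * a * c.
Proof.
move=> d23; have [C C0 HC] := ip_mul_le d23; exists C => //.
move=> w k v j Hw bw Hk bk Hv bv a q c a0 q0 c0 wa kq vc.
have Lw := in_H1_L2 Hw.1; have Lk := in_H1_L2 Hk.1; have Lv := in_H1_L2 Hv.1.
have LDw := in_H1_D j Hw.1; have LDk := in_H1_D j Hk.1; have LDv := in_H1_D j Hv.1.
have Lwk := L2M_bdd Lw Lk bk; have Lvk := L2M_bdd Lv Lk bk.
set S := C * q * l2norm Om k.
have S0 : 0 <= S by rewrite !mulr_ge0 ?l2norm_ge0// ltW.
have bound f s : H10 Om f -> bdd f -> 0 < s -> (forall j, l2norm Om (D j f) <= s) ->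
    l2norm Om (f * k) <= Num.sqrt S * s.
  move=> Hf bf s0 fs.
  rewrite -ler_sqr ?nnegrE ?l2norm_ge0 ?mulr_ge0 ?sqrtr_ge0 ?(ltW s0)//.
  rewrite sqr_l2norm exprMn sqr_sqrtr//.
  apply: le_trans (HC f k Hf bf Hk bk s q s0 q0 fs kq) _.
  by rewrite /S le_eqVlt; apply/orP; left; apply/eqP; ring.
have Bw := bound w a Hw bw a0 wa; have Bv := bound v c Hv bv c0 vc.
have t1 : `|ip Om (D j v) (w * k)| <= Num.sqrt S * a * c.
  apply: le_trans (cauchy_schwarz mOm LDv Lwk) _; rewrite mulrC.
  by apply: ler_pM; rewrite ?l2norm_ge0//; exact: vc.
have t2 : `|ip Om (D j w) (v * k)| <= Num.sqrt S * a * c.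
  apply: le_trans (cauchy_schwarz mOm LDw Lvk) _; rewrite mulrC mulrAC.
  by apply: ler_pM; rewrite ?l2norm_ge0//; exact: wa.
have h2 : `|ip Om (w * D j v) k| <= Num.sqrt S * a * c by rewrite (mulrC w) ip_mulA.
split=> //.
have e := ibp_triple j Hk.1 bk Hw bw Hv.
have LDkw := L2M_bdd LDk Lw bw; have LkDw := L2M_bddl Lk LDw bk.
have -> : ip Om (w * D j k) v = - ip Om (D j w) (v * k) - ip Om (D j v) (w * k).
  move: e; rewrite (ipDl mOm LDkw LkDw Lv) (mulrC w (D j k)).
  rewrite (ipC _ (k * w)) (mulrC k w) (mulrC k (D j w)) (ip_mulA _ (D j w) k v) (mulrC k v).
  by move: (ip Om (D j k * w) v) (ip Om (D j w) _) (ip Om (D j v) _) => x y z; lra.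
apply: le_trans (ler_normB _ _) _; rewrite normrN mulr2n mulrDl mul1r.
exact: lerD.
Qed.

End bounded_H10.

(** * Vector fields and finite element spaces *)

Section vector_fields.
Context (R : realType) (d : nat) (Om : set 'rV[R]_d).
Hypotheses (oOm : open Om) (bOm : bounded_set Om).
Local Notation E := 'rV[R]_d.
Local Notation leb := (lebesgue_rV R d).
Implicit Types (u v w z U : E -> E).
Local Notation D j f := (weak_deriv Om [:: j] f).
Local Notation cmp := Defs.comp.

Let mOm : measurable Om. Proof. exact: open_measurable_rV. Qed.
Let fOm : (leb Om < +oo)%E. Proof. exact: lebesgue_rV_bounded. Qed.

Lemma comp_lin (a : R) u v i : cmp (a *: u + v) i = a *: cmp u i + cmp v i.
Proof. by apply/funext => x; rewrite /Defs.comp mxE mxE. Qed.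

Lemma comp_sum (I : Type) (r : seq I) (F : I -> E -> E) i :
  cmp (\sum_(k <- r) F k) i = \sum_(k <- r) cmp (F k) i.
Proof.
elim: r => [|k r IH]; first by rewrite !big_nil; apply/funext => x; rewrite /Defs.comp mxE.
rewrite !big_cons -IH; apply/funext => x; rewrite /Defs.comp.
by rewrite -[(F k + _) x]/(F k x + _ x) mxE.
Qed.

Lemma spaceXP v : spaceX Om v <-> forall i, H10 Om (cmp v i).
Proof.
split=> [[Hv av] i|H]; first by split; [exact: Hv|exact: av].
by split=> i; have [] := H i.
Qed.

Lemma spaceX_lin (a : R) u v : spaceX Om u -> spaceX Om v -> spaceX Om (a *: u + v).
Proof.
move=> /spaceXP Hu /spaceXP Hv; apply/spaceXP => i.
by rewrite comp_lin; exact: H10_lin.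
Qed.

Lemma spaceQ_lin (a : R) (p q : E -> R) : spaceQ Om p -> spaceQ Om q -> spaceQ Om (a *: p + q).
Proof.
move=> [Lp p0] [Lq q0]; split; first by apply: L2D => //; exact: L2Z.
have L1 : L2 Om (cst 1) by apply: (@L2_bounded _ _ _ mOm _ 1) => // x _; rewrite normr1.
have e f : L2 Om f -> \int[leb]_(x in Om) f x = ip Om f (cst 1).
  by move=> _; apply: eq_Rintegral => x _; rewrite mulr1.
rewrite e; last by apply: L2D => //; exact: L2Z.
rewrite (ipDl mOm (L2Z mOm a Lp) Lq L1) (ipZl mOm a Lp L1) -(e _ Lp) -(e _ Lq).
by rewrite p0 q0 mulr0 addr0.
Qed.

Lemma span_of_lin (V : lmodType R) n (e : 'I_n -> V) (a : R) (u v : V) :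
  span_of e u -> span_of e v -> span_of e (a *: u + v).
Proof.
move=> [c ->] [c' ->]; exists (fun i => a * c i + c' i).
rewrite scaler_sumr -big_split; apply: eq_bigr => i _.
by rewrite scalerDl scalerA.
Qed.

Lemma poly_fun_bounded n (p : E -> R) : poly_fun n p -> exists B : R, forall x, Om x -> `|p x| <= B.
Proof.
move=> [c ->]; have [M M0 OM] := bounded_set_cbox bOm.
exists (\sum_(a : {ffun 'I_d -> 'I_n.+1} | (\sum_i a i <= n)%N) `|c a| * \prod_i M ^+ a i).
move=> x /OM xM; apply: le_trans (ler_norm_sum _ _ _) _; apply: ler_sum => a _.
rewrite normrM ler_wpM2l// normr_prod; apply: ler_prod => i _.
rewrite normr_ge0 normrX /=; apply: lerXn2r; rewrite ?nnegrE ?(ltW M0)//.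
by rewrite ler_norml; have := xM i; rewrite !mxE.
Qed.

(** Finitely many simplices cover the domain, and polynomials are bounded on
    bounded sets. *)
Lemma piecewise_poly_bdd Th (f : E -> R) : closure Om = \bigcup_(K in [set` Th]) simplex K ->
  piecewise_poly Om Th f -> bdd Om f.
Proof.
move=> cOm Hf.
have H (K : {ffun 'I_d.+1 -> E}) : exists B : R, K \in Th -> forall x, simplex K x -> Om x -> `|f x| <= B.
  have [KT|KT] := boolP (K \in Th); last by exists 0.
  have [n [p [pn fp]]] := Hf K KT; have [B pB] := poly_fun_bounded pn.
  by exists B => _ x Kx Ox; rewrite fp//; exact: pB.
have [B HB] := choice H.
exists (\sum_(K <- Th) `|B K|) => x Ox.
have : closure Om x by exact: subset_closure.
rewrite cOm => -[K /= KT Kx]; apply: le_trans (HB K KT x Kx Ox) _.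
rewrite (big_rem K)//= ; apply: le_trans (ler_norm _) _.
by rewrite lerDl sumr_ge0.
Qed.

(** The properties of finite element velocities on which the estimates of the
    convection term rest. *)
Definition good v := forall i, H10 Om (cmp v i) /\ bdd Om (cmp v i).

Lemma good_lin (a : R) u v : good u -> good v -> good (a *: u + v).
Proof.
move=> gu gv i; rewrite comp_lin; have [Hu bu] := gu i; have [Hv bv] := gv i.
by split; [exact: H10_lin|exact: bdd_lin].
Qed.

Lemma fe_velocity_good Th m r (Xh : set (E -> E)) :
  closure Om = \bigcup_(K in [set` Th]) simplex K -> fe_velocity Om Th m r Xh ->
  (forall v, Xh v -> good v) /\
  (forall (a : R) u v, Xh u -> Xh v -> Xh (a *: u + v)).
Proof.
move=> cOm [n [e [He _ ->]]]; split=> [v [[c vc] /spaceXP Xv] i|a u v [su Xu] [sv Xv]].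
  split; first exact: Xv.
  rewrite vc comp_sum; elim/big_rec : _ => [|k f _ bf].
    by exists 0 => x _; rewrite normr0.
  have -> : cmp (c k *: e k) i = c k *: cmp (e k) i by apply/funext => x; rewrite /Defs.comp mxE.
  by apply: bdd_lin => //; apply: (piecewise_poly_bdd cOm); have [_] := He k i.
by split; [exact: span_of_lin|exact: spaceX_lin].
Qed.

Lemma fe_pressure_lin Th m r (Qh : set (E -> R)) : fe_pressure Om Th m r Qh ->
  forall (a : R) p q, Qh p -> Qh q -> Qh (a *: p + q).
Proof.
move=> [n [e [_ _ ->]]] a p q [sp Qp] [sq Qq].
by split; [exact: span_of_lin|exact: spaceQ_lin].
Qed.

Lemma good_L2 v i : good v -> L2 Om (cmp v i).
Proof. by move=> gv; have [[/in_H1_L2]] := gv i. Qed.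

Lemma good_D v i j : good v -> L2 Om (D j (cmp v i)).
Proof. by move=> gv; have [[]] := gv i => /(in_H1_D j). Qed.

Lemma le_sum_term (I : finType) (F : I -> R) i : (forall k, 0 <= F k) -> F i <= \sum_k F k.
Proof. by move=> F0; rewrite (bigD1 i)//= lerDl sumr_ge0. Qed.

Lemma vip_ge0 v : 0 <= vip Om v v.
Proof. by apply: sumr_ge0 => i _; exact: ip_ge0. Qed.

Lemma grad_ip_ge0 v : 0 <= grad_ip Om v v.
Proof. by apply: sumr_ge0 => i _; apply: sumr_ge0 => j _; exact: ip_ge0. Qed.

Lemma sqr_vl2norm v : vl2norm Om v ^+ 2 = vip Om v v.
Proof. by rewrite sqr_sqrtr// vip_ge0. Qed.

Lemma sqr_grad_norm v : grad_norm Om v ^+ 2 = grad_ip Om v v.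
Proof. by rewrite sqr_sqrtr// grad_ip_ge0. Qed.

Lemma vl2norm_ge0 v : 0 <= vl2norm Om v. Proof. exact: sqrtr_ge0. Qed.
Lemma grad_norm_ge0 v : 0 <= grad_norm Om v. Proof. exact: sqrtr_ge0. Qed.

Lemma l2norm_le_vl2norm v i : l2norm Om (cmp v i) <= vl2norm Om v.
Proof.
apply: ler_wsqrtr; apply: (@le_sum_term _ (fun i => ip Om (cmp v i) (cmp v i))) => k.
exact: ip_ge0.
Qed.

Lemma l2norm_le_grad_norm v i j : l2norm Om (D j (cmp v i)) <= grad_norm Om v.
Proof.
apply: ler_wsqrtr.
apply: le_trans (@le_sum_term _ (fun j => ip Om (D j (cmp v i)) (D j (cmp v i))) j _) _.
  by move=> k; exact: ip_ge0.
apply: (@le_sum_term _ (fun i => \sum_j ip Om (D j (cmp v i)) (D j (cmp v i)))) => k.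
by apply: sumr_ge0 => l _; exact: ip_ge0.
Qed.

Lemma l2norm_le_vHsemi v i j : l2norm Om (D j (cmp v i)) <= vHsemi Om 1 v.
Proof.
apply: le_trans (le_Hsemi1 _ _ _) _.
rewrite -(ger0_norm (Hsemi_ge0 Om 1 (cmp v i))) -sqrtr_sqr; apply: ler_wsqrtr.
by apply: (@le_sum_term _ (fun i => Hsemi Om 1 (cmp v i) ^+ 2)) => k; exact: sqr_ge0.
Qed.

Lemma grad_norm_eq0 v : vHsemi Om 1 v <= 0 -> grad_norm Om v = 0.
Proof.
move=> v0; apply/eqP; rewrite -sqrf_eq0 sqr_grad_norm /grad_ip.
apply/eqP; apply: big1 => i _; apply: big1 => j _.
apply/eqP; rewrite -sqr_l2norm sqrf_eq0 eq_le l2norm_ge0 andbT.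
exact: le_trans (l2norm_le_vHsemi v i j) v0.
Qed.

Local Opaque weak_deriv ip l2norm Hsemi Hnorm L2.

Lemma vipC u v : vip Om u v = vip Om v u.
Proof. by apply: eq_bigr => i _; rewrite ipC. Qed.

Lemma vip_linl (a : R) u v w : good u -> good v -> good w ->
  vip Om (a *: u + v) w = a * vip Om u w + vip Om v w.
Proof.
move=> gu gv gw; rewrite mulr_sumr -big_split; apply: eq_bigr => i _.
have Lu := good_L2 i gu; have Lv := good_L2 i gv; have Lw := good_L2 i gw.
by rewrite comp_lin (ipDl mOm (L2Z mOm a Lu) Lv Lw) (ipZl mOm a Lu Lw).
Qed.

Lemma vip_convecE u v w : good u -> good v -> good w ->
  vip Om (convec Om u v) w = \sum_i \sum_j ip Om (cmp u j * D j (cmp v i)) (cmp w i).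
Proof.
move=> gu gv gw; apply: eq_bigr => i _.
have -> : cmp (convec Om u v) i = \sum_j cmp u j * D j (cmp v i).
  apply/funext => x; rewrite /Defs.comp /convec mxE fct_sumE.
  by apply: eq_bigr => j _.
apply: (ip_suml mOm) => [j|]; last exact: good_L2.
by apply: (L2M_bddl oOm) => //; [exact: good_L2|exact: good_D|have [] := gu j].
Qed.

(** Linearity in the second argument involves weak derivatives, hence the
    fundamental lemma. *)
Lemma b_lin (a : R) w u v z : good w -> good u -> good v -> good z ->
  b Om w (a *: u + v) z = a * b Om w u z + b Om w v z.
Proof.
move=> gw gu gv gz; have guv := good_lin a gu gv.
have e1 : vip Om (convec Om w (a *: u + v)) z =
    a * vip Om (convec Om w u) z + vip Om (convec Om w v) z.
  rewrite !vip_convecE// mulr_sumr -big_split; apply: eq_bigr => i _ /=.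
  rewrite mulr_sumr -big_split; apply: eq_bigr => j _ /=.
  rewrite comp_lin !(mulrC (cmp w j)) !ip_mulA.
  have [[Hu _] _] := gu i; have [[Hv _] _] := gv i; have [_ bw] := gw j.
  apply: (ip_D_lin oOm bOm) => //.
  by apply: (L2M_bddl oOm) => //; exact: good_L2.
have e2 : vip Om (convec Om w z) (a *: u + v) =
    a * vip Om (convec Om w z) u + vip Om (convec Om w z) v.
  rewrite !vip_convecE// mulr_sumr -big_split; apply: eq_bigr => i _ /=.
  rewrite mulr_sumr -big_split; apply: eq_bigr => j _ /=.
  have Lu := good_L2 i gu; have Lv := good_L2 i gv.
  have Lk : L2 Om (cmp w j * D j (cmp z i)).
    by apply: (L2M_bddl oOm) => //; [exact: good_L2|exact: good_D|have [] := gw j].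
  by rewrite comp_lin (ipDr mOm (L2Z mOm a Lu) Lv Lk) (ipZr mOm a Lu Lk).
rewrite /b e1 e2.
move: (vip Om (convec Om w u) z) (vip Om (convec Om w v) z) (vip Om (convec Om w z) u)
  (vip Om (convec Om w z) v) => x1 x2 x3 x4; ring.
Qed.

Lemma b_diag w v : b Om w v v = 0. Proof. exact: subrr. Qed.

Lemma b_le : d = 2%N \/ d = 3%N -> exists2 C : R, 0 < C &
  forall w U v, good w -> good U -> good v -> forall a q c : R, 0 < a -> 0 < q -> 0 < c ->
    (forall i j, l2norm Om (D j (cmp w i)) <= a) ->
    (forall i j, l2norm Om (D j (cmp U i)) <= q) ->
    (forall i j, l2norm Om (D j (cmp v i)) <= c) ->
    `|b Om w U v| <= C * Num.sqrt (q * vl2norm Om U) * a * c.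
Proof.
move=> d23; have [C C0 HC] := trilinear_le oOm bOm d23.
exists (2 * (d%:R * d%:R * Num.sqrt C) + 1).
  by rewrite ltr_wpDl// !mulr_ge0// sqrtr_ge0.
move=> w U v gw gU gv a q c a0 q0 c0 wa Uq vc.
set T := Num.sqrt C * Num.sqrt (q * vl2norm Om U) * a * c.
have T0 : 0 <= T by rewrite !mulr_ge0 ?sqrtr_ge0// ltW.
have term i j : `|ip Om (cmp w j * D j (cmp U i)) (cmp v i)| <= 2 * T /\
    `|ip Om (cmp w j * D j (cmp v i)) (cmp U i)| <= T.
  have [Hw bw] := gw j; have [HU bU] := gU i; have [Hv bv] := gv i.
  have := HC _ _ _ j Hw bw HU bU Hv bv a q c a0 q0 c0 (wa j) (Uq i) (vc i).
  set S := Num.sqrt _ * a * c.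
  have ST : S <= T.
    rewrite /S /T -sqrtrM ?(ltW C0)// !ler_wpM2r ?(ltW a0) ?(ltW c0)//.
    apply: ler_wsqrtr; rewrite -mulrA ler_wpM2l ?(ltW C0)// ler_wpM2l ?(ltW q0)//.
    exact: l2norm_le_vl2norm.
  move=> [h1 h2]; split; last exact: le_trans ST.
  by apply: le_trans h1 _; rewrite ler_wpM2l.
have sumb (F : 'I_d -> 'I_d -> R) (B : R) : (forall i j, `|F i j| <= B) ->
    `|\sum_i \sum_j F i j| <= d%:R * d%:R * B.
  move=> FB; apply: le_trans (ler_norm_sum _ _ _) _.
  apply: le_trans (_ : \sum_(i < d) d%:R * B <= _).
    apply: ler_sum => i _; apply: le_trans (ler_norm_sum _ _ _) _.
    apply: le_trans (ler_sum _ (fun j _ => FB i j)) _.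
    by rewrite sumr_const card_ord mulr_natl.
  by rewrite sumr_const card_ord -[_ * B *+ d]mulr_natl mulrA.
have b1 := sumb _ _ (fun i j => (term i j).1).
have b2 := sumb _ _ (fun i j => (term i j).2).
rewrite -vip_convecE// in b1; rewrite -vip_convecE// in b2.
rewrite /b.
apply: (@le_trans _ _ (2 * (d%:R * d%:R * T))).
  move: b1 b2; move: (vip Om (convec Om w U) v) (vip Om (convec Om w v) U) => x y.
  have nT : 0 <= d%:R * d%:R * T by apply: mulr_ge0 => //; exact: mulr_ge0.
  have -> : d%:R * d%:R * (2 * T) = 2 * (d%:R * d%:R * T) by ring.
  move: (d%:R * d%:R * T) nT => z z0; rewrite !ler_norml => /andP[? ?] /andP[? ?].
  by apply/andP; split; lra.
have -> : (2 * (d%:R * d%:R * Num.sqrt C) + 1) * Num.sqrt (q * vl2norm Om U) * a * c =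
   2 * (d%:R * d%:R * T) + Num.sqrt (q * vl2norm Om U) * a * c by rewrite /T; ring.
by rewrite lerDl !mulr_ge0 ?sqrtr_ge0// ltW.
Qed.

(** The bounds on the norms of derivatives are required to be positive; those
    available are only nonnegative, and are approached from above. *)
Lemma ler_limit3 (x K p q r : R) : 0 <= K -> 0 <= p -> 0 <= q -> 0 <= r ->
  (forall e, 0 < e -> x <= K * (p + e) * (q + e) * (r + e)) -> x <= K * p * q * r.
Proof.
move=> K0 p0 q0 r0 H; apply/ler_addgt0Pl => e e0.
set m := K * (p * q + q * r + p * r + p + q + r + 1) + 1.
have m0 : 0 < m by rewrite ltr_wpDl// mulr_ge0// !addr_ge0// mulr_ge0.
pose t := Num.min 1 (e / m).
have t0 : 0 < t by rewrite lt_min ltr01 divr_gt0.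
have t1 : t <= 1 by rewrite ge_min lexx.
have tm : t * m <= e by rewrite -ler_pdivlMr// ge_min lexx orbT.
apply: le_trans (H _ t0) _.
apply: (@le_trans _ _ (t * m + K * p * q * r)); last by rewrite lerD2r.
have t0' := ltW t0.
have t2 : t ^+ 2 <= t by rewrite expr2 ler_piMr.
have t3 : t ^+ 3 <= t by rewrite exprS ler_piMr// exprn_ile1.
have -> : K * (p + t) * (q + t) * (r + t) =
  t * (K * (p * q + q * r + p * r)) + t ^+ 2 * (K * (p + q + r)) + t ^+ 3 * K + K * p * q * r by ring.
rewrite lerD2r.
have -> : t * m = t * (K * (p * q + q * r + p * r)) + t * (K * (p + q + r)) + t * K + t.
  by rewrite /m; ring.
have k1 : 0 <= K * (p + q + r) by rewrite mulr_ge0// !addr_ge0.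
have := ler_wpM2r k1 t2; have := ler_wpM2r K0 t3; move: (ltW t0).
by move=> *; lra.
Qed.

(** The trilinear bound on a finite element space, where the inverse
    inequality trades the gradient of [U] for a negative power of the mesh
    diameter. *)
Lemma b_le_fe (Cinv : R) : d = 2%N \/ d = 3%N -> exists2 C : R, 0 < C &
  forall h, 0 < h -> forall w U v, good w -> good U -> good v ->
    vHsemi Om 1 U <= Cinv * h^-1 * vl2norm Om U ->
    `|b Om w U v| <= C / Num.sqrt h * vl2norm Om U * grad_norm Om w * grad_norm Om v.
Proof.
move=> d23; have [C C0 HC] := b_le d23.
pose c := `|Cinv| + 1; have c0 : 0 < c by rewrite ltr_wpDl.
exists (C * Num.sqrt c) => [|h h0 w U v gw gU gv inv]; first by rewrite mulr_gt0// sqrtr_gt0.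
have sh : 0 < Num.sqrt h by rewrite sqrtr_gt0.
apply: ler_limit3; rewrite ?vl2norm_ge0 ?grad_norm_ge0//.
  by rewrite divr_ge0 ?mulr_ge0 ?sqrtr_ge0// ltW.
move=> e e0.
have pos (x : R) : 0 <= x -> 0 < x + e by move=> x0; rewrite ltr_wpDl.
pose q := c / h * (vl2norm Om U + e).
have q0 : 0 < q by rewrite mulr_gt0 ?divr_gt0// pos// vl2norm_ge0.
have Uq i j : l2norm Om (D j (cmp U i)) <= q.
  apply: le_trans (l2norm_le_vHsemi U i j) _; apply: le_trans inv _.
  have cc : Cinv * h^-1 <= c / h.
    by rewrite ler_wpM2r ?invr_ge0 ?(ltW h0)// /c; have := ler_norm Cinv; lra.
  apply: (@le_trans _ _ (c / h * vl2norm Om U)); first by rewrite ler_wpM2r ?vl2norm_ge0.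
  by rewrite /q ler_wpM2l ?lerDl ?(ltW e0)// divr_ge0 ?ltW.
have a0 := pos _ (grad_norm_ge0 w); have v0 := pos _ (grad_norm_ge0 v).
have wa i j : l2norm Om (D j (cmp w i)) <= grad_norm Om w + e.
  by apply: le_trans (l2norm_le_grad_norm w i j) _; rewrite lerDl ltW.
have vc i j : l2norm Om (D j (cmp v i)) <= grad_norm Om v + e.
  by apply: le_trans (l2norm_le_grad_norm v i j) _; rewrite lerDl ltW.
apply: le_trans (HC _ _ _ gw gU gv _ _ _ a0 q0 v0 wa Uq vc) _.
rewrite ler_wpM2r ?(ltW v0)// ler_wpM2r ?(ltW a0)//.
have -> : C * Num.sqrt c / Num.sqrt h * (vl2norm Om U + e) =
    C * (Num.sqrt c / Num.sqrt h * (vl2norm Om U + e)) by ring.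
rewrite ler_wpM2l ?(ltW C0)//.
have U0 := pos _ (vl2norm_ge0 U).
have s2 : 0 <= Num.sqrt c / Num.sqrt h * (vl2norm Om U + e).
  by apply: mulr_ge0; [rewrite divr_ge0 ?sqrtr_ge0|exact: ltW].
rewrite -ler_sqr ?nnegrE ?sqrtr_ge0//.
rewrite sqr_sqrtr; last by rewrite mulr_ge0 ?vl2norm_ge0 ?(ltW q0).
rewrite !exprMn exprVn !sqr_sqrtr ?(ltW c0) ?(ltW h0)// /q.
rewrite expr2 -!mulrA ler_wpM2l ?(ltW c0)// ler_wpM2l ?invr_ge0 ?(ltW h0)//.
by rewrite ler_wpM2l ?(ltW U0)// lerDl ltW.
Qed.

End vector_fields.

(** * Algebra of the time stepping scheme *)

Section dln_algebra.
Context (R : realType).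
Implicit Types (theta e : R).

Lemma one_plus_gt0 theta e : 0 < theta < 1 -> -1 < e < 1 -> 0 < 1 + e * theta.
Proof. by move=> /andP[? ?] /andP[? ?]; nra. Qed.

(** The bound does not involve [e], that is, the ratio of the time steps. *)
Lemma beta2_bound theta e : 0 < theta < 1 -> -1 < e < 1 ->
  0 <= beta theta e 2 <= (1 + theta) / (2 * (1 - theta)).
Proof.
move=> t01 e01; have d0 := one_plus_gt0 t01 e01.
move: t01 e01 => /andP[t0 t1] /andP[e0 e1]; rewrite /beta.
set A := (1 - theta ^+ 2) / (1 + e * theta) ^+ 2.
have u0 : 0 < 1 - theta by lra.
have s0 : 0 < 1 - theta ^+ 2 by nra.
have A0 : 0 <= A by rewrite divr_ge0 ?(ltW s0)// sqr_ge0.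
have AM : A <= (1 + theta) / (1 - theta).
  rewrite /A ler_pdivrMr ?exprn_gt0// mulrAC ler_pdivlMr//.
  have -> : (1 - theta ^+ 2) * (1 - theta) = (1 + theta) * (1 - theta) ^+ 2 by ring.
  by rewrite ler_pM2l ?addr_gt0// ler_sqr ?nnegrE ?(ltW d0) ?(ltW u0)//; nra.
have -> : e ^+ 2 * (theta * (1 - theta ^+ 2) / (1 + e * theta) ^+ 2) = e ^+ 2 * theta * A.
  by rewrite /A !mulrA.
have eA : 0 <= e ^+ 2 * theta * A <= theta * A.
  have e2 : e ^+ 2 <= 1 by nra.
  have tA : 0 <= theta * A by rewrite mulr_ge0// ltW.
  by rewrite -mulrA mulr_ge0 ?sqr_ge0//= ler_piMl.
move: eA => /andP[eA0 eA1].
have -> : (1 + theta) / (2 * (1 - theta)) = 4^-1 * (1 + theta + (1 + theta) * ((1 + theta) / (1 - theta))).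
  by field; rewrite gt_eqF.
have := ler_wpM2l (ltW (addr_gt0 ltr01 t0)) AM.
by move=> ?; apply/andP; split; lra.
Qed.

(** The [x_ij] are the entries of the Gram matrix of three consecutive
    iterates. The identity is what makes the method stable: the product of
    the two averages is the increment of an energy plus a multiple of the
    square of the second difference. *)
Lemma g_stability theta e (x00 x01 x02 x11 x12 x22 : R) : 1 + e * theta != 0 ->
  let al := alpha theta in let be := beta theta e in
  al 0%N * (be 0%N * x00 + be 1%N * x01 + be 2%N * x02)
  + al 1%N * (be 0%N * x01 + be 1%N * x11 + be 2%N * x12)
  + al 2%N * (be 0%N * x02 + be 1%N * x12 + be 2%N * x22) =
  ((1 + theta) / 4 * x22 + (1 - theta) / 4 * x11) - ((1 + theta) / 4 * x11 + (1 - theta) / 4 * x00)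
  + theta * (1 - theta ^+ 2) / (2 * (1 + e * theta) ^+ 2) *
    ((1 - e) ^+ 2 / 4 * x22 + x11 + (1 + e) ^+ 2 / 4 * x00
      - (1 - e) * x12 + (1 - e) * (1 + e) / 2 * x02 - (1 + e) * x01).
Proof. by move=> d0; rewrite /alpha /beta; field. Qed.

(** In units of half the length of the two time steps, the point
    [t_beta] measured from the middle node stays between the outer nodes. *)
Lemma beta_interval theta e : 0 < theta < 1 -> -1 < e < 1 ->
  - (1 - e) < (1 + e) * beta theta e 2 - (1 - e) * beta theta e 0 < 1 + e.
Proof.
move=> t01 e01; have d0 := one_plus_gt0 t01 e01.
have -> : (1 + e) * beta theta e 2 - (1 - e) * beta theta e 0 =
    ((theta + e) * (1 + e * theta) + e * (1 - theta ^+ 2)) / (2 * (1 + e * theta)).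
  by rewrite /beta; field; rewrite gt_eqF.
have d1 : 0 < 2 * (1 + e * theta) by rewrite mulr_gt0.
move: t01 e01 => /andP[t0 t1] /andP[e0 e1].
rewrite ltr_pdivlMr// ltr_pdivrMr//; apply/andP; split; rewrite -subr_gt0.
  have -> : (theta + e) * (1 + e * theta) + e * (1 - theta ^+ 2) - - (1 - e) * (2 * (1 + e * theta)) =
    2 * (1 - theta) + theta * (1 + e) * (3 - e) by ring.
  by rewrite ltr_wpDr ?mulr_gt0// ?subr_gt0// !mulr_ge0//; lra.
have -> : (1 + e) * (2 * (1 + e * theta)) - ((theta + e) * (1 + e * theta) + e * (1 - theta ^+ 2)) =
    2 * (1 - theta) + theta * (1 + e) ^+ 2 by ring.
by rewrite ltr_wpDr ?mulr_gt0// ?subr_gt0// mulr_ge0 ?sqr_ge0// ltW.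
Qed.

Section averages.
Context (V : lmodType R) (theta : R) (t : nat -> R) (z : nat -> V).

Lemma comb3 (a0 a1 a2 p q : R) (x y w : V) :
  a0 *: x + a1 *: y + a2 *: w + (p *: y + q *: x) =
  (a0 + q) *: x + (a1 + p) *: y + a2 *: w.
Proof. by rewrite !scalerDl (AC (3*2)%AC ((1*5)*(2*4)*3)%AC). Qed.

Lemma avg_alphaE m : avg_alpha theta z m.+1 =
  alpha theta 0 *: z m + alpha theta 1 *: z m.+1 + alpha theta 2 *: z m.+2.
Proof. by rewrite /avg_alpha !big_ord_recl big_ord0 /= addr0 addn0 addn1 addn2 addrA. Qed.

Lemma avg_betaE m : avg_beta theta t z m.+1 = beta theta (eps t m.+1) 0 *: z m +
  beta theta (eps t m.+1) 1 *: z m.+1 + beta theta (eps t m.+1) 2 *: z m.+2.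
Proof. by rewrite /avg_beta !big_ord_recl big_ord0 /= addr0 addn0 addn1 addn2 addrA. Qed.

Lemma diff2E m : diff2 t z m.+1 = ((1 + eps t m.+1) / 2) *: z m +
  (-1) *: z m.+1 + ((1 - eps t m.+1) / 2) *: z m.+2.
Proof. by rewrite /diff2 /= scaleN1r (AC (2*1)%AC (3*2*1)%AC). Qed.

(** The extrapolation [avg_star] differs from the average [avg_beta] by a
    multiple of the second difference that the scheme dissipates. *)
Lemma avg_beta_star m : 0 < step t m -> 0 < step t m.+1 ->
  avg_beta theta t z m.+1 =
  (2 * beta theta (eps t m.+1) 2 / (1 - eps t m.+1)) *: diff2 t z m.+1 + avg_star theta t z m.+1.
Proof.
move=> a b; rewrite avg_betaE diff2E /avg_star; cbv zeta; rewrite -[m.+1.-1]/m.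
set e := eps t m.+1.
have e1 : 1 - e = 2 * step t m / (step t m.+1 + step t m).
  by rewrite /e /eps /=; field; rewrite gt_eqF// addr_gt0.
have rho : step t m.+1 / step t m = (1 + e) / (1 - e).
  rewrite e1 /e /eps /=; field.
  by apply/andP; split; rewrite gt_eqF// addr_gt0.
have en0 : 1 - e != 0 by rewrite e1 gt_eqF// divr_gt0// ?mulr_gt0// addr_gt0.
rewrite rho !scalerDr !scalerA comb3.
move: (beta theta e 0) (beta theta e 1) (beta theta e 2) en0 {e1 rho} => b0 b1 b2.
move: e => e en0; congr (_ *: _ + _ *: _ + _ *: _); by field.
Qed.

End averages.

Section grid.
Context (T : R) (N : nat) (t : nat -> R).
Hypothesis tg : time_grid T N t.

Lemma grid_le i j : (i <= j <= N)%N -> t i <= t j.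
Proof.
have [_ _ inc] := tg.
move=> /andP[ij jN]; elim: j ij jN => [|j IH]; first by rewrite leqn0 => /eqP ->.
rewrite leq_eqVlt => /orP[/eqP -> //|ij] jN.
by apply: le_trans (IH ij (ltnW jN)) (ltW (inc _ jN)).
Qed.

Lemma step_gt0 n : (n < N)%N -> 0 < step t n.
Proof. by have [_ _ inc] := tg => /inc; rewrite /step subr_gt0. Qed.

Lemma eps_bound m : (m.+1 < N)%N -> -1 < eps t m.+1 < 1.
Proof.
move=> mN; rewrite /eps /=.
have a := step_gt0 mN; have b := step_gt0 (ltnW mN).
have S0 : 0 < step t m.+1 + step t m by rewrite addr_gt0.
by apply/andP; split; [rewrite ltr_pdivlMr//|rewrite ltr_pdivrMr//]; lra.
Qed.

Lemma t_betaE theta m : t_beta theta t m.+1 =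
  t m.+1 + beta theta (eps t m.+1) 2 * step t m.+1 - beta theta (eps t m.+1) 0 * step t m.
Proof.
rewrite /t_beta (@avg_betaE R^o) /step.
have bE e : beta theta e 1 = 1 - beta theta e 2 - beta theta e 0.
  rewrite /beta; move: (_ / _ ^+ 2) (_ ^+ 2 * (_ / _)) => A B; lra.
rewrite bE; move: (eps t m.+1) => e.
rewrite -[LHS]/(beta theta e 0 * t m + (1 - beta theta e 2 - beta theta e 0) * t m.+1 +
  beta theta e 2 * t m.+2).
move: (beta theta e 0) (beta theta e 2) (t m) (t m.+1) (t m.+2) => b0 b2 t0 t1 t2.
ring.
Qed.

Lemma t_beta_itv theta m : 0 < theta < 1 -> (m.+1 < N)%N -> 0 < t_beta theta t m.+1 < T.
Proof.
move=> t01 mN; have [t0 tN inc] := tg.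
have /andP[h1 h2] := beta_interval t01 (eps_bound mN).
have a := step_gt0 mN; have b := step_gt0 (ltnW mN).
pose S := step t m.+1 + step t m; have S0 : 0 < S by rewrite addr_gt0.
have Sn0 : S != 0 by rewrite gt_eqF.
have ea : step t m.+1 = S / 2 * (1 + eps t m.+1) by rewrite /S /eps /=; field.
have eb : step t m = S / 2 * (1 - eps t m.+1) by rewrite /S /eps /=; field.
have S2 : 0 < S / 2 by rewrite divr_gt0.
rewrite t_betaE.
have lo : 0 <= t m by rewrite -t0; apply: grid_le; rewrite leq0n ltnW// ltnW.
have hi : t m.+2 <= T by rewrite -tN; apply: grid_le; rewrite mN leqnn.
have := ltr_pM2l S2 _ _ => lt2.
move: h1 h2; rewrite -(lt2 (- (1 - eps t m.+1))) -(lt2 _ (1 + eps t m.+1)).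
rewrite mulrN -eb -ea => h1 h2.
have e2 : S / 2 * ((1 + eps t m.+1) * beta theta (eps t m.+1) 2 -
     (1 - eps t m.+1) * beta theta (eps t m.+1) 0) =
   beta theta (eps t m.+1) 2 * step t m.+1 - beta theta (eps t m.+1) 0 * step t m.
  by rewrite [in RHS]ea [in RHS]eb; ring.
rewrite e2 in h1 h2.
move: h1 h2 lo hi; rewrite /step => h1 h2 lo hi.
by apply/andP; split; lra.
Qed.

Lemma khat_bound theta m : 0 < theta < 1 -> (m.+1 < N)%N ->
  0 < khat theta t m.+1 <= step t m.+1 + step t m.
Proof.
move=> /andP[t0 t1] mN; rewrite /khat /alpha /=.
have a := step_gt0 mN; have b := step_gt0 (ltnW mN).
by apply/andP; split; nra.
Qed.

End grid.

End dln_algebra.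

(** * Energy balance of one time step *)

Section energy_estimate.
Context (R : realType).

(** The nonlinear term is absorbed half by the numerical dissipation, where the
    condition on the time step is spent, and half by the viscosity. *)
Lemma energy_absorb (theta e be2 B C k h nu E1 E0 A W U G F bU : R) :
  0 < theta < 1 -> -1 < e < 1 -> 0 <= be2 <= B -> 0 < B -> 0 < C -> 0 < k -> 0 < h -> 0 < nu ->
  0 <= U -> 0 <= W -> 0 <= G ->
  A = E1 - E0 + theta * (1 - theta ^+ 2) / (2 * (1 + e * theta) ^+ 2) * U ^+ 2 ->
  k^-1 * A + nu * G ^+ 2 = F + 2 * be2 / (1 - e) * bU ->
  `|bU| <= C / Num.sqrt h * U * W * G ->
  0 <= 1 - 8 * B ^+ 2 * C ^+ 2 / (theta * (1 - theta ^+ 2)) * ((1 + e * theta) / (1 - e)) ^+ 2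
       * (k / (h * nu)) * W ^+ 2 ->
  E1 + (theta * (1 - theta ^+ 2) / (4 * (1 + e * theta) ^+ 2) * U ^+ 2 + nu * k / 4 * G ^+ 2)
    <= (k * F - nu * k / 4 * G ^+ 2) + E0.
Proof.
move=> t01 e01 /andP[b0 bB] B0 C0 k0 h0 nu0 U0 W0 G0 AE scheme bUle cfl.
have d0 := one_plus_gt0 t01 e01.
move: t01 e01 => /andP[t0 t1] /andP[e0 e1].
have f0 : 0 < 1 - e by lra.
have s0 : 0 < theta * (1 - theta ^+ 2) by rewrite mulr_gt0//; nra.
set d := 1 + e * theta in AE cfl d0 *.
set s := theta * (1 - theta ^+ 2) in AE cfl s0 *.
have sh : 0 < Num.sqrt h by rewrite sqrtr_gt0.
have shh : Num.sqrt h ^+ 2 = h by rewrite sqr_sqrtr// ltW.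
have kA : A + nu * k * G ^+ 2 = k * F + k * (2 * be2 / (1 - e)) * bU.
  have -> : k * F + k * (2 * be2 / (1 - e)) * bU = k * (F + 2 * be2 / (1 - e) * bU).
    by ring.
  by rewrite -scheme; field; rewrite gt_eqF.
pose X := 2 * be2 / (1 - e) * (C / Num.sqrt h) * W * U.
have ka0 : 0 <= k * (2 * be2 / (1 - e)).
  by rewrite mulr_ge0 ?(ltW k0)// divr_ge0 ?(ltW f0)// mulr_ge0.
have kbU : k * (2 * be2 / (1 - e)) * bU <= k * (X * G).
  have -> : k * (X * G) = k * (2 * be2 / (1 - e)) * (C / Num.sqrt h * U * W * G).
    by rewrite /X; ring.
  by rewrite ler_wpM2l//; apply: le_trans (ler_norm _) bUle.
(* X is the factor of G in the bound of the nonlinear term *)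
have young : k * (X * G) <= nu * k / 2 * G ^+ 2 + k / (2 * nu) * X ^+ 2.
  rewrite -subr_ge0.
  have -> : nu * k / 2 * G ^+ 2 + k / (2 * nu) * X ^+ 2 - k * (X * G) =
     k / (2 * nu) * (X - nu * G) ^+ 2 by field; rewrite gt_eqF.
  by rewrite mulr_ge0 ?sqr_ge0// divr_ge0 ?mulr_ge0 ?(ltW k0) ?(ltW nu0).
(* the quantity controlled by the condition on the time step *)
pose Q := (d / (1 - e)) ^+ 2 * (k / (h * nu)) * W ^+ 2.
have Q0 : 0 <= Q.
  rewrite /Q mulr_ge0 ?sqr_ge0// mulr_ge0 ?sqr_ge0// divr_ge0 ?(ltW k0)//.
  by rewrite mulr_ge0 ?(ltW h0) ?(ltW nu0).
have BCQ : 8 * B ^+ 2 * C ^+ 2 * Q <= s.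
  have : 8 * B ^+ 2 * C ^+ 2 / s * Q <= 1.
    by move: cfl; rewrite subr_ge0 /Q !mulrA.
  by rewrite mulrAC ler_pdivrMr// mul1r.
have bBQ : 8 * be2 ^+ 2 * C ^+ 2 * Q <= s.
  apply: le_trans BCQ; rewrite ler_wpM2r// ler_wpM2r ?sqr_ge0// ler_wpM2l//.
  by rewrite ler_sqr ?nnegrE// (le_trans b0).
have XE : k / (2 * nu) * X ^+ 2 = (8 * be2 ^+ 2 * C ^+ 2 * Q) / (4 * d ^+ 2) * U ^+ 2.
  have -> : X ^+ 2 = (2 * be2 / (1 - e)) ^+ 2 * (C ^+ 2 / h) * W ^+ 2 * U ^+ 2.
    by rewrite /X -[in RHS]shh; field; rewrite !gt_eqF.
  by rewrite /Q; field; rewrite !gt_eqF.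
have d4 : 0 < 4 * d ^+ 2 by rewrite mulr_gt0// exprn_gt0.
have Xle : k / (2 * nu) * X ^+ 2 <= s / (4 * d ^+ 2) * U ^+ 2.
  by rewrite XE ler_wpM2r ?sqr_ge0// ler_wpM2r// invr_ge0 ltW.
have half : s / (2 * d ^+ 2) * U ^+ 2 = s / (4 * d ^+ 2) * U ^+ 2 + s / (4 * d ^+ 2) * U ^+ 2.
  by field; rewrite gt_eqF.
move: kA kbU young Xle; rewrite AE half.
move: (s / (4 * d ^+ 2) * U ^+ 2) (k / (2 * nu) * X ^+ 2) (k * (X * G)) (k * (2 * be2 / (1 - e)) * bU)
  => x1 x2 x3 x4.
have -> : nu * k / 4 * G ^+ 2 = (nu * k * G ^+ 2) / 4 by ring.
have -> : nu * k / 2 * G ^+ 2 = (nu * k * G ^+ 2) / 2 by ring.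
move: (nu * k * G ^+ 2) (k * F) => x5 x6.
by lra.
Qed.

Lemma sqre_ge0 (x : \bar R) : (0 <= x ^+ 2)%E.
Proof. by rewrite expe2; case: x => [r| |] //; rewrite -EFinM lee_fin -expr2 sqr_ge0. Qed.

Lemma telescope_ereal (E a : nat -> R) (g : nat -> \bar R) N :
  (forall n, (1 <= n < N)%N -> ((E n.+1 + a n)%:E <= g n + (E n)%:E)%E) ->
  forall M, (1 <= M <= N)%N ->
    ((E M + \sum_(1 <= n < M) a n)%:E <= \sum_(1 <= n < M) g n + (E 1%N)%:E)%E.
Proof.
move=> H; elim=> [//|[_ _|M IH /andP[_ MN]]].
  by rewrite !big_geq// addr0 add0e.
rewrite (big_nat_recr M.+1)//= [X in (_ <= X + _)%E](big_nat_recr M.+1)//=.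
set s := \sum_(1 <= n < M.+1) a n; set sg := (\sum_(1 <= n < M.+1) g n)%E.
have -> : E M.+2 + (s + a M.+1) = (E M.+2 + a M.+1) + s by ring.
have h := IH (ltnW MN).
rewrite -/s -/sg in h.
rewrite EFinD; apply: le_trans (leeD (H M.+1 MN) (lexx s%:E)) _.
by rewrite -addeA -EFinD (addeC sg) -addeA leeD2l.
Qed.

End energy_estimate.

Section subspace.
Context (R : realType) (V : lmodType R) (Xh : set V).
Hypothesis (Xlin : forall (a : R) u v, Xh u -> Xh v -> Xh (a *: u + v)).
Implicit Types (x y z : V).

Lemma Xh_0 x : Xh x -> Xh 0.
Proof. by move=> Xx; rewrite -(addNr x) -scaleN1r; exact: Xlin. Qed.

Lemma Xh_Z (a : R) x : Xh x -> Xh (a *: x).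
Proof. by move=> Xx; rewrite -[_ *: _]addr0; apply: Xlin => //; exact: Xh_0 Xx. Qed.

Lemma Xh_D x y : Xh x -> Xh y -> Xh (x + y).
Proof. by move=> Xx Xy; rewrite -[x]scale1r; exact: Xlin. Qed.

Lemma Xh_comb3 (a b c : R) x y z : Xh x -> Xh y -> Xh z -> Xh (a *: x + b *: y + c *: z).
Proof. by move=> *; apply: Xh_D; [apply: Xh_D|]; exact: Xh_Z. Qed.

Lemma Xh_avg_beta theta t (u : nat -> V) m : Xh (u m) -> Xh (u m.+1) -> Xh (u m.+2) ->
  Xh (avg_beta theta t u m.+1).
Proof. by move=> *; rewrite avg_betaE; exact: Xh_comb3. Qed.

Lemma Xh_diff2 t (u : nat -> V) m : Xh (u m) -> Xh (u m.+1) -> Xh (u m.+2) ->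
  Xh (diff2 t u m.+1).
Proof. by move=> *; rewrite diff2E; exact: Xh_comb3. Qed.

Lemma Xh_avg_star theta t (u : nat -> V) m : Xh (u m) -> Xh (u m.+1) ->
  Xh (avg_star theta t u m.+1).
Proof. by move=> *; rewrite /avg_star; apply: Xh_D; exact: Xh_Z. Qed.

End subspace.

Section scheme.
Context (R : realType) (d : nat) (Om : set 'rV[R]_d).
Hypotheses (oOm : open Om) (bOm : bounded_set Om).
Local Notation E := 'rV[R]_d.
Implicit Types (x y z w : E -> E).

Let mOm : measurable Om. Proof. exact: open_measurable_rV. Qed.

Local Opaque weak_deriv ip l2norm Hsemi Hnorm L2.

Lemma vipZl (a : R) x w : good Om x -> good Om w -> vip Om (a *: x) w = a * vip Om x w.
Proof.
move=> gx gw; rewrite mulr_sumr; apply: eq_bigr => i _.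
have -> : Defs.comp (a *: x) i = a *: Defs.comp x i by apply/funext => y; rewrite /Defs.comp mxE.
by rewrite (ipZl mOm a (good_L2 i gx) (good_L2 i gw)).
Qed.

Lemma vip_comb3l (a b c : R) x y z w : good Om x -> good Om y -> good Om z -> good Om w ->
  good Om (b *: y + c *: z) -> good Om (c *: z) ->
  vip Om (a *: x + b *: y + c *: z) w = a * vip Om x w + b * vip Om y w + c * vip Om z w.
Proof.
move=> gx gy gz gw g1 g2.
by rewrite -addrA (vip_linl oOm)// (vip_linl oOm)// vipZl// addrA.
Qed.

Section velocity_space.
Variable Xh : set (E -> E).
Hypotheses (Xg : forall v, Xh v -> good Om v)
  (Xlin : forall (a : R) u v, Xh u -> Xh v -> Xh (a *: u + v)).

Lemma Xh_mean_star J theta t (u : 'I_J -> nat -> E -> E) m : (0 < J)%N ->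
  (forall j, Xh (u j m)) -> (forall j, Xh (u j m.+1)) -> Xh (mean_star theta t u m.+1).
Proof.
case: J u => // J u _ X0 X1; apply: (Xh_Z Xlin).
apply: big_ind; [exact: (Xh_0 Xlin (X0 ord0))|exact: (Xh_D Xlin)|].
by move=> j _; exact: (Xh_avg_star Xlin).
Qed.

Lemma vip_comb3 (a b c : R) x y z w : Xh x -> Xh y -> Xh z -> Xh w ->
  vip Om (a *: x + b *: y + c *: z) w = a * vip Om x w + b * vip Om y w + c * vip Om z w.
Proof.
move=> Xx Xy Xz Xw; apply: vip_comb3l; apply: Xg => //; last exact: (Xh_Z Xlin).
by apply: (Xh_D Xlin); exact: (Xh_Z Xlin).
Qed.

(** Both sides are quadratic forms in three consecutive iterates, which
    reduces the claim to [g_stability]. *)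
Lemma vip_alpha_beta theta t (u : nat -> E -> E) m :
  1 + eps t m.+1 * theta != 0 -> Xh (u m) -> Xh (u m.+1) -> Xh (u m.+2) ->
  vip Om (avg_alpha theta u m.+1) (avg_beta theta t u m.+1) =
  ((1 + theta) / 4 * vl2norm Om (u m.+2) ^+ 2 + (1 - theta) / 4 * vl2norm Om (u m.+1) ^+ 2)
  - ((1 + theta) / 4 * vl2norm Om (u m.+1) ^+ 2 + (1 - theta) / 4 * vl2norm Om (u m) ^+ 2)
  + theta * (1 - theta ^+ 2) / (2 * (1 + eps t m.+1 * theta) ^+ 2)
    * vl2norm Om (diff2 t u m.+1) ^+ 2.
Proof.
move=> d0 X0 X1 X2.
rewrite !sqr_vl2norm avg_alphaE avg_betaE diff2E.
move: (eps t m.+1) d0 (u m) (u m.+1) (u m.+2) X0 X1 X2 => e d0 x y z Xx Xy Xz.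
have gram (a b c a' b' c' : R) :
    vip Om (a *: x + b *: y + c *: z) (a' *: x + b' *: y + c' *: z) =
    a * (a' * vip Om x x + b' * vip Om x y + c' * vip Om x z)
    + b * (a' * vip Om x y + b' * vip Om y y + c' * vip Om y z)
    + c * (a' * vip Om x z + b' * vip Om y z + c' * vip Om z z).
  have Xw : Xh (a' *: x + b' *: y + c' *: z) by exact: (Xh_comb3 Xlin).
  rewrite vip_comb3// (vipC Om x) (vipC Om y) (vipC Om z).
  by rewrite !vip_comb3// (vipC Om y x) (vipC Om z x) (vipC Om z y).
rewrite !gram (g_stability (vip Om x x) (vip Om x y) (vip Om x z) (vip Om y y)
  (vip Om y z) (vip Om z z) d0).
congr (_ + _ * _).
move: (vip Om x x) (vip Om x y) (vip Om x z) (vip Om y y) (vip Om y z) (vip Om z z)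
  => x0 x1 x2 x3 x4 x5.
by field.
Qed.

End velocity_space.

(** The source term: the supremum in the dual norm is tested with [v], and a
    field with zero gradient is not seen by a bounded functional. *)
Lemma source_le (g : (E -> E) -> R) v (k nu S : R) : spaceX Om v ->
  0 < k <= S -> 0 < nu -> in_dual Om g -> (grad_norm Om v != 0 -> vl2norm Om v != 0) ->
  ((k * g v)%:E <= nu^-1%:E * (S%:E * dual_norm Om g ^+ 2) +
     (nu * k / 4 * grad_norm Om v ^+ 2)%:E)%E.
Proof.
move=> Xv /andP[k0 kS] nu0 [_ [C gC]] vn.
set G := grad_norm Om v; have G0 : 0 <= G by exact: grad_norm_ge0.
have S0 : 0 < S by rewrite (lt_le_trans k0).
have n0 : 0 < nu^-1 by rewrite invr_gt0.
have k0' := ltW k0; have nu0' := ltW nu0; have n0' := ltW n0; have S0' := ltW S0.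
have q0 : 0 <= nu * k / 4 * G ^+ 2.
  by apply: mulr_ge0; [apply: divr_ge0 => //; exact: mulr_ge0|exact: sqr_ge0].
have rhs0 : (0 <= nu^-1%:E * (S%:E * dual_norm Om g ^+ 2))%E.
  by rewrite mule_ge0 ?lee_fin// mule_ge0 ?lee_fin// sqre_ge0.
have [G00|Gn0] := eqVneq G 0.
  have := gC v Xv; rewrite -/G G00 mulr0 normr_le0 => /eqP ->.
  by rewrite mulr0; apply: adde_ge0 => //; rewrite lee_fin expr0n mulr0.
have Gp : 0 < G by rewrite lt_def Gn0.
have : ((g v / G)%:E <= dual_norm Om g)%E.
  by apply: ereal_sup_ubound; exists v => //; split=> //=; exact: vn.
move: rhs0; case: (dual_norm Om g) => [y _|_ _|//].
  rewrite lee_fin -EFin_expe -!EFinM -EFinD lee_fin ler_pdivrMr// => gy.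
  apply: (@le_trans _ _ (k * (y * G))); first by rewrite ler_wpM2l// ltW.
  apply: (@le_trans _ _ (nu^-1 * (k * y ^+ 2) + nu * k / 4 * G ^+ 2)).
    rewrite -subr_ge0.
    have -> : nu^-1 * (k * y ^+ 2) + nu * k / 4 * G ^+ 2 - k * (y * G) =
      nu^-1 * k * (y - nu * G / 2) ^+ 2 by field; rewrite gt_eqF.
    by rewrite mulr_ge0 ?sqr_ge0// mulr_ge0 ?ltW.
  by rewrite lerD2r ler_wpM2l ?(ltW n0)// ler_wpM2r ?sqr_ge0.
by rewrite expe2 mulyy gt0_muley ?lte_fin// gt0_muley ?lte_fin// addye// leey.
Qed.

End scheme.

(** * Stability *)

Theorem theorem4p4 (R : realType) :
  exists2 C : R, 0 < C &
  forall (d : nat) (Om : set 'rV[R]_d) (theta : R) (F : fe_consts R),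
  d = 2%N \/ d = 3%N -> is_domain Om -> 0 < theta < 1 ->
  exists2 C1 : R, 0 < C1 &
  forall (h : R) (Xh : set ('rV[R]_d -> 'rV[R]_d)) (Qh : set ('rV[R]_d -> R))
    (nu T : R) (N : nat) (t : nat -> R) (J : nat)
    (f : 'I_J -> R -> ('rV[R]_d -> 'rV[R]_d) -> R)
    (u : 'I_J -> nat -> ('rV[R]_d -> 'rV[R]_d))
    (p : 'I_J -> nat -> ('rV[R]_d -> R)),
  0 < h <= 1 -> fe_pair Om F h Xh Qh ->
  0 < nu -> time_grid T N t -> (1 < J)%N ->
  (forall j, in_l2beta Om theta T N t (f j)) ->
  dln_ensemble Om nu theta N t Xh Qh f u p ->
  (forall j n, (1 <= n < N)%N ->
     0 <= 1 - C1 * ((1 + eps t n * theta) / (1 - eps t n)) ^+ 2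
              * (khat theta t n / (h * nu))
              * grad_norm Om (avg_star theta t (u j) n - mean_star theta t u n)
                ^+ 2) ->
  forall j M, (2 <= M <= N)%N ->
  (((1 + theta) / 4 * vl2norm Om (u j M) ^+ 2
    + (1 - theta) / 4 * vl2norm Om (u j M.-1) ^+ 2
    + \sum_(1 <= n < M) theta * (1 - theta ^+ 2)
          / (4 * (1 + eps t n * theta) ^+ 2)
        * vl2norm Om (diff2 t (u j) n) ^+ 2
    + \sum_(1 <= n < M) nu * khat theta t n / 4
        * grad_norm Om (avg_beta theta t (u j) n) ^+ 2)%R%:E
   <= (C / nu)%:E * dln_norm Om theta N t (f j) ^+ 2
      + ((1 + theta) / 4 * vl2norm Om (u j 1%N) ^+ 2
         + (1 - theta) / 4 * vl2norm Om (u j 0%N) ^+ 2)%R%:E)%E.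
Proof.
exists 1 => // d Om theta F d23 [oOm _ _ bOm] t01.
have [C C0 HC] := b_le_fe oOm bOm (fe_Cinv F) d23.
have [t0 t1] := andP t01.
(* a bound for beta_2 that is uniform in the time grid *)
pose B := (1 + theta) / (2 * (1 - theta)).
have B0 : 0 < B by apply: divr_gt0; [exact: addr_gt0|rewrite mulr_gt0// subr_gt0].
have s0 : 0 < theta * (1 - theta ^+ 2) by rewrite mulr_gt0//; nra.
exists (8 * B ^+ 2 * C ^+ 2 / (theta * (1 - theta ^+ 2))).
  apply: divr_gt0 => //; apply: mulr_gt0; last exact: exprn_gt0.
  by apply: mulr_gt0 => //; exact: exprn_gt0.
move=> h Xh Qh nu T N t J f u p /andP[h0 _] [[Th [[_ cOm _ _] feX feQ]] [_ _ inv _ _]] nu0 tg J1 fd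
  [uX scheme] cfl j M /andP[M2 MN].
have [Xgood Xlin] := fe_velocity_good oOm bOm cOm feX.
have Qlin := fe_pressure_lin oOm bOm feQ.
have XX v : Xh v -> spaceX Om v by move=> /Xgood gv; apply/spaceXP => i; have [] := gv i.
have uXj i n : (n <= N)%N -> Xh (u i n) by move=> nN; have [] := uX i n nN.
(* energy, dissipation and source of one time step *)
pose En n := (1 + theta) / 4 * vl2norm Om (u j n) ^+ 2 + (1 - theta) / 4 * vl2norm Om (u j n.-1) ^+ 2.
pose a n := theta * (1 - theta ^+ 2) / (4 * (1 + eps t n * theta) ^+ 2) * vl2norm Om (diff2 t (u j) n) ^+ 2
  + nu * khat theta t n / 4 * grad_norm Om (avg_beta theta t (u j) n) ^+ 2.
pose g n := (nu^-1%:E * ((step t n + step t n.-1)%:E * dual_norm Om (f j (t_beta theta t n)) ^+ 2))%E.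
have g0 n : (1 <= n < N)%N -> (0 <= g n)%E.
  case: n => // m /andP[_ mN]; rewrite mule_ge0 ?lee_fin ?invr_ge0 ?(ltW nu0)//.
  rewrite mule_ge0 ?sqre_ge0// lee_fin addr_ge0// ltW// (step_gt0 tg)//.
  exact: ltnW.
have stepE n : (1 <= n < N)%N -> ((En n.+1 + a n)%:E <= g n + (En n)%:E)%E.
  case: n => // m /andP[_ mN].
  have mN' := ltnW mN; have mN'' := ltnW mN'.
  have e01 := eps_bound tg mN; have d0 := one_plus_gt0 t01 e01.
  have /andP[k0 _] := khat_bound tg t01 mN.
  have X0 := uXj j m mN''; have X1 := uXj j m.+1 mN'; have X2 := uXj j m.+2 mN.
  have [mom div0] := scheme m.+1 j mN.
  set ub := avg_beta theta t (u j) m.+1 in mom div0.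
  set us := avg_star theta t (u j) m.+1 in mom.
  set um := mean_star theta t u m.+1 in mom.
  have Xub : Xh ub by exact: (Xh_avg_beta Xlin).
  have Xus : Xh us by exact: (Xh_avg_star Xlin).
  have Xum : Xh um.
    by apply: (Xh_mean_star Xlin) => [|i|i]; [exact: ltnW J1|exact: uXj|exact: uXj].
  have Xw : Xh (us - um) by rewrite addrC -scaleN1r; exact: Xlin.
  have Xd : Xh (diff2 t (u j) m.+1) by exact: (Xh_diff2 Xlin).
  have Xal : Xh (avg_alpha theta (u j) m.+1) by rewrite avg_alphaE; exact: (Xh_comb3 Xlin).
  have Qp : Qh (avg_beta theta t (p j) m.+1).
    rewrite avg_betaE; have Qj n : (n <= N)%N -> Qh (p j n) by move=> nN; have [] := uX j n nN.
    by apply: (Xh_comb3 Qlin); exact: Qj.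
  have := mom ub Xub.
  rewrite b_diag (ipC _ (avg_beta theta t (p j) m.+1)) (div0 _ Qp) addr0 subr0.
  rewrite (vipZl oOm _ (Xgood _ Xal) (Xgood _ Xub)).
  (* the form vanishes when its last two arguments agree, so only the part
     of ub - us, a multiple of the second difference, is left *)
  have bE : b Om (us - um) us ub =
      - (2 * beta theta (eps t m.+1) 2 / (1 - eps t m.+1) * b Om (us - um) (diff2 t (u j) m.+1) ub).
    have := b_diag Om (us - um) ub.
    rewrite {1}/ub (avg_beta_star theta (u j) (step_gt0 tg mN') (step_gt0 tg mN)) -/us -/ub.
    rewrite (b_lin oOm bOm _ (Xgood _ Xw) (Xgood _ Xd) (Xgood _ Xus) (Xgood _ Xub)).
    by move/eqP; rewrite addrC addr_eq0 => /eqP.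
  rewrite bE opprK -sqr_grad_norm => momE.
  have bnd := HC h h0 _ _ _ (Xgood _ Xw) (Xgood _ Xd) (Xgood _ Xub) (inv _ Xd).
  have AE := vip_alpha_beta oOm Xgood Xlin (lt0r_neq0 d0) X0 X1 X2.
  have absorb := energy_absorb t01 e01 (beta2_bound t01 e01) B0 C0 k0 h0 nu0
    (vl2norm_ge0 Om (diff2 t (u j) m.+1)) (grad_norm_ge0 Om (us - um)) (grad_norm_ge0 Om ub)
    AE momE bnd (cfl j m.+1 mN).
  (* the inverse inequality *)
  have gradn : grad_norm Om ub != 0 -> vl2norm Om ub != 0.
    apply: contra_neq => v0; apply: grad_norm_eq0.
    by rewrite -(mulr0 (fe_Cinv F * h^-1)) -v0; exact: inv.
  have src := source_le (XX _ Xub) (khat_bound tg t01 mN) nu0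
    ((fd j).1 _ (t_beta_itv tg t01 mN)) gradn.
  apply: (@le_trans _ _ ((khat theta t m.+1 * f j (t_beta theta t m.+1) ub -
     nu * khat theta t m.+1 / 4 * grad_norm Om ub ^+ 2) + En m.+1)%:E).
    by rewrite lee_fin; exact: absorb.
  by rewrite EFinD leeD2r// EFinB leeBlDr.
have := telescope_ereal stepE (M := M); rewrite MN (ltnW M2) => /(_ isT) tel.
apply: le_trans (_ : (En M + \sum_(1 <= n < M) a n)%:E <= _)%E.
  by rewrite lee_fin /a big_split /= addrA.
apply: le_trans tel _; rewrite leeD2r// mul1r.
rewrite sqr_sqrte; last first.
  rewrite big_nat_cond; apply: sume_ge0 => n /andP[nN _].
  by have := g0 n nN; rewrite /g pmule_rge0 ?lte_fin ?invr_gt0.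
rewrite big_nat_cond [X in (_ <= _ * X)%E]big_nat_cond ge0_sume_distrr; last first.
  move=> n /andP[nN _].
  by have := g0 n nN; rewrite /g pmule_rge0 ?lte_fin ?invr_gt0.
rewrite -!big_nat_cond.
rewrite [leRHS](big_cat_nat (ltnW M2) MN) /=.
rewrite leeDl// big_nat_cond; apply: sume_ge0 => n /andP[/andP[Mn nN] _].
by apply: g0; rewrite nN andbT (leq_trans _ Mn)// ltnW.
Qed.
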